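(* Let $N=2n+1$ with $n\ge1$. The torus knot $T(2,N)$ can be parametrized by $$x=T_4(t),\quad y=T_N(t),\quad z=C(t)\qquad(t\in\mathbb R),$$ where $C(t)$ is an odd real polynomial of degree $\deg C=N+2=2n+3$.
   Context: $T_n(t)$ (with one index) is the Chebyshev polynomial $T_n(\cos t)=\cos nt$; $T(2,N)$ is the torus knot of type $(2,N)$. ''Can be parametrized by'' means that there is such a polynomial $C$ for which the map $\mathbb R\to\mathbb R^3$ is an embedding and the knot in $S^3=\mathbb R^3\cup\{\infty\}$ obtained by adding the point at infinity is isotopic to the given knot (knots being unoriented). *)

(* Defs.v *)
From HB Require Import structures.
From mathcomp Require Import all_boot all_order all_algebra.
From mathcomp Require Import all_classical all_reals all_analysis.
From mathcomp Require Import ring.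
Set Implicit Arguments.
Unset Strict Implicit.
Unset Printing Implicit Defensive.
Import Order.TTheory GRing.Theory Num.Theory.
Import numFieldNormedType.Exports.
Local Open Scope classical_set_scope.
Local Open Scope ring_scope.

Fixpoint chebyshevT (R : realType) (n : nat) : {poly R} :=
  match n with
  | 0 => 1
  | 1 => 'X
  | (m.+1 as k).+1 => 2 *: 'X * chebyshevT R k - chebyshevT R m
  end.

(* [chebyshevT R n] is the only polynomial T_n with T_n(cos t) = cos (n t). *)
Lemma chebyshevT_cos (R : realType) (n : nat) (t : R) :
  (chebyshevT R n).[cos t] = cos (n%:R * t).
Proof.
elim/ltn_ind: n => -[|[|n]] IH; first by rewrite hornerC mul0r cos0.
  by rewrite hornerX mul1r.
rewrite [chebyshevT _ _]/= hornerD hornerN hornerM hornerZ hornerX.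
rewrite [X in _ * X - _](IH n.+1) // (IH n) //.
have -> : n.+2%:R * t = n.+1%:R * t + t by rewrite -natr1; ring.
have -> : n%:R * t = n.+1%:R * t - t by rewrite -[n.+1%:R]natr1; ring.
by rewrite cosB cosD; ring.
Qed.

Lemma chebyshevT_unique (R : realType) (n : nat) (p : {poly R}) :
  (forall t : R, p.[cos t] = cos (n%:R * t)) -> p = chebyshevT R n.
Proof.
move=> pE; apply/eqP; rewrite -subr_eq0; apply/negP => /negP nz.
have rt (k : nat) : root (p - chebyshevT R n) (k.+1%:R^-1).
  have k01 : -1 <= (k.+1%:R^-1 : R) <= 1.
    rewrite invf_le1 ?ltr0n // ler1n andbT.
    by rewrite (le_trans (lerN10 R)) // invr_ge0 ler0n.
  by rewrite -(acosK k01) /root hornerD hornerN pE chebyshevT_cos subrr.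
have := max_poly_roots (rs := [seq (k.+1%:R^-1 : R) |
  k <- iota 0 (size (p - chebyshevT R n))]) nz.
rewrite size_map size_iota ltnn => H; suff : false by [].
apply: H; first by apply/allP => _ /mapP[k _ ->]; exact: rt.
rewrite map_inj_uniq ?iota_uniq // => i j /invr_inj /eqP.
by rewrite eqr_nat eqSS => /eqP.
Qed.

Definition vec3 (R : realType) (a b c : R) : 'rV[R]_3 :=
  \row_(i < 3) [:: a; b; c]`_i.

Definition poly_curve (R : realType) (p q r : {poly R}) (t : R) : 'rV[R]_3 :=
  vec3 p.[t] q.[t] r.[t].

(* Smooth embedding of the line: a C^oo immersion that is a homeomorphism onto
   its image. *)
Definition smooth_embedding (R : realType) (f : R -> 'rV[R]_3) : Prop :=
  [/\ forall (k : nat) (t : R), derivable (derive1n k f) t 1,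
      forall t : R, derive1 f t != 0,
      injective f,
      continuous f
    & forall U : set R, open U ->
        exists2 V : set 'rV[R]_3, open V & U = f @^-1` V].

Definition sphere3 (R : realType) : topologicalType :=
  one_point_compactification 'rV[R]_3.

(* The long knot f closed up by the point at infinity [None]. *)
Definition closed_long_knot (R : realType) (f : R -> 'rV[R]_3) :
    set (sphere3 R) :=
  [set None] `|` [set Some (f t) | t in [set: R]].

(* The curve on the torus of radii 2 and 1 winding p times around the z-axis
   and q times around the core circle; the sign of the last coordinate makes
   it the right-handed one. *)
Definition torus_curve (R : realType) (p q : nat) (t : R) : 'rV[R]_3 :=
  vec3 ((2 + cos (q%:R * t)) * cos (p%:R * t))
       ((2 + cos (q%:R * t)) * sin (p%:R * t))
       (- sin (q%:R * t)).

Definition torus_knot (R : realType) (p q : nat) : set (sphere3 R) :=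
  [set Some (torus_curve p q t) | t in [set: R]].

Definition homeomorphism (X Y : topologicalType) (f : X -> Y) : Prop :=
  exists g : Y -> X,
    [/\ cancel f g, cancel g f, continuous f & continuous g].

(* Ambient isotopy of subsets. Mere isotopy through topological embeddings of
   the circle would identify all the knots considered here. *)
Definition isotopic (R : realType) (X : topologicalType) (K L : set X) : Prop :=
  exists H : R -> X -> X,
    [/\ {within `[0, 1]%classic `*` [set: X],
          continuous (fun u : R * X => H u.1 u.2)},
        forall s : R, 0 <= s <= 1 -> homeomorphism (H s),
        forall x : X, H 0 x = x
      & H 1 @` K = L].

(* Main.v *)
Require Import Defs.
From HB Require Import structures.
From mathcomp Require Import all_boot all_order all_algebra.
From mathcomp Require Import all_classical all_reals all_analysis.
From mathcomp Require Import ring lra.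
From mathcomp Require polyrcf.
Set Implicit Arguments.
Unset Strict Implicit.
Unset Printing Implicit Defensive.
Import Order.TTheory GRing.Theory Num.Theory.
Import numFieldNormedType.Exports.
Local Open Scope classical_set_scope.
Local Open Scope ring_scope.

(** The polynomial is $C=(2X^2-1)(\varepsilon T_N+\mu X U_{N-1})$ with $\varepsilon=(-1)^n$ and
    $\mu=1/(4N)$ ([height]). As $T_4$ is even while $T_N$ and $C$ are odd, the curve is invariant
    under the half-turn $(x,y,z)\mapsto(x,-y,-z)$. For $0\le\tau\le\pi/4$ the parameters
    $\pm\cos\tau,\pm\sin\tau$ all have abscissa $\cos 4\tau$, so the closed knot consists of an
    outer strand, an inner strand and their images under the half-turn, with $x$ monotone on each.

    Ambient isotopies are built by hand. A displacement of a set that contracts distances extends by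
    McShane's formula to a contraction $v$ of space, and $\mathrm{id}+v$ is a homeomorphism by
    Banach's fixed point theorem ([ambient_perturb], [iso_small]). Hence a straight-line homotopy is
    realized by an ambient isotopy as soon as, at all times, differences of displacements are at
    most a constant times differences of positions ([iso_linear]). For strands moving inside the
    planes of constant $x$, this says that the segment joining the old and new difference vectors of
    two strands avoids 0, or tends to 0 only linearly where the strands meet ([fib], [iso_strands]).

    The isotopy has four stages. [iso_closed] straightens the polynomial ends to rays and pulls
    infinity to a finite point. [iso_untwisted] is the core: a linear homotopy to a model whose
    strands, seen from a frame of the $yz$-plane rotating by $N\tau$, are
    $\pm\kappa/2\pm(\mu/2)e^{-2iN\tau}$. During the homotopy the sum and the difference of the outer
    and inner $y$-coordinates stay positive multiples of $\cos N\tau\pm\varepsilon\sin N\tau$; where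
    these vanish, the heights at both ends of the homotopy differ in the same sense ([E_nonzero],
    [F_nonzero]). A strand and its own image are treated by [O_nonzero], [I_nonzero] and
    [pair_nonzero]. [iso_rotated] removes the rotation by a twist about the $x$-axis. What is left
    winds twice around the $z$-axis, two points on each half-plane ([rotated_as_pages]), and
    [iso_torus] deforms it linearly into $T(2,N)$: in both closed 2-braids the radial difference on
    the page of angle $2d$ has the sign of $\cos Nd$, and where it vanishes the height differences
    have equal signs.

    For the embedding, $T_4(t)=T_4(u)$ forces $u=\pm t$ or $t^2+u^2=1$, and the last case is
    excluded by the same non-vanishing statements at time 0 of the homotopy
    ([poly_curve_injective]). *)

(** * Ambient isotopies of the one-point compactification of space *)

Definition clamp (R : realType) (s : R) : R := Num.max 0 (Num.min 1 s).

Lemma clamp_itv (R : realType) (s : R) : 0 <= clamp s <= 1.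
Proof. by rewrite /clamp le_max lexx /= ge_max ler01 ge_min lexx. Qed.

Lemma clamp0 (R : realType) : clamp (0 : R) = 0.
Proof. by rewrite /clamp (min_idPr _) ?ler01 // (max_idPr _). Qed.

Lemma clamp1 (R : realType) : clamp (1 : R) = 1.
Proof. by rewrite /clamp (min_idPr _) // (max_idPr _) ?ler01. Qed.

Lemma clamp_continuous (R : realType) : continuous (@clamp R).
Proof.
move=> s; rewrite /clamp.
apply: (@continuous_comp _ _ _ (fun s : R => Num.min 1 s) (fun s => Num.max 0 s)).
  exact: (continuous_min (f := fun=> 1) (g := id) (cvg_cst _) cvg_id).
exact: (continuous_max (f := fun=> 0) (g := id) (cvg_cst _) cvg_id).
Qed.

Lemma pair_continuous (X Y Z : topologicalType) (f : X -> Y) (g : X -> Z) :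
  continuous f -> continuous g -> continuous (fun x => (f x, g x)).
Proof. by move=> cf cg x; exact: (cvg_pair (cf x) (cg x)). Qed.

Lemma comp_continuous (X Y Z : topologicalType) (f : X -> Y) (g : Y -> Z) :
  continuous f -> continuous g -> continuous (fun x => g (f x)).
Proof. by move=> cf cg x; apply: (continuous_comp (cf x)); exact: cg. Qed.

Lemma fst_continuous (X Y : topologicalType) : continuous (@fst X Y).
Proof. by move=> x; exact: cvg_fst. Qed.

Lemma snd_continuous (X Y : topologicalType) : continuous (@snd X Y).
Proof. by move=> x; exact: cvg_snd. Qed.

(** Time runs over the whole line, so no subspace topology is involved and such families compose
    directly; families given on $[0,1]$ are extended by [clamp]. *)
Definition ambient (R : realType) (X : topologicalType) (h : X -> X) : Prop :=
  exists H : R * X -> X,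
    [/\ continuous H, forall s, homeomorphism (fun x => H (s, x)),
        forall x, H (0, x) = x & forall x, H (1, x) = h x].

Lemma homeomorphism_comp (X Y Z : topologicalType) (f : X -> Y) (g : Y -> Z) :
  homeomorphism f -> homeomorphism g -> homeomorphism (g \o f).
Proof.
move=> [f' [fK f'K cf cf']] [g' [gK g'K cg cg']]; exists (f' \o g'); split.
- exact: can_comp.
- exact: can_comp.
- by move=> x; apply: continuous_comp; [exact: cf|exact: cg].
- by move=> x; apply: continuous_comp; [exact: cg'|exact: cf'].
Qed.

Lemma ambient_comp (R : realType) (X : topologicalType) (g h : X -> X) :
  ambient R g -> ambient R h -> ambient R (g \o h).
Proof.
move=> [G [cG hG G0 G1]] [H [cH hH H0 H1]].
exists (fun u => G (u.1, H u)); split.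
- apply: comp_continuous cG; apply: pair_continuous => //.
  exact: fst_continuous.
- by move=> s; apply: (homeomorphism_comp (hH s) (hG s)).
- by move=> x /=; rewrite G0 H0.
- by move=> x /=; rewrite G1 H1.
Qed.

Lemma ambient_homeo (R : realType) (X : topologicalType) (h : X -> X) :
  ambient R h -> homeomorphism h.
Proof.
move=> [H [cH hH H0 H1]]; have := hH 1.
by rewrite (_ : (fun x => H (1, x)) = h) //; apply/funext.
Qed.

Lemma ambient_inv (R : realType) (X : topologicalType) (h g : X -> X) :
  ambient R h -> cancel h g -> ambient R g.
Proof.
move=> ah hg; have := ambient_homeo ah => -[g' [hg' g'h ch cg']].
have gg' : g = g'.
  by apply/funext => x; rewrite -{1}[x]g'h hg.
subst g'; have [H [cH hH H0 H1]] := ah.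
exists (fun u => H (1 - u.1, g u.2)); split.
- apply: comp_continuous cH; apply: pair_continuous.
    move=> u; apply: continuousB; first exact: cvg_cst.
    exact: fst_continuous.
  apply: comp_continuous cg'; exact: snd_continuous.
- move=> s; apply: (@homeomorphism_comp _ _ _ g (fun x => H (1 - s, x))) => //.
  by exists h; split.
- by move=> x /=; rewrite subr0 H1 g'h.
- by move=> x /=; rewrite subrr H0.
Qed.

Lemma ambient_conj (R : realType) (X : topologicalType) (h j k : X -> X) :
  ambient R h -> cancel j k -> cancel k j -> continuous j -> continuous k ->
  ambient R (j \o h \o k).
Proof.
move=> [H [cH hH H0 H1]] jk kj cj ck.
exists (fun u => j (H (u.1, k u.2))); split.
- apply: comp_continuous cj; apply: comp_continuous cH.
  apply: pair_continuous; first exact: fst_continuous.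
  apply: comp_continuous ck; exact: snd_continuous.
- move=> s; apply: (@homeomorphism_comp _ _ _ k (fun x => j (H (s, x)))).
    by exists j; split.
  apply: (@homeomorphism_comp _ _ _ (fun x => H (s, x)) j) => //.
  by exists k; split.
- by move=> x /=; rewrite H0 kj.
- by move=> x /=; rewrite H1.
Qed.

Definition iso (R : realType) (X : topologicalType) (K L : set X) : Prop :=
  exists2 h : X -> X, ambient R h & h @` K = L.

Lemma iso_isotopic (R : realType) (X : topologicalType) (K L : set X) :
  iso R K L -> isotopic R K L.
Proof.
move=> [h [H [cH hH H0 H1]] hK]; exists (fun s x => H (s, x)); split => //.
- apply: continuous_subspaceT => -[s x]; have := @cH (s, x).
  by rewrite (_ : (fun u : R * X => H (u.1, u.2)) = H) //; apply/funext; case.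
- by rewrite -hK; apply: eq_imagel => x _; exact: H1.
Qed.

Lemma iso_trans (R : realType) (X : topologicalType) (K L M : set X) :
  iso R K L -> iso R L M -> iso R K M.
Proof.
move=> [h ah <-] [g ag <-]; exists (g \o h); first exact: ambient_comp.
by rewrite image_comp.
Qed.

Lemma iso_sym (R : realType) (X : topologicalType) (K L : set X) :
  iso R K L -> iso R L K.
Proof.
move=> [h ah <-]; have [g [hg gh ch cg]] := ambient_homeo ah.
exists g; first exact: ambient_inv ah hg.
by rewrite image_comp -[RHS]image_id; apply: eq_imagel => x _ /=; rewrite hg.
Qed.

Lemma iso_homeo (R : realType) (X : topologicalType) (K L : set X) (j : X -> X) :
  homeomorphism j -> iso R (j @` K) (j @` L) -> iso R K L.
Proof.
move=> [k [jk kj cj ck]] [h ah jL]; exists (k \o h \o j).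
  exact: ambient_conj.
rewrite -(image_comp j (k \o h)) -(image_comp h k) jL image_comp.
by rewrite -[RHS]image_id; apply: eq_imagel => x _ /=; rewrite jk.
Qed.

Section real_continuity.
Variables (R : realType) (T : topologicalType).
Implicit Types f g : T -> R.

Lemma contD f g : continuous f -> continuous g -> continuous (fun x => f x + g x).
Proof. by move=> cf cg x; apply: cvgD; [exact: cf|exact: cg]. Qed.

Lemma contB f g : continuous f -> continuous g -> continuous (fun x => f x - g x).
Proof. by move=> cf cg x; apply: cvgB; [exact: cf|exact: cg]. Qed.

Lemma contN f : continuous f -> continuous (fun x => - f x).
Proof. by move=> cf x; apply: cvgN; exact: cf. Qed.

Lemma contM f g : continuous f -> continuous g -> continuous (fun x => f x * g x).
Proof. by move=> cf cg x; apply: cvgM; [exact: cf|exact: cg]. Qed.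

Lemma contV f : (forall x, f x != 0) -> continuous f -> continuous (fun x => (f x)^-1).
Proof. by move=> f0 cf x; apply: cvgV; [exact: f0|exact: cf]. Qed.

Lemma cont_cst (c : R) : continuous (fun _ : T => c).
Proof. by move=> x; exact: cvg_cst. Qed.

Lemma cont_norm f : continuous f -> continuous (fun x => `|f x|).
Proof. by move=> cf x; apply: cvg_norm; exact: cf. Qed.

Lemma cont_max f g : continuous f -> continuous g ->
  continuous (fun x => Num.max (f x) (g x)).
Proof. by move=> cf cg x; exact: (continuous_max (cf x) (cg x)). Qed.

Lemma cont_min f g : continuous f -> continuous g ->
  continuous (fun x => Num.min (f x) (g x)).
Proof. by move=> cf cg x; exact: (continuous_min (cf x) (cg x)). Qed.

Lemma cont_cos f : continuous f -> continuous (fun x => cos (f x)).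
Proof. by move=> cf; apply: comp_continuous cf _; exact: continuous_cos. Qed.

Lemma cont_sin f : continuous f -> continuous (fun x => sin (f x)).
Proof. by move=> cf; apply: comp_continuous cf _; exact: continuous_sin. Qed.

End real_continuity.

Lemma compact_norm_le (R : realType) (M : R) :
  compact [set p : 'rV[R]_3 | `|p| <= M].
Proof.
apply: bounded_closed_compact.
  by exists M; split; [exact: num_real|move=> x Mx p /= pM; rewrite (le_trans pM) // ltW].
have -> : [set p : 'rV[R]_3 | `|p| <= M] = Num.norm @^-1` [set x | x <= M] by [].
have /continuous_closedP := @norm_continuous _ 'rV[R]_3; apply; exact: closed_le.
Qed.

Lemma nbhs_infty (R : realType) (A : set (sphere3 R)) :
  nbhs (None : sphere3 R) A <->
  A None /\ exists M, forall p, M < `|p| -> A (Some p).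
Proof.
split=> [[K [cK _]] KA|[AN [M MA]]].
  split; first by apply: KA; right.
  have [M [_ KM]] := compact_bounded cK.
  exists (M + 1) => p Mp; apply: KA; left; exists p => // Kp.
  have := KM (M + 1) (ltr_pwDr ltr01 (lexx M)) p Kp.
  by apply/negP; rewrite -ltNge.
exists [set p | `|p| <= M].
  by split; [exact: compact_norm_le|apply: compact_closed; [exact: norm_hausdorff|exact: compact_norm_le]].
by move=> _ [[p /= /negP + <-]|->] //; rewrite -ltNge; exact: MA.
Qed.

Lemma sphere3_hausdorff (R : realType) : hausdorff_space (sphere3 R).
Proof.
apply: one_point_compactification_hausdorff; last exact: norm_hausdorff.
move=> x _; exists [set p : 'rV[R]_3 | `|p| <= `|x| + 1].
  rewrite withinET; have := @nbhsx_ballx _ _ x 1 ltr01; apply: filterS => p.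
  rewrite -ball_normE /= => xp.
  have -> : p = x - (x - p) by rewrite opprB addrC subrK.
  by rewrite (le_trans (ler_normB _ _)) // lerD2l ltW.
split; first exact: compact_norm_le.
by apply: compact_closed; [exact: norm_hausdorff|exact: compact_norm_le].
Qed.

(** A continuous bijection of a compact Hausdorff space is closed, so its inverse is continuous. *)
Lemma sphere3_homeo (R : realType) (f g : sphere3 R -> sphere3 R) :
  cancel f g -> cancel g f -> continuous f -> homeomorphism f.
Proof.
move=> fg gf cf; exists g; split=> //; apply/continuous_closedP => A cA.
have -> : g @^-1` A = f @` A.
  apply/seteqP; split=> [x /= Agx|_ [x Ax <-]]; last by rewrite /= fg.
  by exists (g x) => //; rewrite gf.
apply: compact_closed; first exact: sphere3_hausdorff.
apply: continuous_compact; first exact: continuous_subspaceT.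
by apply: (subclosed_compact cA); [exact: one_point_compactification_compact|].
Qed.

Lemma sphere3_homeo_bij (R : realType) (f : sphere3 R -> sphere3 R) :
  bijective f -> continuous f -> homeomorphism f.
Proof. by move=> [g fg gf]; exact: sphere3_homeo fg gf. Qed.

(** Neighbourhoods of infinity are the sets containing infinity and everything outside some ball;
    continuity there is therefore properness, uniform in the parameter. *)
Lemma omap_continuous (R : realType) (T : topologicalType)
    (H : T -> 'rV[R]_3 -> 'rV[R]_3) :
  continuous (fun u : T * 'rV[R]_3 => H u.1 u.2) ->
  (forall B, exists A, forall t p, A < `|p| -> B < `|H t p|) ->
  continuous (fun u : T * sphere3 R => omap (H u.1) u.2 : sphere3 R).
Proof.
move=> cH pH [t [p|]] /= U.
  move=> /(cH (t, p)) [[A B] /= [At Bp] ABU].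
  exists (A, Some @` B) => /=; first by split=> //; exact: one_point_compactification_some_nbhs.
  by move=> [s _] /= [As [q Bq <-]]; exact: (ABU (s, q)).
move=> /nbhs_infty[UN [M MU]].
have [A AH] := pH M.
exists (setT, [set q : sphere3 R | if q is Some p then A < `|p| else True]) => /=.
  split; first exact: (@filterT _ (nbhs t)).
  by apply/nbhs_infty; split => //=; exists A => p Ap /=.
by move=> [s [q|]] //= [_ Aq]; apply: MU; exact: AH.
Qed.

(** The criterion used for all explicit isotopies: joint continuity, uniform properness and
    bijectivity of the stages, all but the first only on $[0,1]$. *)
Lemma ambient_omap (R : realType) (H : R -> 'rV[R]_3 -> 'rV[R]_3) :
  continuous (fun u : R * 'rV[R]_3 => H u.1 u.2) ->
  (forall B, exists A, forall s p, 0 <= s <= 1 -> A < `|p| -> B < `|H s p|) ->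
  (forall s, 0 <= s <= 1 -> bijective (H s)) ->
  (forall p, H 0 p = p) ->
  ambient R (omap (H 1) : sphere3 R -> sphere3 R).
Proof.
move=> cH pH bH H0; exists (fun u => omap (H (clamp u.1)) u.2).
have cK : continuous (fun u : R * sphere3 R =>
    omap (H (clamp u.1)) u.2 : sphere3 R).
  apply: (@omap_continuous R R (fun s => H (clamp s))).
    apply: (@comp_continuous _ _ _
      (fun u : R * 'rV[R]_3 => (clamp u.1, u.2)) _ _ cH).
    apply: pair_continuous; last exact: snd_continuous.
    by apply: comp_continuous (@clamp_continuous R); exact: fst_continuous.
  by move=> B; have [A AH] := pH B; exists A => t p Ap; exact: (AH _ _ (clamp_itv _)).
split=> //.
- move=> s; apply: sphere3_homeo_bij.
    have [g Hg gH] := bH _ (clamp_itv s).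
    by exists (omap g) => -[p|] //=; rewrite ?Hg ?gH.
  have cs : continuous (fun x : sphere3 R => (s, x)).
    by apply: pair_continuous; [exact: (@cst_continuous (sphere3 R) R s)|move=> x; exact: cvg_id].
  exact: comp_continuous cs cK.
- by move=> [p|] //=; rewrite clamp0 H0.
- by move=> [p|] //=; rewrite clamp1.
Qed.

Definition some3 (R : realType) (K : set 'rV[R]_3) : set (sphere3 R) :=
  (Some : 'rV[R]_3 -> sphere3 R) @` K.

HB.instance Definition _ (R : realType) := NormedModule.copy 'rV[R]_3 'rV[R]_3.

Lemma coord_le_norm (R : realType) (p : 'rV[R]_3) (i : 'I_3) :
  `|p ord0 i| <= `|p|.
Proof.
rewrite [leRHS]/Num.norm /= mx_normrE.
by apply/bigmax_geP; right; exists (ord0, i).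
Qed.

Lemma norm_le_coord (R : realType) (p : 'rV[R]_3) (M : R) :
  0 <= M -> (forall i, `|p ord0 i| <= M) -> `|p| <= M.
Proof.
move=> M0 pM; rewrite [leLHS]/Num.norm /= mx_normrE.
by apply/bigmax_leP; split=> // -[i j] _ /=; rewrite ord1.
Qed.

(** * Contracting displacements and straight-line homotopies *)

(** At every stage $p\mapsto p+s\,v(p)$, two points are displaced by amounts differing by less than
    their distance, which gives injectivity. Solving for the preimage of $y$ means finding the fixed
    point of the contraction $p\mapsto y-s\,v(p)$. Properness follows from growth at rate $1-k$. *)
Lemma ambient_perturb (R : realType) (v : 'rV[R]_3 -> 'rV[R]_3) (k : R) :
  0 <= k < 1 -> (forall p q, `|v p - v q| <= k * `|p - q|) ->
  ambient R (omap (fun p => p + v p) : sphere3 R -> sphere3 R).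
Proof.
move=> /andP[k0 k1] kv.
have sv s p q : 0 <= s <= 1 -> `|s *: v p - s *: v q| <= k * `|p - q|.
  move=> /andP[s0 s1]; rewrite -scalerBr normrZ ger0_norm //.
  by rewrite (le_trans _ (kv p q)) // ler_piMl.
have cv : continuous v.
  move=> p; apply/(@cvgrPdist_le _ _ _ (nbhs p)) => e e0.
  apply: filterS (nbhsx_ballx p e e0) => q; rewrite -ball_normE /= => pq.
  rewrite (le_trans (kv p q)) //.
  by rewrite (le_trans (ler_wpM2r _ (ltW k1))) // mul1r ltW.
pose H s p := p + s *: v p.
have -> : (fun p => p + v p) = H 1 by apply/funext => p; rewrite /H scale1r.
apply: (@ambient_omap R H).
- move=> u; apply: continuousD; first exact: snd_continuous.
  apply: (@continuousZ _ _ _ fst (fun u => v u.2)); first exact: fst_continuous.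
  exact: (comp_continuous (@snd_continuous _ _) cv).
- move=> B; exists ((B + `|v 0|) / (1 - k)) => s p s01.
  rewrite ltr_pdivrMr ?subr_gt0 // => Bp.
  have h1 : `|s *: v p| <= `|v 0| + k * `|p|.
    have := sv s p 0 s01; rewrite subr0 => h.
    rewrite -[s *: v p](subrK (s *: v 0)) (le_trans (ler_normD _ _)) //.
    rewrite addrC lerD // normrZ ger0_norm; last by case/andP: s01.
    by rewrite ler_piMl //; case/andP: s01.
  have h2 : `|p| <= `|H s p| + `|s *: v p|.
    by rewrite -{1}[p](addrK (s *: v p)) ler_normB.
  lra.
- move=> s s01.
  have inj : injective (H s).
    move=> p q pq.
    have : (p - q) + (s *: v p - s *: v q) == 0.
      by rewrite addrACA -opprD -/(H s p) -/(H s q) pq subrr.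
    rewrite addr_eq0 opprB => /eqP pqE.
    apply/eqP; rewrite -subr_eq0 -normr_eq0.
    have := sv s q p s01; rewrite -pqE [`|q - p|]distrC => h.
    by have := normr_ge0 (p - q); move: k0 k1 h; move: `|p - q| => z *; nra.
  have sur y : exists p, H s p = y.
    pose f : {fun [set: 'rV[R]_3] >-> [set: 'rV[R]_3]} :=
      totalfun (fun p : 'rV[R]_3 => y - s *: v p).
    have cf : is_contraction f.
      exists (NngNum k0); split=> //= -[p q] _ /=.
      by rewrite opprD opprK addrACA subrr add0r addrC -normrN opprD opprK addrC (le_trans (sv s p q s01)).
    have [p _ pE] := @banach_fixed_point R [the completeNormedModType R of 'rV[R]_3]
      setT f cf closedT (ex_intro _ 0 I).
    by exists p; rewrite /H {1}pE /= subrK.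
  exists (fun y => xget 0 [set p | H s p = y]) => y.
    by apply: inj; case: xgetP => [p _ //|/(_ y)/(_ erefl)].
  by have [p Hp] := sur y; case: xgetP => [q _ //|/(_ p)/(_ Hp)].
- by move=> p; rewrite /H scale0r addr0.
Qed.

Section mcshane.
Variables (R : realType) (T : Type) (D : set T).
Variables (f : T -> 'rV[R]_3) (u : T -> R) (k : R).
Hypotheses (k0 : 0 <= k) (D0 : D !=set0).
Hypothesis uk : forall t t', D t -> D t' -> `|u t - u t'| <= k * `|f t - f t'|.

(** McShane's extension of a Lipschitz function from a subset to the whole space with the same
    constant. The function is given on parameters [t]; hypothesis [uk] forces it to depend only on
    the point [f t]. *)
Definition mcshane (p : 'rV[R]_3) : R :=
  inf [set u t + k * `|p - f t| | t in D].

Let has_inf_mcshane p : has_inf [set u t + k * `|p - f t| | t in D].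
Proof.
have [t0 Dt0] := D0; split; first by exists (u t0 + k * `|p - f t0|), t0.
exists (u t0 - k * `|p - f t0|) => _ [t Dt <-].
have h := uk Dt0 Dt.
have h2 : `|f t0 - f t| <= `|p - f t0| + `|p - f t|.
  by rewrite [in leRHS]distrC -{1}(subrKA p) ler_normD.
have h3 := ler_wpM2l k0 h2; rewrite mulrDr in h3.
have := ler_norm (u t0 - u t); lra.
Qed.

Lemma mcshane_lip p q : `|mcshane p - mcshane q| <= k * `|p - q|.
Proof.
suff W a b : mcshane a - k * `|a - b| <= mcshane b.
  rewrite ler_norml; apply/andP; split.
    have := W q p; rewrite distrC; lra.
  have := W p q; lra.
apply: lb_le_inf; first by have [] := has_inf_mcshane b.
move=> _ [t Dt <-].
have h : mcshane a <= u t + k * `|a - f t|.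
  by apply: ge_inf; [have [] := has_inf_mcshane a|exists t].
have h2 : `|a - f t| <= `|a - b| + `|b - f t|.
  by rewrite -{1}(subrKA b) ler_normD.
have h3 := ler_wpM2l k0 h2; rewrite mulrDr in h3; lra.
Qed.

Lemma mcshane_ext t : D t -> mcshane (f t) = u t.
Proof.
move=> Dt; apply/eqP; rewrite eq_le; apply/andP; split.
  apply: ge_inf; first by have [] := has_inf_mcshane (f t).
  by exists t => //; rewrite subrr normr0 mulr0 addr0.
apply: lb_le_inf; first by have [] := has_inf_mcshane (f t).
move=> _ [s Ds <-]; have := uk Dt Ds; have := ler_norm (u t - u s); lra.
Qed.

End mcshane.

(** The three coordinates of the displacement are extended separately; since the norm is the maximum
    norm, the constant does not increase. *)
Lemma iso_small (R : realType) (T : Type) (D : set T) (f d : T -> 'rV[R]_3) k :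
  0 <= k < 1 ->
  (forall t t', D t -> D t' -> `|d t - d t'| <= k * `|f t - f t'|) ->
  iso R (some3 (f @` D)) (some3 ((fun t => f t + d t) @` D)).
Proof.
move=> k01 dk; have [/eqP D0|/set0P D0] := boolP (D == set0).
  rewrite D0 /some3 !image_set0; exists id; last by rewrite image_set0.
  have -> : id = omap (fun p : 'rV[R]_3 => p + 0) :> (sphere3 R -> sphere3 R).
    by apply/funext => -[p|] //=; rewrite addr0.
  by apply: (@ambient_perturb _ (fun=> 0) k) => // p q; rewrite subrr normr0 mulr_ge0 //; case/andP: k01.
have k0 : 0 <= k by case/andP: k01.
have uk i t t' : D t -> D t' ->
    `|d t ord0 i - d t' ord0 i| <= k * `|f t - f t'|.
  move=> Dt Dt'; apply: le_trans (dk _ _ Dt Dt').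
  by have := coord_le_norm (d t - d t') i; rewrite !mxE.
pose v p : 'rV[R]_3 := \row_i mcshane D f (fun t => d t ord0 i) k p.
have vk p q : `|v p - v q| <= k * `|p - q|.
  apply: norm_le_coord; first by rewrite mulr_ge0.
  move=> i; rewrite !mxE; apply: mcshane_lip => // t t' Dt Dt'; exact: uk.
exists (omap (fun p => p + v p)); first exact: ambient_perturb k01 vk.
rewrite /some3 !image_comp; apply: eq_imagel => t Dt /=; congr Some.
congr (_ + _); apply/rowP => i; rewrite !mxE mcshane_ext // => t1 t2 D1 D2.
exact: uk.
Qed.

(** The substitute for the isotopy extension theorem. The homotopy is cut into more than $|M|$ equal
    steps; each step then displaces the set reached so far with Lipschitz constant below 1, and
    [iso_small] applies. *)
Lemma iso_linear (R : realType) (T : Type) (D : set T) (f g : T -> 'rV[R]_3) M :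
  (forall s t t', 0 <= s <= 1 -> D t -> D t' ->
    `|g t - g t'| <= M * `|(f t + s *: g t) - (f t' + s *: g t')|) ->
  iso R (some3 (f @` D)) (some3 ((fun t => f t + g t) @` D)).
Proof.
move=> Mg; pose m := (Num.truncn `|M|).+1.
have mM : `|M| < m%:R by exact: truncnS_gt.
have m0 : (0 : R) < m%:R by rewrite ltr0n.
suff W i : (0 < i <= m)%N -> iso R (some3 (f @` D))
    (some3 ((fun t => f t + (i%:R / m%:R) *: g t) @` D)).
  have := W m; rewrite leqnn divff ?gt_eqF // => /(_ isT).
  by rewrite (_ : (fun t => f t + 1 *: g t) = fun t => f t + g t) //; apply/funext => t; rewrite scale1r.
have step (j : nat) : (j < m)%N -> forall t t', D t -> D t' ->
    `|m%:R^-1 *: g t - m%:R^-1 *: g t'| <=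
    (`|M| / m%:R) * `|(f t + (j%:R / m%:R) *: g t) - (f t' + (j%:R / m%:R) *: g t')|.
  move=> jm t t' Dt Dt'; rewrite -scalerBr normrZ gtr0_norm ?invr_gt0 //.
  rewrite mulrAC mulrC ler_pM2r ?invr_gt0 //.
  rewrite (le_trans (Mg (j%:R / m%:R) _ _ _ Dt Dt')) ?ler_wpM2r ?ler_norm //.
  by rewrite divr_ge0 ?ler0n //= ler_pdivrMr // mul1r ler_nat ltnW.
have k01 : 0 <= `|M| / m%:R < 1.
  by rewrite divr_ge0 //= ltr_pdivrMr // mul1r.
elim: i => // -[|i] IH /andP[_ im].
  have := iso_small k01 (step 0%N isT); rewrite mul0r mulr1n div1r.
  have E : (fun t => f t + 0 *: g t) = f.
    by apply/funext => t; rewrite scale0r addr0.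
  rewrite E; congr (iso _ _ (some3 (_ @` _))); apply/funext => t.
  by rewrite scale0r addr0.
apply: iso_trans (IH _) _; first by rewrite /= ltnW.
have := iso_small k01 (step i.+1 im).
congr (iso _ _ (some3 (_ @` _))); apply/funext => t.
by rewrite -addrA -scalerDl -[in RHS]natr1 mulrDl div1r.
Qed.

(** * Coordinates, and explicit isotopies: coordinatewise maps, twists, displacing infinity *)

Definition cx (R : realType) (p : 'rV[R]_3) : R := p ord0 (@Ordinal 3 0 isT).
Definition cy (R : realType) (p : 'rV[R]_3) : R := p ord0 (@Ordinal 3 1 isT).
Definition cz (R : realType) (p : 'rV[R]_3) : R := p ord0 (@Ordinal 3 2 isT).

Lemma ord3P (P : 'I_3 -> Prop) :
  P (@Ordinal 3 0 isT) -> P (@Ordinal 3 1 isT) -> P (@Ordinal 3 2 isT) ->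
  forall i, P i.
Proof.
move=> P0 P1 P2 [[|[|[|//]]] i3].
- by rewrite (_ : Ordinal i3 = @Ordinal 3 0 isT) //; exact/val_inj.
- by rewrite (_ : Ordinal i3 = @Ordinal 3 1 isT) //; exact/val_inj.
- by rewrite (_ : Ordinal i3 = @Ordinal 3 2 isT) //; exact/val_inj.
Qed.

Section vec3.
Variable R : realType.
Implicit Types (a b c : R) (p q : 'rV[R]_3).

Lemma cx_vec3 a b c : cx (vec3 a b c) = a. Proof. by rewrite /cx mxE. Qed.
Lemma cy_vec3 a b c : cy (vec3 a b c) = b. Proof. by rewrite /cy mxE. Qed.
Lemma cz_vec3 a b c : cz (vec3 a b c) = c. Proof. by rewrite /cz mxE. Qed.
Definition c_vec3 := (cx_vec3, cy_vec3, cz_vec3).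

Lemma vec3K p : vec3 (cx p) (cy p) (cz p) = p.
Proof. by apply/rowP; apply: ord3P; rewrite mxE. Qed.

Lemma vec3_inj a b c a' b' c' :
  vec3 a b c = vec3 a' b' c' -> [/\ a = a', b = b' & c = c'].
Proof.
move=> e; split.
- by have := congr1 (@cx R) e; rewrite !c_vec3.
- by have := congr1 (@cy R) e; rewrite !c_vec3.
- by have := congr1 (@cz R) e; rewrite !c_vec3.
Qed.

Lemma vec3D a b c a' b' c' :
  vec3 a b c + vec3 a' b' c' = vec3 (a + a') (b + b') (c + c').
Proof. by apply/rowP; apply: ord3P; rewrite !mxE. Qed.

Lemma vec3B a b c a' b' c' :
  vec3 a b c - vec3 a' b' c' = vec3 (a - a') (b - b') (c - c').
Proof. by apply/rowP; apply: ord3P; rewrite !mxE. Qed.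

Lemma vec3Z k a b c : k *: vec3 a b c = vec3 (k * a) (k * b) (k * c).
Proof. by apply/rowP; apply: ord3P; rewrite !mxE. Qed.

Lemma norm_vec3_le a b c M :
  `|a| <= M -> `|b| <= M -> `|c| <= M -> `|vec3 a b c| <= M.
Proof.
move=> aM bM cM; apply: norm_le_coord; first exact: le_trans aM.
by apply: ord3P; rewrite mxE.
Qed.

Lemma le_norm_cx p : `|cx p| <= `|p|. Proof. exact: coord_le_norm. Qed.
Lemma le_norm_cy p : `|cy p| <= `|p|. Proof. exact: coord_le_norm. Qed.
Lemma le_norm_cz p : `|cz p| <= `|p|. Proof. exact: coord_le_norm. Qed.

Lemma norm_gt_vec3 a b c A : 0 <= A -> A < `|vec3 a b c| ->
  [\/ A < `|a|, A < `|b| | A < `|c|].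
Proof.
move=> A0; have [aA|] := ltP A `|a|; first by constructor 1.
have [bA|] := ltP A `|b|; first by constructor 2.
have [cA|] := ltP A `|c|; first by constructor 3.
by move=> h1 h2 h3; rewrite ltNge norm_vec3_le.
Qed.

Lemma cx_continuous : continuous (@cx R). Proof. exact: coord_continuous. Qed.
Lemma cy_continuous : continuous (@cy R). Proof. exact: coord_continuous. Qed.
Lemma cz_continuous : continuous (@cz R). Proof. exact: coord_continuous. Qed.

Lemma vec3_continuous (T : topologicalType) (f g h : T -> R) :
  continuous f -> continuous g -> continuous h ->
  continuous (fun t => vec3 (f t) (g t) (h t)).
Proof.
move=> cf cg ch t; apply/(@cvgrPdist_le _ _ _ (nbhs t)) => e e0.
have /cvgrPdist_le /(_ e e0) hf := cf t.
have /cvgrPdist_le /(_ e e0) hg := cg t.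
have /cvgrPdist_le /(_ e e0) hh := ch t.
near=> u; rewrite vec3B; apply: norm_vec3_le; near: u => //.
Unshelve. all: by end_near. Qed.

End vec3.

Record line_homeo (R : realType) (e : R -> R) : Prop := LineHomeo {
  line_homeo_cont : continuous e;
  line_homeo_mono : {homo e : x y / x < y};
  line_homeo_infty : forall B, exists A, forall x,
    (A < x -> B < e x) /\ (x < - A -> e x < - B) }.

Definition interp (R : realType) (e : R -> R) (s x : R) : R := (1 - s) * x + s * e x.

Lemma conv_gt (R : realType) (s B x y : R) : 0 <= s <= 1 ->
  B < x -> B < y -> B < (1 - s) * x + s * y.
Proof.
move=> /andP[s0 s1] Bx By; have [->|s0'] := eqVneq s 0.
  by rewrite mul0r addr0 subr0 mul1r.
have s_gt0 : 0 < s by rewrite lt_neqAle eq_sym s0'.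
nra.
Qed.

Section interp.
Variables (R : realType) (e : R -> R).
Hypothesis he : line_homeo e.
Let Re := line_homeo_infty he.

Lemma interp_mono s : 0 <= s <= 1 -> {homo interp e s : x y / x < y}.
Proof.
move=> /andP[s0 s1] x y xy; have := line_homeo_mono he xy; rewrite /interp => exy.
have [->|s0'] := eqVneq s 0; first by rewrite !mul0r !addr0 subr0 !mul1r.
have s_gt0 : 0 < s by rewrite lt_neqAle eq_sym s0'.
nra.
Qed.

Lemma interp_cont_joint : continuous (fun u : R * R => interp e u.1 u.2).
Proof.
apply: contD; apply: contM.
- by apply: contB; [exact: cont_cst|exact: fst_continuous].
- exact: snd_continuous.
- exact: fst_continuous.
- exact: (comp_continuous (@snd_continuous _ _) (line_homeo_cont he)).
Qed.

Lemma interp_cont s : continuous (interp e s).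
Proof.
have cs : continuous (fun x : R => (s, x)).
  by apply: pair_continuous; [exact: (@cst_continuous R R s)|move=> x; exact: cvg_id].
exact: (comp_continuous cs interp_cont_joint).
Qed.

Lemma interp_infty B : exists2 A, 0 <= A & forall s x, 0 <= s <= 1 ->
  (A < x -> B < interp e s x) /\ (x < - A -> interp e s x < - B).
Proof.
have [A hA] := Re B; exists (Num.max 0 (Num.max A B)); first by rewrite le_max lexx.
move=> s x s01; rewrite /interp; split.
  by rewrite !gt_max => /and3P[_ Ax Bx]; have [/(_ Ax) h _] := hA x; exact: conv_gt.
rewrite ltrNr !gt_max => /and3P[_ Ax Bx].
have [_ /(_ _) h] := hA x; have {}h := h ltac:(by rewrite ltrNr).
by rewrite ltrNr opprD -!mulrN; apply: conv_gt => //; rewrite ltrNr.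
Qed.

Lemma interp_norm B : exists2 A, 0 <= A & forall s x, 0 <= s <= 1 ->
  A < `|x| -> B < `|interp e s x|.
Proof.
have [A A0 hA] := interp_infty B; exists A => // s x s01.
have [h1 h2] := hA s x s01; rewrite ltr_normr => /orP[/h1 h|].
  by rewrite (lt_le_trans h) // ler_norm.
by rewrite ltrNr => /h2; rewrite ltrNr => h; rewrite ltr_normr h orbT.
Qed.

Lemma interp_surj s y : 0 <= s <= 1 -> exists x, interp e s x = y.
Proof.
move=> s01; have [A A0 hA] := interp_infty `|y|.
have [_ h1] := hA s (- (A + 1)) s01; have [h2 _] := hA s (A + 1) s01.
have {}h1 := h1 ltac:(by rewrite ltrN2 ltrDl). have {}h2 := h2 ltac:(by rewrite ltrDl).
have hle : - (A + 1) <= A + 1 by lra.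
have hc : {within `[- (A + 1), A + 1], continuous (interp e s)}.
  exact/continuous_subspaceT/interp_cont.
have hm : Num.min (interp e s (- (A + 1))) (interp e s (A + 1)) <= y <=
    Num.max (interp e s (- (A + 1))) (interp e s (A + 1)).
  have yy := ler_norm y; have yN : - y <= `|y| by rewrite -normrN ler_norm.
  by rewrite ge_min le_max; apply/andP; split; apply/orP; [left|right]; lra.
by have [x _ xy] := IVT hle hc hm; exists x.
Qed.

End interp.

Definition coord_map (R : realType) (e1 e2 e3 : R -> R) (p : 'rV[R]_3) :=
  vec3 (e1 (cx p)) (e2 (cy p)) (e3 (cz p)).

(** Increasing proper functions form a convex set containing the identity, so each coordinate can be
    moved along [interp]. *)
Lemma ambient_coord_map (R : realType) (e1 e2 e3 : R -> R) :
  line_homeo e1 -> line_homeo e2 -> line_homeo e3 ->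
  ambient R (omap (coord_map e1 e2 e3) : sphere3 R -> sphere3 R).
Proof.
move=> h1 h2 h3.
pose H s := coord_map (interp e1 s) (interp e2 s) (interp e3 s).
have iE e : interp e 1 = e :> (R -> R).
  by apply/funext => x; rewrite /interp subrr mul0r add0r mul1r.
rewrite (_ : coord_map e1 e2 e3 = H 1); last by rewrite /H !iE.
apply: (@ambient_omap R H).
- have c2 e (c : 'rV[R]_3 -> R) : line_homeo e -> continuous c ->
      continuous (fun u : R * 'rV[R]_3 => interp e u.1 (c u.2)).
    move=> he cc; have cu : continuous (fun u : R * 'rV[R]_3 => (u.1, c u.2)).
      apply: pair_continuous; first exact: fst_continuous.
      by apply: (comp_continuous _ cc); exact: snd_continuous.
    exact: (comp_continuous cu (interp_cont_joint he)).
  apply: vec3_continuous; apply: c2 => //.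
  + exact: cx_continuous.
  + exact: cy_continuous.
  + exact: cz_continuous.
- move=> B.
  have [A1 A10 k1] := interp_norm h1 B; have [A2 A20 k2] := interp_norm h2 B.
  have [A3 A30 k3] := interp_norm h3 B.
  exists (Num.max A1 (Num.max A2 A3)) => s p s01; rewrite -{1}(vec3K p).
  move=> /norm_gt_vec3; rewrite le_max A10 => /(_ isT) [].
  + rewrite !gt_max => /andP[/(k1 _ _ s01) h _]; rewrite (lt_le_trans h) //.
    by have := le_norm_cx (H s p); rewrite c_vec3.
  + rewrite !gt_max => /and3P[_ /(k2 _ _ s01) h _]; rewrite (lt_le_trans h) //.
    by have := le_norm_cy (H s p); rewrite c_vec3.
  + rewrite !gt_max => /and3P[_ _ /(k3 _ _ s01) h]; rewrite (lt_le_trans h) //.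
    by have := le_norm_cz (H s p); rewrite c_vec3.
- move=> s s01.
  have inv e : line_homeo e -> exists f, cancel (interp e s) f /\ cancel f (interp e s).
    move=> he; pose f y := xget 0 [set x | interp e s x = y].
    have fK y : interp e s (f y) = y.
      have [x Hx] := interp_surj he y s01.
      by rewrite /f; case: xgetP => [q _ //|/(_ x)/(_ Hx)].
    exists f; split=> // x; have := fK (interp e s x).
    case: (ltgtP (f (interp e s x)) x) => // lt_fx;
      have := interp_mono he s01 lt_fx; move=> /[swap] ->; by rewrite ltxx.
  have [f1 [f1K K1f]] := inv _ h1; have [f2 [f2K K2f]] := inv _ h2.
  have [f3 [f3K K3f]] := inv _ h3.
  exists (coord_map f1 f2 f3) => p; rewrite /H /coord_map !c_vec3.
    by rewrite f1K f2K f3K vec3K.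
  by rewrite K1f K2f K3f vec3K.
- move=> p; rewrite /H /coord_map /interp !subr0 !mul0r !addr0 !mul1r.
  exact: vec3K.
Qed.

Definition plane_rot (R : realType) (a : R) (y z : R) : R * R :=
  (cos a * y - sin a * z, sin a * y + cos a * z).

Definition twist (R : realType) (psi : R -> R) (p : 'rV[R]_3) : 'rV[R]_3 :=
  let q := plane_rot (psi (cx p)) (cy p) (cz p) in vec3 (cx p) q.1 q.2.

Lemma plane_rotK (R : realType) (a y z : R) :
  plane_rot (- a) (plane_rot a y z).1 (plane_rot a y z).2 = (y, z).
Proof.
rewrite /plane_rot /= cosN sinN; have := cos2Dsin2 a => h.
congr (_, _).
  by rewrite -[RHS]mul1r -h; ring.
by rewrite -[RHS]mul1r -h; ring.
Qed.

Lemma twistK (R : realType) (psi : R -> R) :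
  cancel (twist psi) (twist (fun x => - psi x)).
Proof. by move=> p; rewrite /twist !c_vec3 plane_rotK /= vec3K. Qed.

(** A rotation is no isometry for the maximum norm, whence the factor 2. Applied to the inverse
    twist, this bound yields properness. *)
Lemma norm_twist (R : realType) (psi : R -> R) (p : 'rV[R]_3) :
  `|twist psi p| <= `|p| *+ 2.
Proof.
have h a b u v : `|u| <= 1 -> `|v| <= 1 -> `|a| <= `|p| -> `|b| <= `|p| ->
    `|u * a + v * b| <= `|p| *+ 2.
  move=> u1 v1 ap bp; rewrite mulr2n (le_trans (ler_normD _ _)) // !normrM.
  by rewrite lerD // -[leRHS]mul1r ler_pM.
have c1 a : `|cos a : R| <= 1 by rewrite ler_norml cos_geN1 cos_le1.
have s1 a : `|sin a : R| <= 1 by rewrite ler_norml sin_geN1 sin_le1.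
apply: norm_vec3_le.
- by rewrite (le_trans (le_norm_cx p)) // mulr2n lerDl.
- rewrite /= -mulNr; apply: h => //; rewrite ?normrN //; first exact: le_norm_cy.
  exact: le_norm_cz.
- by apply: h => //; [exact: le_norm_cy|exact: le_norm_cz].
Qed.

Lemma ambient_twist (R : realType) (psi : R -> R) : continuous psi ->
  ambient R (omap (twist psi) : sphere3 R -> sphere3 R).
Proof.
move=> cpsi; pose H s := twist (fun x => s * psi x).
rewrite (_ : twist psi = H 1); last first.
  by rewrite /H; congr twist; apply/funext => x; rewrite mul1r.
apply: (@ambient_omap R H).
- have cX := comp_continuous (@snd_continuous R 'rV[R]_3) (@cx_continuous R).
  have cY := comp_continuous (@snd_continuous R 'rV[R]_3) (@cy_continuous R).
  have cZ := comp_continuous (@snd_continuous R 'rV[R]_3) (@cz_continuous R).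
  have ca : continuous (fun u : R * 'rV[R]_3 => u.1 * psi (cx u.2)).
    by apply: contM; [exact: fst_continuous|exact: (comp_continuous cX cpsi)].
  apply: vec3_continuous => //=.
  + by apply: contB; apply: contM => //; [exact: cont_cos|exact: cont_sin].
  + by apply: contD; apply: contM => //; [exact: cont_sin|exact: cont_cos].
- move=> B; exists (B *+ 2) => s p _ Bp.
  have := norm_twist (fun x => - (s * psi x)) (H s p); rewrite /H twistK => h.
  by rewrite -(ltr_pMn2r (isT : (0 < 2)%N)) (lt_le_trans Bp).
- move=> s _; exists (twist (fun x => - (s * psi x))); first exact: twistK.
  rewrite /H => p; have := @twistK _ (fun x => - (s * psi x)) p.
  by rewrite (_ : (fun x => - - _) = fun x => s * psi x) //; apply/funext => x; rewrite opprK.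
- by move=> p; rewrite /H /twist /plane_rot mul0r cos0 sin0 !mul1r !mul0r subr0 add0r vec3K.
Qed.

Section inversion.
Variable R : realType.
Implicit Types p q : 'rV[R]_3.

(** Inversion in the unit sphere of the maximum norm, that is, in a cube. It exchanges 0 and
    infinity and conjugates statements about infinity to statements about the origin. *)
Definition inversion (x : sphere3 R) : sphere3 R :=
  if x is Some p then
    if p == 0 then None else Some (`|p| ^- 2 *: p)
  else Some 0.

Lemma norm_inversion p : p != 0 -> `| `|p| ^- 2 *: p| = `|p|^-1.
Proof.
move=> p0; rewrite normrZ ger0_norm ?invr_ge0 ?exprn_ge0 //.
by rewrite expr2 invfM mulfVK // normr_eq0.
Qed.

Lemma inversionK : involutive inversion.
Proof.
move=> [p|] /=; last by rewrite eqxx.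
have [->|p0] //= := eqVneq p 0.
have np0 : `|p| != 0 by rewrite normr_eq0.
rewrite scaler_eq0 invr_eq0 expf_eq0 /= (negPf np0) (negPf p0) /=.
rewrite norm_inversion // scalerA exprVn invrK divff ?scale1r //.
by rewrite expf_neq0.
Qed.

Lemma inversion_continuous : continuous inversion.
Proof.
move=> [p|]; last first.
  move=> U U0; have : nbhs (0 : 'rV[R]_3) (Some @^-1` U) := U0.
  move=> /nbhs_ballP[e /= e0 eU]; apply/nbhs_infty; split.
    by apply: eU; exact: ballxx.
  exists e^-1 => q eq; have q0 : q != 0.
    rewrite -normr_eq0 gt_eqF // (lt_trans _ eq) // invr_gt0 //.
  rewrite /= (negPf q0); apply: eU.
  rewrite -ball_normE /= sub0r normrN norm_inversion //.
  rewrite -[e]invrK ltf_pV2 ?posrE ?invr_gt0 //.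
  by rewrite (lt_trans _ eq) // invr_gt0.
have [->|p0] := eqVneq p 0.
  move=> U; rewrite /= eqxx => /nbhs_infty[UN [M MU]].
  pose e := (`|M| + 1)^-1.
  have e0 : 0 < e by rewrite invr_gt0 ltr_wpDl.
  apply/nbhs_ballP; exists e => //= q; rewrite -ball_normE /= sub0r normrN => qe.
  have [//|q0] := eqVneq q 0; apply: MU.
  rewrite norm_inversion // (@lt_le_trans _ _ (`|M| + 1)) //.
    by rewrite (le_lt_trans (ler_norm M)) // ltrDl.
  rewrite -[leLHS]invrK lef_pV2 ?posrE ?normr_gt0 ?ltW //.
have cont : {for p, continuous (fun q => `|q| ^- 2 *: q)}.
  apply: (@continuousZ _ _ _ (fun q => `|q| ^- 2) id); last exact: cvg_id.
  have n2 : `|p| ^+ 2 != 0 by rewrite expf_neq0 // normr_eq0.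
  have c2 : (`|q| ^+ 2) @[q --> p] --> `|p| ^+ 2.
    have cn := @norm_continuous _ 'rV[R]_3.
    have := contM cn cn; rewrite (_ : (fun q => _) = fun q : 'rV[R]_3 => `|q| ^+ 2).
      by move=> /(_ p); exact.
    by apply/funext => q; rewrite expr2.
  exact: (cvgV n2 c2).
move=> U /=; rewrite (negPf p0) => pU.
have np0 : 0 < `|p| by rewrite normr_gt0.
have nU := cont _ pU; have nB := nbhsx_ballx p _ np0.
have : nbhs p ((fun q => U (Some (`|q| ^- 2 *: q) : sphere3 R)) `&` ball p `|p|).
  exact: filterI.
apply: filterS => q /= [Uq]; rewrite -ball_normE /= => pq.
case: ifPn => // /eqP q0.
by move: pq; rewrite q0 subr0 ltxx.
Qed.

(** Moves the origin and nothing outside the unit ball. The length $1/2$ makes the displacement a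
    contraction; seen through [inversion], infinity goes to $(2,0,0)$. *)
Definition push p : 'rV[R]_3 := p + Num.max 0 (1 - `|p|) *: vec3 2^-1 0 0.

Lemma ambient_push : ambient R (omap push : sphere3 R -> sphere3 R).
Proof.
apply: (@ambient_perturb _ (fun p => Num.max 0 (1 - `|p|) *: vec3 2^-1 0 0) 2^-1).
  by apply/andP; split; lra.
move=> p q; rewrite -scalerBl normrZ mulrC.
have h1 : `|vec3 2^-1 0 0 : 'rV[R]_3| <= 2^-1.
  by apply: norm_vec3_le; rewrite ?normr0 ?ger0_norm ?invr_ge0.
apply: ler_pM => //.
have h2 := ler_dist_dist p q; have h3 := ler_norm (`|p| - `|q|).
have h4 := ler_norm (`|q| - `|p|); rewrite distrC in h4.
rewrite ler_norml; apply/andP; split;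
  case: (leP 0 (1 - `|p|)); case: (leP 0 (1 - `|q|)); lra.
Qed.

(* Moves the point at infinity to [2 0 0] and bends rays into arcs. *)
Definition close_up : sphere3 R -> sphere3 R :=
  inversion \o omap push \o inversion.

Lemma ambient_close_up : ambient R close_up.
Proof.
apply: ambient_conj; [exact: ambient_push|exact: inversionK|exact: inversionK| |];
  exact: inversion_continuous.
Qed.

Lemma close_up_None : close_up None = Some (vec3 2 0 0).
Proof.
rewrite /close_up /= /push normr0 subr0 (max_idPr _) ?ler01 // add0r scale1r.
have n : `|vec3 2^-1 0 0 : 'rV[R]_3| = 2^-1.
  apply/eqP; rewrite eq_le norm_vec3_le ?normr0 ?ger0_norm ?invr_ge0 //=.
  by have := le_norm_cx (vec3 2^-1 0 0 : 'rV[R]_3); rewrite c_vec3 ger0_norm ?invr_ge0.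
rewrite -normr_eq0 n invr_eq0 pnatr_eq0 /=; congr Some.
by rewrite vec3Z !mulr0; congr vec3; field.
Qed.

Lemma close_up_small p : `|p| <= 1 -> close_up (Some p) = Some p.
Proof.
move=> p1; rewrite /close_up /=; have [->|p0] := eqVneq p 0; first by [].
have np0 : 0 < `|p| by rewrite normr_gt0.
rewrite [omap _ _]/= /push norm_inversion //.
rewrite (max_idPl _) ?scale0r ?addr0; last by rewrite subr_le0 invf_ge1.
by have := inversionK (Some p); rewrite /= (negPf p0).
Qed.

(** On such a ray, and on its images under [inversion] and [push], the maximum norm is the first
    coordinate, so the composite is computed rationally. The image lies on a parabola leading from
    $(1,a,b)$ to $(2,0,0)$. *)
Lemma close_up_ray (t a b : R) : 1 <= t -> `|a| <= 1 -> `|b| <= 1 ->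
  let X := 2 * t / (t + 1) in
  close_up (Some (vec3 t (t * a) (t * b))) =
  Some (vec3 X (a * (X * (2 - X))) (b * (X * (2 - X)))).
Proof.
move=> t1 a1 b1 X; have t0 : 0 < t by lra.
have nvec (x y z : R) : 0 <= x -> `|y| <= x -> `|z| <= x -> `|vec3 x y z| = x.
  move=> x0 yx zx; apply/eqP; rewrite eq_le norm_vec3_le //= ?(ger0_norm x0) //.
  by have := le_norm_cx (vec3 x y z); rewrite c_vec3 ger0_norm.
have nt : `|vec3 t (t * a) (t * b)| = t.
  by rewrite nvec // ?normrM ?(gtr0_norm t0) ?ler_piMr // ltW.
rewrite /close_up /= -normr_eq0 nt gt_eqF // [omap _ _]/= /push vec3Z.
have -> : t ^- 2 * t = t^-1 by field; lra.
have -> : t ^- 2 * (t * a) = t^-1 * a by field; lra.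
have -> : t ^- 2 * (t * b) = t^-1 * b by field; lra.
have tV0 : 0 < t^-1 by rewrite invr_gt0.
have tV1 : t^-1 <= 1 by rewrite invf_le1.
rewrite nvec; [|exact: ltW|by rewrite normrM gtr0_norm // ler_piMr // ltW..].
rewrite (max_idPr _) ?subr_ge0 // vec3Z vec3D !mulr0 !addr0 /=.
have nn : `|vec3 (t^-1 + (1 - t^-1) * 2^-1) (t^-1 * a) (t^-1 * b)| = t^-1 + (1 - t^-1) * 2^-1.
  have h : t^-1 <= t^-1 + (1 - t^-1) * 2^-1 by lra.
  have hy (c : R) : `|c| <= 1 -> `|t^-1 * c| <= t^-1 + (1 - t^-1) * 2^-1.
    by move=> c1; rewrite normrM gtr0_norm //; apply: le_trans h; rewrite ler_piMr // ltW.
  by rewrite nvec //; [lra|exact: hy|exact: hy].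
rewrite -normr_eq0 nn gt_eqF; last by lra.
congr Some; rewrite vec3Z /X; congr vec3; field; lra.
Qed.

End inversion.

(** * Trigonometric inequalities and Lipschitz functions on an interval *)

Section trig_bounds.
Variable R : realType.
Implicit Types x y : R.

Lemma lip1_of_derive (f df : R -> R) : (forall x, is_derive x 1 f (df x)) ->
  (forall x, `|df x| <= 1) -> forall x y, `|f x - f y| <= `|x - y|.
Proof.
move=> fd dfle x y; wlog xy : x y / x <= y.
  move=> W; have [/W //|/ltW/W] := leP x y.
  by rewrite distrC [in leRHS]distrC.
have cf : {within `[x, y], continuous f}.
  apply: continuous_subspaceT => z; apply: differentiable_continuous.
  by apply/derivable1_diffP; have := fd z => -[].
have [c _ fE] := MVT_segment xy (fun z _ => fd z) cf.
by rewrite distrC fE normrM [in leRHS]distrC ler_piMl.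
Qed.

Lemma sin_lip1 x y : `|sin x - sin y| <= `|x - y|.
Proof.
apply: (@lip1_of_derive sin cos) => z.
by rewrite ler_norml cos_geN1 cos_le1.
Qed.

Lemma cos_lip1 x y : `|cos x - cos y| <= `|x - y|.
Proof.
apply: (@lip1_of_derive cos (fun z => - sin z)) => z.
by rewrite normrN ler_norml sin_geN1 sin_le1.
Qed.

(** The derivative of $\sin z-z\cos z$ is $z\sin z\ge0$. *)
Lemma xcos_le_sin x : 0 <= x <= pi -> x * cos x <= sin x.
Proof.
move=> /andP[x0 xpi].
pose f z : R := sin z - z * cos z.
have fd (z : R) : is_derive z (1 : R) f (z * sin z).
  have h1 : is_derive z 1 (sin : R -> R) (cos z) by exact: is_derive_sin.
  have h2 : is_derive z 1 (cos : R -> R) (- sin z) by exact: is_derive_cos.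
  have h3 : is_derive z (1 : R) (id : R -> R) 1 by exact: is_derive_id.
  have h4 := is_deriveB h1 (is_deriveM h3 h2).
  apply: is_derive_eq h4 _.
  by rewrite /GRing.scale /= mulr1; ring.
have cf : {within `[0, x], continuous f}.
  apply: continuous_subspaceT => z; apply: differentiable_continuous.
  by apply/derivable1_diffP; have := fd z => -[].
have [c] := MVT_segment x0 (fun z _ => fd z) cf.
rewrite in_itv /= => /andP[c0 cx] fE.
have f0 : f 0 = 0 by rewrite /f sin0 mul0r subr0.
have s0 : 0 <= sin c by rewrite sin_ge0_pi // c0 (le_trans cx).
have : 0 <= f x by move: fE; rewrite f0 !subr0 => ->; rewrite !mulr_ge0.
by rewrite /f subr_ge0.
Qed.

(** $\sin x=2\sin(x/2)\cos(x/2)\ge x\cos^2(x/2)$, and $\cos^2(x/2)\ge1/2$ because $\cos x\ge0$. This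
    is the source of all linear lower bounds on sines below. *)
Lemma half_le_sin x : 0 <= x <= pi / 2 -> x / 2 <= sin x.
Proof.
move=> /andP[x0 xpi]; have pi2 := @pi_ge2 R.
have h := @xcos_le_sin (x / 2) ltac:(apply/andP; split; lra).
have xE : x = x / 2 + x / 2 by field.
have sE : sin x = 2 * sin (x / 2) * cos (x / 2) by rewrite {1}xE sinD; ring.
have cE : cos x = 2 * cos (x / 2) ^+ 2 - 1.
  by rewrite {1}xE cosD -[X in _ - X]expr2 sin2cos2; ring.
have c0 : 0 <= cos x by apply: cos_ge0_pihalf; apply/andP; split; lra.
have c2 : 0 <= cos (x / 2) by apply: cos_ge0_pihalf; apply/andP; split; lra.
rewrite sE; have := ler_wpM2r c2 h; nra.
Qed.

End trig_bounds.

Section lip.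
Variable R : realType.
Implicit Types (a b : R) (f g : R -> R).

Definition lip a b f := exists2 L, 0 <= L & forall x y,
  a <= x <= b -> a <= y <= b -> `|f x - f y| <= L * `|x - y|.

Lemma lip_cst a b c : lip a b (fun=> c).
Proof. by exists 0 => // x y _ _; rewrite subrr normr0 mul0r. Qed.

Lemma lip_id a b : lip a b id.
Proof. by exists 1 => // x y _ _; rewrite mul1r. Qed.

Lemma lip_eq a b f g : (forall x, a <= x <= b -> f x = g x) -> lip a b f -> lip a b g.
Proof. by move=> fg [L L0 fL]; exists L => // x y ax ay; rewrite -!fg // fL. Qed.

Lemma lip_sub a b a' b' f : a <= a' -> b' <= b -> lip a b f -> lip a' b' f.
Proof.
move=> aa bb [L L0 fL]; exists L => // x y /andP[ax xb] /andP[ay yb].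
by apply: fL; rewrite (le_trans aa) ?(le_trans _ bb).
Qed.

Lemma lipD a b f g : lip a b f -> lip a b g -> lip a b (fun x => f x + g x).
Proof.
move=> [L L0 fL] [M M0 gM]; exists (L + M); first exact: addr_ge0.
move=> x y ax ay; rewrite opprD addrACA (le_trans (ler_normD _ _)) // mulrDl.
by rewrite lerD ?fL ?gM.
Qed.

Lemma lipN a b f : lip a b f -> lip a b (fun x => - f x).
Proof. by move=> [L L0 fL]; exists L => // x y ax ay; rewrite -opprD normrN fL. Qed.

Lemma lipB a b f g : lip a b f -> lip a b g -> lip a b (fun x => f x - g x).
Proof. by move=> lf lg; apply: lipD => //; exact: lipN. Qed.

Lemma lip_bounded a b f : lip a b f ->
  exists2 M, 0 <= M & forall x, a <= x <= b -> `|f x| <= M.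
Proof.
move=> [L L0 fL]; exists (`|f a| + L * `|b - a|).
  by rewrite addr_ge0 ?mulr_ge0.
move=> x /andP[ax xb]; rewrite -[f x](subrK (f a)) addrC.
rewrite (le_trans (ler_normD _ _)) // lerD2l.
have ab := le_trans ax xb.
rewrite (le_trans (fL _ _ _ _)) ?lexx ?ax ?xb ?ab // ler_wpM2l //.
by rewrite !ger0_norm ?subr_ge0 // lerD2r.
Qed.

Lemma lipM a b f g : lip a b f -> lip a b g -> lip a b (fun x => f x * g x).
Proof.
move=> lf lg; have [Mf Mf0 fM] := lip_bounded lf; have [Mg Mg0 gM] := lip_bounded lg.
move: lf lg => [L L0 fL] [M M0 gL]; exists (Mf * M + L * Mg).
  by rewrite addr_ge0 ?mulr_ge0.
move=> x y ax ay.
rewrite (_ : _ - _ = f x * (g x - g y) + (f x - f y) * g y); last by ring.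
rewrite (le_trans (ler_normD _ _)) // !normrM mulrDl lerD //.
  by rewrite -mulrA ler_pM // ?fM ?gL.
by rewrite [leRHS]mulrAC ler_pM // ?fL ?gM.
Qed.

Lemma lip_comp1 a b f (h : R -> R) : (forall x y, `|h x - h y| <= `|x - y|) ->
  lip a b f -> lip a b (fun x => h (f x)).
Proof.
by move=> h1 [L L0 fL]; exists L => // x y ax ay; rewrite (le_trans (h1 _ _)) ?fL.
Qed.

Lemma lip_cos a b f : lip a b f -> lip a b (fun x => cos (f x)).
Proof. by apply: lip_comp1 => x y; exact: cos_lip1. Qed.

Lemma lip_sin a b f : lip a b f -> lip a b (fun x => sin (f x)).
Proof. by apply: lip_comp1 => x y; exact: sin_lip1. Qed.

Lemma lip_norm a b f : lip a b f -> lip a b (fun x => `|f x|).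
Proof. by apply: lip_comp1 => x y; exact: ler_dist_dist. Qed.

Lemma max_cst_lip1 (c x y : R) : `|Num.max x c - Num.max y c| <= `|x - y|.
Proof.
have := ler_norm (x - y); have := ler_norm (y - x); rewrite distrC => h1 h2.
by rewrite ler_norml; apply/andP; split; case: (leP x c); case: (leP y c); lra.
Qed.

Lemma lip_max a b f c : lip a b f -> lip a b (fun x => Num.max (f x) c).
Proof. exact: (lip_comp1 (max_cst_lip1 c)). Qed.

Lemma lip_min a b f c : lip a b f -> lip a b (fun x => Num.min (f x) c).
Proof.
move=> lf; apply: (@lip_eq _ _ (fun x => - Num.max (- f x) (- c))).
  by move=> x _; rewrite oppr_max !opprK.
by apply/lipN/lip_max/lipN.
Qed.

Lemma lip_poly a b f (p : {poly R}) : lip a b f -> lip a b (fun x => p.[f x]).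
Proof.
move=> lf; elim/poly_ind: p => [|p c IH].
  by apply: lip_eq (lip_cst a b 0) => x _; rewrite horner0.
apply: (@lip_eq _ _ (fun x => p.[f x] * f x + c)).
  by move=> x _; rewrite hornerMXaddC.
by apply: lipD; [exact: lipM|exact: lip_cst].
Qed.

Lemma lip_cat a m b f : a <= m <= b -> lip a m f -> lip m b f -> lip a b f.
Proof.
move=> /andP[am mb] [L L0 fL] [M M0 fM].
exists (L + M); first exact: addr_ge0.
move=> x y; wlog xy : x y / x <= y.
  move=> W ax ay; have [/W|/ltW/W] := leP x y; first exact.
  by rewrite distrC [X in _ * X]distrC; exact.
move=> /andP[ax xb] /andP[ay yb]; rewrite mulrDl.
have [ym|my] := leP y m.
  rewrite (le_trans (fL _ _ _ _)) ?ax ?ay ?ym ?(le_trans xy) //.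
  by rewrite lerDl mulr_ge0.
have [mx|xm] := leP m x.
  rewrite (le_trans (fM _ _ _ _)) ?mx ?xb ?yb ?(ltW my) //.
  by rewrite lerDr mulr_ge0.
rewrite -(subrKA (f m)) (le_trans (ler_normD _ _)) // lerD //.
  rewrite (le_trans (fL _ _ _ _)) ?ax ?am ?lexx ?(ltW xm) // ler_wpM2l //.
  by rewrite !ltr0_norm ?subr_lt0 // ?(lt_trans xm) //; lra.
rewrite (le_trans (fM _ _ _ _)) ?(ltW my) ?yb ?mb ?lexx // ler_wpM2l //.
by rewrite !ltr0_norm ?subr_lt0 // ?(lt_trans xm) //; lra.
Qed.

End lip.

(** * Homotopies of four strands inside the planes of constant abscissa *)

Section fiberwise.
Variable R : realType.

Definition pnorm (y z : R) : R := Num.max `|y| `|z|.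

Lemma pnorm_ge0 y z : 0 <= pnorm y z. Proof. by rewrite le_max normr_ge0. Qed.

Lemma pnorm_gt0 y z : ~ (y = 0 /\ z = 0) -> 0 < pnorm y z.
Proof.
move=> h; rewrite lt_max !normr_gt0; apply/orP.
have [y0|] := eqVneq y 0; last by left.
by right; apply/eqP => z0; apply: h.
Qed.

Lemma pnorm_cont (T : topologicalType) (y z : T -> R) :
  continuous y -> continuous z -> continuous (fun t => pnorm (y t) (z t)).
Proof. by move=> cy cz; apply: cont_max; exact: cont_norm. Qed.

Definition seg (s a b : R) : R := (1 - s) * a + s * b.

Lemma seg_cont (T : topologicalType) (s a b : T -> R) : continuous s ->
  continuous a -> continuous b -> continuous (fun t => seg (s t) (a t) (b t)).
Proof.
by move=> cs ca cb; apply: contD; apply: contM => //; apply: contB => //; exact: cont_cst.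
Qed.

(* [fib a b (y0, z0) (y1, z1)]: over [a, b], the segment from (y0, z0) to
   (y1, z1) approaches 0 only as fast as its length goes to 0. *)
Definition fib (a b : R) (y0 z0 y1 z1 : R -> R) := exists2 M, 0 <= M &
  forall t s, a <= t <= b -> 0 <= s <= 1 ->
  pnorm (y1 t - y0 t) (z1 t - z0 t) <=
  M * pnorm (seg s (y0 t) (y1 t)) (seg s (z0 t) (z1 t)).

Lemma fib_cat a m b y0 z0 y1 z1 :
  fib a m y0 z0 y1 z1 -> fib m b y0 z0 y1 z1 -> fib a b y0 z0 y1 z1.
Proof.
move=> [M M0 h] [N N0 k]; exists (M + N); first exact: addr_ge0.
move=> t s /andP[at_ tb] s01; rewrite mulrDl.
have [tm|/ltW mt] := leP t m.
  by rewrite (le_trans (h t s _ s01)) ?at_ ?tm // lerDl mulr_ge0 // pnorm_ge0.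
by rewrite (le_trans (k t s _ s01)) ?tb ?mt // lerDr mulr_ge0 // pnorm_ge0.
Qed.

Lemma positive_lower (T : topologicalType) (K : set T) (f : T -> R) :
  compact K -> continuous f -> (forall t, K t -> 0 < f t) ->
  exists2 c, 0 < c & forall t, K t -> c <= f t.
Proof.
move=> cK cf fpos; have [/eqP K0|/set0P K0] := boolP (K == set0).
  by exists 1 => // t; rewrite K0.
have [c cinK cmin] := compact_EVT_min K0 cK (continuous_subspaceT cf).
by exists (f c) => [|t Kt]; [apply: fpos; rewrite -inE|apply: cmin; rewrite inE].
Qed.

Lemma bounded_upper (T : topologicalType) (K : set T) (f : T -> R) :
  compact K -> continuous f -> exists2 c, 0 <= c & forall t, K t -> f t <= c.
Proof.
move=> cK cf; have [/eqP K0|/set0P K0] := boolP (K == set0).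
  by exists 1 => // t; rewrite K0.
have [c cinK cmax] := compact_EVT_max K0 cK (continuous_subspaceT cf).
exists `|f c| => // t Kt; rewrite (le_trans _ (ler_norm _)) //.
by apply: cmax; rewrite inE.
Qed.

(** If no segment meets the origin, its distance to 0 has a positive minimum over the compact set of
    pairs (time, parameter). *)
Lemma fib_compact a b y0 z0 y1 z1 :
  continuous y0 -> continuous z0 -> continuous y1 -> continuous z1 ->
  (forall t s, a <= t <= b -> 0 <= s <= 1 ->
    ~ (seg s (y0 t) (y1 t) = 0 /\ seg s (z0 t) (z1 t) = 0)) ->
  fib a b y0 z0 y1 z1.
Proof.
move=> cy0 cz0 cy1 cz1 nz.
pose K := `[0, 1]%classic `*` `[a, b]%classic : set (R * R).
have cK : compact K by apply: compact_setX; exact: segment_compact.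
have KP t s : a <= t <= b -> 0 <= s <= 1 -> K (s, t) by split; rewrite /= in_itv.
have c2 f : continuous f -> continuous (fun u : R * R => f u.2 : R).
  by move=> cf; exact: (comp_continuous (@snd_continuous _ _) cf).
have dy0 := c2 _ cy0; have dz0 := c2 _ cz0.
have dy1 := c2 _ cy1; have dz1 := c2 _ cz1.
have [c c0 clow] := @positive_lower _ K
  (fun u => pnorm (seg u.1 (y0 u.2) (y1 u.2)) (seg u.1 (z0 u.2) (z1 u.2))) cK
  ltac:(by apply: pnorm_cont; apply: seg_cont => //; exact: fst_continuous)
  ltac:(by move=> [s t] [/=]; rewrite !in_itv /= => s01 tab; apply: pnorm_gt0; exact: nz).
have [B B0 Bup] := @bounded_upper _ K
  (fun u => pnorm (y1 u.2 - y0 u.2) (z1 u.2 - z0 u.2)) cK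
  ltac:(by apply: pnorm_cont; apply: contB).
exists (B / c); first by rewrite divr_ge0 // ltW.
move=> t s tab s01; have h1 := clow _ (KP _ _ tab s01); have h2 := Bup _ (KP _ _ tab s01).
rewrite (le_trans h2) // -mulrA ler_peMr // mulrC ler_pdivlMr // mul1r //.
Qed.

End fiberwise.

Section fib_zero.
Variable R : realType.

Lemma seg_diff (w a b : R) : seg w a b = a + w * (b - a).
Proof. by rewrite /seg; ring. Qed.

(** For intervals containing a point [z] where two strands meet throughout the homotopy: the length
    of the segment is at most a multiple of $|t-z|$, so a linear lower bound on its distance to 0
    suffices. *)
Lemma fib_near (a b z K : R) (y0 z0 y1 z1 : R -> R) : 0 < K -> a <= z <= b ->
  lip a b y0 -> lip a b z0 -> lip a b y1 -> lip a b z1 ->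
  y0 z = y1 z -> z0 z = z1 z ->
  (forall t s, a <= t <= b -> 0 <= s <= 1 ->
    K * `|t - z| <= pnorm (seg s (y0 t) (y1 t)) (seg s (z0 t) (z1 t))) ->
  fib a b y0 z0 y1 z1.
Proof.
move=> K0 az ly0 lz0 ly1 lz1 yz zz low.
have [L L0 hL] := lipB ly1 ly0; have [M M0 hM] := lipB lz1 lz0.
exists ((L + M) / K); first by rewrite divr_ge0 ?addr_ge0 // ltW.
move=> t s at_ s01; have h := low t s at_ s01.
have n0 := normr_ge0 (t - z).
have h1 := hL t z at_ az; rewrite yz subrr subr0 in h1.
have h2 := hM t z at_ az; rewrite zz subrr subr0 in h2.
apply: le_trans (_ : (L + M) * `|t - z| <= _).
  rewrite /pnorm ge_max; apply/andP; split.
    by rewrite (le_trans h1) // ler_wpM2r //; lra.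
  by rewrite (le_trans h2) // ler_wpM2r //; lra.
rewrite -mulrA ler_wpM2l ?addr_ge0 // mulrC ler_pdivlMr // mulrC //.
Qed.

Lemma cont_horner (T : topologicalType) (p : {poly R}) (f : T -> R) :
  continuous f -> continuous (fun x => p.[f x]).
Proof. by move=> cf; apply: comp_continuous cf _; exact: continuous_horner. Qed.

End fib_zero.

Definition sg (R : realType) (e : bool) : R := (-1) ^+ e.
Arguments sg {R} e.

Lemma sg_neq (R : realType) (e e' : bool) : e != e' -> sg e' = - sg e :> R.
Proof. by rewrite /sg; case: e; case: e' => //=; rewrite ?expr0 ?expr1 ?opprK. Qed.

Section strands.
Variable R : realType.

(* A point of a knot invariant under (x, y, z) -> (x, -y, -z): [u.1.1] selects
   one of the two symmetric copies and [u.1.2] the outer or the inner strand. *)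
Definition strand (X Yo Zo Yi Zi : R -> R) (u : bool * bool * R) : 'rV[R]_3 :=
  let: (e, i, t) := u in
  vec3 (X t) (sg e * (if i then Yi t else Yo t))
             (sg e * (if i then Zi t else Zo t)).

Definition strand_dom (L b : R) : set (bool * bool * R) :=
  [set u | (if u.1.2 then 0 else - L) <= u.2 <= b].

Definition strands L b X Yo Zo Yi Zi : set 'rV[R]_3 :=
  strand X Yo Zo Yi Zi @` strand_dom L b.

Lemma norm_vec3_0 (y z : R) : `|vec3 0 y z| = pnorm y z.
Proof.
apply/eqP; rewrite eq_le /pnorm ge_max; apply/and3P; split.
- by apply: norm_vec3_le; rewrite ?normr0 le_max ?normr_ge0 ?lexx ?orbT.
- by have := le_norm_cy (vec3 0 y z); rewrite c_vec3.
- by have := le_norm_cz (vec3 0 y z); rewrite c_vec3.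
Qed.

Lemma pnormZ (k y z : R) : pnorm (k * y) (k * z) = `|k| * pnorm y z.
Proof. by rewrite /pnorm !normrM maxr_pMr. Qed.

Lemma lip_vec3 (a b : R) (f g h : R -> R) : lip a b f -> lip a b g -> lip a b h ->
  exists2 L, 0 <= L & forall x y, a <= x <= b -> a <= y <= b ->
    `|vec3 (f x) (g x) (h x) - vec3 (f y) (g y) (h y)| <= L * `|x - y|.
Proof.
move=> [L L0 fL] [M M0 gM] [K K0 hK]; exists (L + M + K).
  by rewrite !addr_ge0.
move=> x y ax ay; rewrite vec3B.
have n0 := normr_ge0 (x - y).
apply: norm_vec3_le.
- by rewrite (le_trans (fL _ _ ax ay)) // ler_wpM2r //; lra.
- by rewrite (le_trans (gM _ _ ax ay)) // ler_wpM2r //; lra.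
- by rewrite (le_trans (hK _ _ ax ay)) // ler_wpM2r //; lra.
Qed.

(* Reduces the Lipschitz condition of [iso_linear] to points with the same x. *)
Lemma fibered_estimate (A dA B dB C dC : 'rV[R]_3) (s d c L M : R) :
  0 < c -> 0 <= L -> 0 <= M -> 0 <= s <= 1 ->
  `|A - B| <= L * d -> `|dA - dB| <= L * d ->
  c * d <= `|(A + s *: dA) - (C + s *: dC)| ->
  `|dB - dC| <= M * `|(B + s *: dB) - (C + s *: dC)| ->
  `|dA - dC| <=
    ((L + M * (L + L)) / c + M) * `|(A + s *: dA) - (C + s *: dC)|.
Proof.
move=> c0 L0 M0 /andP[s0 s1] fL gL gap fibM.
set D := `|_ + _ - (_ + _)| in gap *.
have h1 := ler_distD dB dA dC.
have hP : `|(B + s *: dB) - (A + s *: dA)| <= (L + L) * d.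
  rewrite distrC opprD addrACA -scalerBr mulrDl.
  rewrite (le_trans (ler_normD _ _)) // lerD //.
  by rewrite normrZ ger0_norm // (le_trans _ gL) // ler_piMl.
have h2 : `|(B + s *: dB) - (C + s *: dC)| <= (L + L) * d + D.
  have := ler_distD (A + s *: dA) (B + s *: dB) (C + s *: dC);
    move=> /le_trans; apply; rewrite lerD2r; exact: hP.
have h3 : d <= D / c by rewrite ler_pdivlMr // mulrC.
have h4 := ler_wpM2l M0 h2.
rewrite (_ : ((L + M * (L + L)) / c + M) * D = (L + M * (L + L)) * (D / c) + M * D); last by ring.
have h5 := ler_wpM2l (addr_ge0 L0 (mulr_ge0 M0 (addr_ge0 L0 L0))) h3; lra.
Qed.

(** By [fibered_estimate], one of two points can first be slid along its strand to the parameter of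
    the other, at a cost controlled by the gap in [X]. Over one abscissa the difference of two
    points is, up to sign, 0, twice the outer vector, twice the inner vector, or their sum or
    difference; these are the four [fib] hypotheses. *)
Lemma iso_strands (L b c : R) (X Yo0 Zo0 Yi0 Zi0 Yo1 Zo1 Yi1 Zi1 : R -> R) :
  0 <= L -> 0 <= b -> 0 < c -> lip (- L) b X ->
  (forall t t', - L <= t <= b -> - L <= t' <= b -> c * `|t - t'| <= `|X t - X t'|) ->
  lip (- L) b Yo0 -> lip (- L) b Zo0 -> lip (- L) b Yo1 -> lip (- L) b Zo1 ->
  lip 0 b Yi0 -> lip 0 b Zi0 -> lip 0 b Yi1 -> lip 0 b Zi1 ->
  fib (- L) b Yo0 Zo0 Yo1 Zo1 -> fib 0 b Yi0 Zi0 Yi1 Zi1 ->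
  fib 0 b (fun t => Yo0 t + Yi0 t) (fun t => Zo0 t + Zi0 t)
          (fun t => Yo1 t + Yi1 t) (fun t => Zo1 t + Zi1 t) ->
  fib 0 b (fun t => Yo0 t - Yi0 t) (fun t => Zo0 t - Zi0 t)
          (fun t => Yo1 t - Yi1 t) (fun t => Zo1 t - Zi1 t) ->
  iso R (some3 (strands L b X Yo0 Zo0 Yi0 Zi0)) (some3 (strands L b X Yo1 Zo1 Yi1 Zi1)).
Proof.
move=> L0 b0 c0 lX gap lyo0 lzo0 lyo1 lzo1 lyi0 lzi0 lyi1 lzi1.
move=> [Mo Mo0 ho] [Mi Mi0 hi] [Me Me0 he] [Mf Mf0 hf].
pose f (e i : bool) t : 'rV[R]_3 := strand X Yo0 Zo0 Yi0 Zi0 (e, i, t).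
pose g (e i : bool) t : 'rV[R]_3 := strand (fun=> 0) (fun t => Yo1 t - Yo0 t)
  (fun t => Zo1 t - Zo0 t) (fun t => Yi1 t - Yi0 t) (fun t => Zi1 t - Zi0 t) (e, i, t).
have LL : - L <= 0 by rewrite oppr_le0.
have lipfg (i : bool) : exists2 K, 0 <= K & forall e t t',
    (if i then 0 else - L) <= t <= b -> (if i then 0 else - L) <= t' <= b ->
    `|f e i t - f e i t'| <= K * `|t - t'| /\ `|g e i t - g e i t'| <= K * `|t - t'|.
  have key (e : bool) : exists2 K, 0 <= K & forall t t',
    (if i then 0 else - L) <= t <= b -> (if i then 0 else - L) <= t' <= b ->
    `|f e i t - f e i t'| <= K * `|t - t'| /\ `|g e i t - g e i t'| <= K * `|t - t'|.
    have [K1 K10 h1] : exists2 K, 0 <= K & forall t t',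
        (if i then 0 else - L) <= t <= b -> (if i then 0 else - L) <= t' <= b ->
        `|f e i t - f e i t'| <= K * `|t - t'|.
      rewrite /f /=; apply: lip_vec3.
      - by case: (i) => //; exact: lip_sub lX.
      - by apply: lipM; [exact: lip_cst|case: (i)].
      - by apply: lipM; [exact: lip_cst|case: (i)].
    have [K2 K20 h2] : exists2 K, 0 <= K & forall t t',
        (if i then 0 else - L) <= t <= b -> (if i then 0 else - L) <= t' <= b ->
        `|g e i t - g e i t'| <= K * `|t - t'|.
      rewrite /g /=; apply: (@lip_vec3 _ _ (fun=> 0)); first exact: lip_cst.
      - by apply: lipM; [exact: lip_cst|case: (i); exact: lipB].
      - by apply: lipM; [exact: lip_cst|case: (i); exact: lipB].
    exists (K1 + K2) => [|t t' it it']; first exact: addr_ge0.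
    by split; [apply: le_trans (h1 _ _ it it') _|apply: le_trans (h2 _ _ it it') _];
      rewrite ler_wpM2r //; lra.
  have [K K0 hK] := key false; have [K' K'0 hK'] := key true.
  exists (K + K') => [|e t t' it it']; first exact: addr_ge0.
  have [h1 h2] := hK _ _ it it'; have [h1' h2'] := hK' _ _ it it'.
  have n := normr_ge0 (t - t').
  by case: e; split; [apply: le_trans h1' _|apply: le_trans h2' _|
    apply: le_trans h1 _|apply: le_trans h2 _]; rewrite ler_wpM2r //; lra.
pose M := Mo + Mi + Me + Mf.
have M0 : 0 <= M by rewrite !addr_ge0.
have fgE e i t s : f e i t + s *: g e i t =
    vec3 (X t) (sg e * (if i then seg s (Yi0 t) (Yi1 t) else seg s (Yo0 t) (Yo1 t)))
               (sg e * (if i then seg s (Zi0 t) (Zi1 t) else seg s (Zo0 t) (Zo1 t))).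
  by rewrite /f /g /strand vec3Z vec3D /seg; case: i; congr vec3; ring.
have fibM e i e' i' t s : 0 <= s <= 1 -> (if i || i' then 0 else - L) <= t <= b ->
    `|g e i t - g e' i' t| <= M * `|(f e i t + s *: g e i t) - (f e' i' t + s *: g e' i' t)|.
  move=> s01 it; rewrite !fgE vec3B subrr /g /strand vec3B subrr.
  have red (k K y1 z1 y2 z2 y1' z1' y2' z2' : R) : K <= M ->
      y2 = k * y1 -> z2 = k * z1 -> y2' = k * y1' -> z2' = k * z1' ->
      pnorm y1 z1 <= K * pnorm y1' z1' -> `|vec3 0 y2 z2| <= M * `|vec3 0 y2' z2'|.
    move=> KM -> -> -> -> h; rewrite !norm_vec3_0 !pnormZ mulrCA ler_wpM2l //.
    by rewrite (le_trans h) // ler_wpM2r // pnorm_ge0.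
  have it0 : - L <= t <= b.
    by case/andP: it => h ->; rewrite andbT; move: h; case: ifP => // _; exact: le_trans.
  have MoM : Mo <= M by rewrite /M; lra.
  have MiM : Mi <= M by rewrite /M; lra.
  have MeM : Me <= M by rewrite /M; lra.
  have MfM : Mf <= M by rewrite /M; lra.
  move: it; case: i; case: i' => /= it.
  - by apply: (red (sg e - sg e') _ _ _ _ _ _ _ _ _ MiM _ _ _ _ (hi _ _ it s01)); ring.
  - case: (e =P e') => [->|/eqP ee'].
      by apply: (red (- sg e') _ _ _ _ _ _ _ _ _ MfM _ _ _ _ (hf _ _ it s01)); rewrite /seg; ring.
    rewrite (sg_neq R ee').
    by apply: (red (sg e) _ _ _ _ _ _ _ _ _ MeM _ _ _ _ (he _ _ it s01)); rewrite /seg; ring.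
  - case: (e =P e') => [->|/eqP ee'].
      by apply: (red (sg e') _ _ _ _ _ _ _ _ _ MfM _ _ _ _ (hf _ _ it s01)); rewrite /seg; ring.
    rewrite (sg_neq R ee').
    by apply: (red (sg e) _ _ _ _ _ _ _ _ _ MeM _ _ _ _ (he _ _ it s01)); rewrite /seg; ring.
  - by apply: (red (sg e - sg e') _ _ _ _ _ _ _ _ _ MoM _ _ _ _ (ho _ _ it s01)); ring.
have gapfg e i e' i' t t' s : - L <= t <= b -> - L <= t' <= b ->
    c * `|t - t'| <= `|(f e i t + s *: g e i t) - (f e' i' t' + s *: g e' i' t')|.
  move=> it it'; rewrite !fgE vec3B (le_trans (gap _ _ it it')) //.
  by have := le_norm_cx (vec3 (X t - X t') 0 0); rewrite c_vec3 => h; apply: le_trans (le_norm_cx _); rewrite c_vec3.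
have [K K0 hK] := lipfg false; have [K' K'0 hK'] := lipfg true.
pose C := (K + K' + M * ((K + K') + (K + K'))) / c + M.
have sE u : strand X Yo1 Zo1 Yi1 Zi1 u =
    strand X Yo0 Zo0 Yi0 Zi0 u + g u.1.1 u.1.2 u.2.
  by case: u => -[e i] t; rewrite /g /strand vec3D addr0 /=; case: i; congr vec3; ring.
rewrite /strands (_ : strand X Yo1 Zo1 Yi1 Zi1 =
  fun u => strand X Yo0 Zo0 Yi0 Zi0 u + g u.1.1 u.1.2 u.2); last exact/funext.
apply: (@iso_linear R _ _ _ (fun u => g u.1.1 u.1.2 u.2) C).
move=> s [[e i] t] [[e' i'] t'] s01; rewrite /strand_dom /= => it it'.
rewrite -/(f e i t) -/(f e' i' t').
have sub (j : bool) x : (if j then 0 else - L) <= x <= b -> - L <= x <= b.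
  by case/andP=> h ->; rewrite andbT; move: h; case: j => //; exact: le_trans.
have lipK (j : bool) e0 x x' : (if j then 0 else - L) <= x <= b ->
    (if j then 0 else - L) <= x' <= b ->
    `|f e0 j x - f e0 j x'| <= (K + K') * `|x - x'| /\
    `|g e0 j x - g e0 j x'| <= (K + K') * `|x - x'|.
  move=> jx jx'; have n := normr_ge0 (x - x').
  by case: j jx jx' => jx jx'; [have [] := hK' e0 _ _ jx jx'|have [] := hK e0 _ _ jx jx'];
    move=> h1 h2; (split; [apply: le_trans h1 _|apply: le_trans h2 _]); rewrite ler_wpM2r //; lra.
have KK : 0 <= K + K' by rewrite addr_ge0.
(* The inner strand has the shorter parameter interval, so only one of the two points may be
   slidable to the parameter of the other. *)
have [ii|ii] : ((if i then 0 else - L) <= t' <= b) \/ ((if i' then 0 else - L) <= t <= b).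
  move: it it'; case: (i); case: (i') => it it'; [by left| |left|by left].
    by right; exact: (sub true _ it).
  exact: (sub true _ it').
- have [h1 h2] := lipK i e _ _ it ii.
  apply: (fibered_estimate c0 KK M0 s01 h1 h2 (gapfg _ _ _ _ _ _ _ (sub _ _ it) (sub _ _ it'))).
  apply: fibM => //; move: ii it'; rewrite /=; by case: i {it h1 h2}; case: i'.
- have [h1 h2] := lipK i' e' _ _ it' ii.
  rewrite distrC [X in _ <= _ * X]distrC.
  apply: (fibered_estimate c0 KK M0 s01 h1 h2 (gapfg _ _ _ _ _ _ _ (sub _ _ it') (sub _ _ it))).
  apply: fibM => //; move: ii it; rewrite /=; by case: i' {it' h1 h2}; case: i.
Qed.

End strands.

(** * Chebyshev polynomials of both kinds and the height function *)

(* [chebyshevU n] is the Chebyshev polynomial U_(n-1) of the second kind. *)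
Fixpoint chebyshevU (R : realType) (n : nat) : {poly R} :=
  match n with
  | 0 => 0
  | 1 => 1
  | (m.+1 as k).+1 => 2 *: 'X * chebyshevU R k - chebyshevU R m
  end.

Lemma chebyshevTSS (R : realType) (n : nat) :
  chebyshevT R n.+2 = 2 *: 'X * chebyshevT R n.+1 - chebyshevT R n.
Proof. by []. Qed.

Lemma chebyshevUSS (R : realType) (n : nat) :
  chebyshevU R n.+2 = 2 *: 'X * chebyshevU R n.+1 - chebyshevU R n.
Proof. by []. Qed.

Lemma chebyshevU_cos (R : realType) (n : nat) (t : R) :
  (chebyshevU R n).[cos t] * sin t = sin (n%:R * t).
Proof.
elim/ltn_ind: n => -[|[|n]] IH; first by rewrite /= horner0 !mul0r sin0.
  by rewrite /= hornerC !mul1r.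
rewrite chebyshevUSS hornerD hornerN hornerM hornerZ hornerX.
have h1 := IH n.+1 (ltnSn _); have h0 := IH n (ltnW (ltnSn _)).
rewrite mulrBl -[_ * _ * sin t]mulrA h1 h0.
have -> : n.+2%:R * t = n.+1%:R * t + t by rewrite -natr1; ring.
have -> : n%:R * t = n.+1%:R * t - t by rewrite -[n.+1%:R]natr1; ring.
by rewrite sinB sinD; ring.
Qed.

(** The sign relating complementary angles for odd multiples: $\cos N(\pi/2-t)=\varepsilon\sin Nt$
    ([cos_compl]). It enters whenever the parameter $\sin t$ of the inner strand is written as a
    cosine. *)
Definition eps (R : realType) (n : nat) : R := (-1) ^+ n.
Arguments eps {R} n.

Section parity.
Variable R : realType.
Implicit Types (n : nat) (x t : R).

Lemma epsS n : eps n.+1 = - eps n :> R.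
Proof. by rewrite /eps exprS mulN1r. Qed.

Lemma eps_sqr n : eps n * eps n = 1 :> R.
Proof. by rewrite /eps -expr2 sqrr_sign. Qed.

Lemma eps_cases n : (eps n = 1 :> R) \/ (eps n = -1 :> R).
Proof. by rewrite /eps -signr_odd; case: odd; [right|left]; rewrite ?expr1 ?expr0. Qed.

Lemma cosDnpi x n : cos (x + n%:R * pi) = eps n * cos x.
Proof.
elim: n => [|n IH]; first by rewrite mul0r addr0 /eps expr0 mul1r.
by rewrite -natr1 mulrDl mul1r addrA cosDpi IH epsS mulNr.
Qed.

Lemma sinDnpi x n : sin (x + n%:R * pi) = eps n * sin x.
Proof.
elim: n => [|n IH]; first by rewrite mul0r addr0 /eps expr0 mul1r.
by rewrite -natr1 mulrDl mul1r addrA sinDpi IH epsS mulNr.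
Qed.

Lemma odd_pihalf n t : (2 * n + 1)%:R * (pi / 2 - t) =
  pi / 2 - (2 * n + 1)%:R * t + n%:R * pi :> R.
Proof. by rewrite natrD natrM; field. Qed.

Lemma cos_compl n t :
  cos ((2 * n + 1)%:R * (pi / 2 - t)) = eps n * sin ((2 * n + 1)%:R * t).
Proof. by rewrite odd_pihalf cosDnpi addrC cosDpihalf sinN opprK. Qed.

Lemma sin_compl n t :
  sin ((2 * n + 1)%:R * (pi / 2 - t)) = eps n * cos ((2 * n + 1)%:R * t).
Proof. by rewrite odd_pihalf sinDnpi addrC sinDpihalf cosN. Qed.

Lemma cos_pi4_sqr : 2 * (cos (pi / 4) * cos (pi / 4)) = 1 :> R.
Proof.
have := cos2Dsin2 (pi / 4 : R).
have -> : sin (pi / 4) = cos (pi / 4) :> R.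
  by rewrite -cosBpihalf -cosN; congr cos; field.
by rewrite -!expr2 => h; rewrite -[RHS]h; ring.
Qed.

Lemma sin_pi4 : sin (pi / 4) = cos (pi / 4) :> R.
Proof. by rewrite -cosBpihalf -cosN; congr cos; field. Qed.

Lemma cos_pi4_gt0 : 0 < cos (pi / 4) :> R.
Proof. by have := @pi_ge2 R => h; apply: cos_gt0_pihalf; apply/andP; split; lra. Qed.

Lemma cos_eps_pi4 n : cos (eps n * (pi / 4)) = cos (pi / 4) :> R.
Proof. by case: (eps_cases n) => ->; rewrite ?mul1r ?mulN1r ?cosN. Qed.

Lemma sin_eps_pi4 n : sin (eps n * (pi / 4)) = eps n * cos (pi / 4) :> R.
Proof. by case: (eps_cases n) => ->; rewrite ?mul1r ?mulN1r ?sinN sin_pi4. Qed.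

End parity.

Lemma three_term_size (R : realType) (p q : {poly R}) (m : nat) (l : R) :
  (size q < m.+1)%N -> size p = m -> (0 < m)%N -> lead_coef p = l ->
  size (2 *: 'X * p - q) = m.+1 /\ lead_coef (2 *: 'X * p - q) = 2 * l.
Proof.
move=> sq sp m0 lp; have p0 : p != 0 by rewrite -size_poly_gt0 sp.
have sM : size (2 *: 'X * p) = m.+1.
  by rewrite -scalerAl size_scale ?pnatr_eq0 // mulrC size_mulX // sp.
have lt : (size (- q)%R < size (2 *: 'X * p)%R)%N by rewrite size_polyN sM.
split; first by rewrite size_polyDl // sM.
by rewrite lead_coefDl // -scalerAl lead_coefZ lead_coefM lead_coefX mul1r lp.
Qed.

Lemma size_chebyshevT (R : realType) (n : nat) :
  size (chebyshevT R n.+1) = n.+2 /\ lead_coef (chebyshevT R n.+1) = 2 ^+ n.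
Proof.
elim/ltn_ind: n => -[|[|n]] IH.
- by rewrite /= size_polyX lead_coefX expr0.
- rewrite chebyshevTSS exprS expr0.
  by apply: three_term_size; rewrite //= ?size_polyX ?lead_coefX ?size_poly1.
have [s1 l1] := IH n.+1 (ltnSn _); have [s0 _] := IH n (ltnW (ltnSn _)).
by rewrite chebyshevTSS exprS; apply: three_term_size; rewrite // s0.
Qed.

Lemma size_chebyshevU (R : realType) (n : nat) :
  size (chebyshevU R n.+1) = n.+1 /\ lead_coef (chebyshevU R n.+1) = 2 ^+ n.
Proof.
elim/ltn_ind: n => -[|[|n]] IH.
- by rewrite /= size_poly1 lead_coef1 expr0.
- rewrite chebyshevUSS exprS expr0.
  by apply: three_term_size; rewrite //= ?size_poly1 ?lead_coef1 ?size_poly0.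
have [s1 l1] := IH n.+1 (ltnSn _); have [s0 _] := IH n (ltnW (ltnSn _)).
by rewrite chebyshevUSS exprS; apply: three_term_size; rewrite // s0.
Qed.

Lemma chebyshevT_parity (R : realType) (n : nat) (t : R) :
  (chebyshevT R n).[- t] = (-1) ^+ n * (chebyshevT R n).[t].
Proof.
elim/ltn_ind: n => -[|[|n]] IH.
- by rewrite /= !hornerC expr0 mul1r.
- by rewrite /= !hornerX expr1 mulN1r.
rewrite chebyshevTSS !(hornerD, hornerN, hornerM, hornerZ, hornerX).
rewrite (IH n.+1) // (IH n) // !exprS; ring.
Qed.

Lemma chebyshevU_parity (R : realType) (n : nat) (t : R) :
  (chebyshevU R n).[- t] = (-1) ^+ n.+1 * (chebyshevU R n).[t].
Proof.
elim/ltn_ind: n => -[|[|n]] IH.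
- by rewrite /= !horner0 mulr0.
- by rewrite /= !hornerC expr2 mulrNN !mulr1.
rewrite chebyshevUSS !(hornerD, hornerN, hornerM, hornerZ, hornerX).
rewrite (IH n.+1) // (IH n) // !exprS; ring.
Qed.

Lemma chebyshevT_ge1 (R : realType) (n : nat) (t : R) : 1 <= t ->
  1 <= (chebyshevT R n).[t] <= (chebyshevT R n.+1).[t].
Proof.
move=> t1; elim: n => [|n IH]; first by rewrite /= hornerC hornerX lexx.
have := IH; rewrite chebyshevTSS !(hornerD, hornerN, hornerM, hornerZ, hornerX).
move: (chebyshevT R n).[t] (chebyshevT R n.+1).[t] => a b /andP[a1 ab].
apply/andP; split; nra.
Qed.

Section curve.
Variables (R : realType) (n : nat).

Definition dg : nat := (2 * n + 1)%N.
(** Only $\mu>0$ and $\mu N=1/4$ matter: this is small enough for $\mu<\sin 2t$ once $Nt\ge\pi/4$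
    ([sin2_gt_mu]), and for functions of size $\mu$ oscillating with frequency $2N$ to have
    Lipschitz constant $1/2$. *)
Definition mu : R := (4 * dg%:R)^-1.

(* The height function; on t = cos tau it equals
   cos (2 tau) (eps cos (N tau) + mu sin (N tau) / tan tau). *)
Definition height : {poly R} :=
  (2 *: 'X^2 - 1) * (eps n *: chebyshevT R dg + mu *: ('X * chebyshevU R dg)).

Lemma dg_ge1 : 1 <= dg%:R :> R.
Proof. by rewrite ler1n /dg addn1. Qed.

Lemma mu_gt0 : 0 < mu.
Proof. by rewrite invr_gt0 mulr_gt0 ?ltr0n // /dg addn1. Qed.

Lemma mu_dg : mu * dg%:R = 1 / 4.
Proof. by have := dg_ge1 => h; rewrite /mu; field; lra. Qed.

Lemma mu_lt1 : mu < 1.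
Proof. by have := dg_ge1; have := mu_dg; have := mu_gt0; nra. Qed.

Lemma horner_height t : height.[t] =
  (2 * t ^+ 2 - 1) * (eps n * (chebyshevT R dg).[t] + mu * (t * (chebyshevU R dg).[t])).
Proof.
by rewrite /height hornerM !hornerD hornerN !hornerZ hornerXn hornerM hornerX hornerC.
Qed.

Lemma height_odd t : height.[- t] = - height.[t].
Proof.
rewrite !horner_height sqrrN chebyshevT_parity chebyshevU_parity.
have -> : (-1) ^+ dg = -1 :> R by rewrite -signr_odd /dg addn1 /= mul2n odd_double.
have -> : (-1) ^+ dg.+1 = 1 :> R.
  by rewrite exprS -signr_odd /dg addn1 /= mul2n odd_double mulrNN mulr1.
ring.
Qed.

(** $T_N$ and $XU_{N-1}$ both have leading coefficient $2^{N-1}$, so nothing cancels as long as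
    $\varepsilon+\mu\ne0$, which holds because $0<\mu<1$. *)
Lemma size_height : size height = (dg + 2).+1 /\
  lead_coef height = 2 ^+ dg * (eps n + mu).
Proof.
have [sT lT] := size_chebyshevT R (2 * n); have [sU lU] := size_chebyshevU R (2 * n).
have dgE : dg = (2 * n).+1 by rewrite /dg addn1.
have e0 : eps n + mu != 0.
  have := mu_gt0; have := mu_lt1; case: (eps_cases R n) => -> h1 h2.
    by rewrite gt_eqF //; lra.
  by rewrite lt_eqF //; lra.
pose p := eps n *: chebyshevT R dg + mu *: ('X * chebyshevU R dg).
have pE : p = \poly_(i < dg.+1) p`_i.
  apply/polyP => i; rewrite coef_poly; case: ltnP => // di.
  rewrite dgE in di; rewrite /p dgE coefD !coefZ coefXM.
  case: i di => // i di; rewrite [in X in X + _]nth_default ?sT // mulr0 add0r.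
  by rewrite nth_default ?mulr0 // sU.
have pl : p`_dg = 2 ^+ (2 * n) * (eps n + mu).
  have hT : (chebyshevT R dg)`_dg = 2 ^+ (2 * n) by rewrite dgE -lT /lead_coef sT.
  have hU : ('X * chebyshevU R dg)`_dg = 2 ^+ (2 * n).
    by rewrite coefXM dgE /= -lU /lead_coef sU.
  by rewrite /p coefD !coefZ hT hU; ring.
have p1 : p`_dg != 0 by rewrite pl mulf_neq0 // expf_neq0 // pnatr_eq0.
have sp : size p = dg.+1 by rewrite pE size_poly_eq.
have lp : lead_coef p = 2 ^+ (2 * n) * (eps n + mu) by rewrite /lead_coef sp.
have s2 : size (2 *: 'X^2 - 1 : {poly R}) = 3%N.
  by rewrite size_polyDl ?size_scale ?pnatr_eq0 ?size_polyXn // size_polyN size_poly1.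
have l2 : lead_coef (2 *: 'X^2 - 1 : {poly R}) = 2.
  rewrite lead_coefDl ?lead_coefZ ?lead_coefXn ?mulr1 //.
  by rewrite size_polyN size_poly1 size_scale ?pnatr_eq0 // size_polyXn.
rewrite /height -/p; split.
  by rewrite size_mul -?size_poly_gt0 ?s2 ?sp //= addn2.
by rewrite lead_coefM l2 lp dgE exprS mulrA.
Qed.

End curve.

(** * Algebra of the differences between strands at a fixed parameter and time *)

Section algebra.
Variable R : realType.
Variables (c s e st ct G Gi m h w : R).
Hypotheses (ee : e * e = 1) (cs : c * c + s * s = 1) (tt : st * st + ct * ct = 1).
Hypotheses (hG : G * st = ct * s) (hGi : Gi * ct = e * (st * c)).
Hypotheses (st0 : 0 < st) (ct0 : 0 < ct) (m0 : 0 < m) (h0 : 0 <= h).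
Hypotheses (w0 : 0 <= w) (w1 : w <= 1).

Let s_neq0 : e * c = - s \/ e * c = s -> s != 0.
Proof.
move=> H; apply/eqP => s0; have c0 : c = 0.
  by rewrite -[c]mul1r -ee -mulrA; case: H => ->; rewrite s0 ?oppr0 mulr0.
by move: cs; rewrite c0 s0 !mulr0 addr0 => /eqP; rewrite eq_sym oner_eq0.
Qed.

(** Here [c], [s] stand for $\cos Nt,\sin Nt$; [ct], [st] for $\cos t,\sin t$; [G], [Gi] for [GG]
    and [HH]; [h] for $\cos(2t)/k_z$; [w] is the time. When $\varepsilon c=-s$ one finds
    $(G-G_i)\sin t\cos t=s$. Both ends of the segment are then negative multiples of $s$, the first
    one because $m<2\sin t\cos t$. *)
Lemma E_nonzero d : e * c = - s -> m < 2 * (st * ct) -> 0 < h -> 0 < d ->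
  (1 - w) * (h * (e * c + m * G - (s + m * Gi))) + w * (d * (e * c - s)) != 0.
Proof.
move=> ec mst hp d0; apply/eqP => Z.
have eG : (G - Gi) * (st * ct) = s.
  have -> : (G - Gi) * (st * ct) = (G * st) * ct - (Gi * ct) * st by ring.
  rewrite hG hGi; have -> : ct * s * ct - e * (st * c) * st = s * (ct * ct) - (e * c) * (st * st) by ring.
  by rewrite ec -[RHS]mulr1 -tt; ring.
have : s * ((1 - w) * (h * (2 * (st * ct) - m)) + w * (d * 2) * (st * ct)) = 0.
  have -> : s * ((1 - w) * (h * (2 * (st * ct) - m)) + w * (d * 2) * (st * ct)) =
    - (((1 - w) * (h * (e * c + m * G - (s + m * Gi))) + w * (d * (e * c - s))) * (st * ct)
      + (1 - w) * h * m * (s - (G - Gi) * (st * ct))).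
    by rewrite ec; ring.
  by rewrite Z eG subrr mul0r mulr0 addr0 oppr0.
move/eqP; rewrite mulf_eq0 (negPf (s_neq0 (or_introl ec))) /=.
apply/negP; rewrite gt_eqF //.
have k1 : 0 < h * (2 * (st * ct) - m) by rewrite mulr_gt0 // subr_gt0.
have k2 : 0 < d * 2 * (st * ct) by rewrite !mulr_gt0 // ltr0n.
by rewrite -[w * _ * _]mulrA; apply: conv_gt; rewrite ?w0.
Qed.

(** When $\varepsilon c=s$ one finds $(G+G_i)\sin t\cos t=s$, and both ends are positive multiples
    of $s$; the terms now add up, so no bound on $m$ is required. *)
Lemma F_nonzero d : e * c = s -> 0 < h -> 0 < d ->
  (1 - w) * (h * (e * c + m * G + (s + m * Gi))) + w * (d * (e * c + s)) != 0.
Proof.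
move=> ec hp d0; apply/eqP => Z.
have eG : (G + Gi) * (st * ct) = s.
  have -> : (G + Gi) * (st * ct) = (G * st) * ct + (Gi * ct) * st by ring.
  rewrite hG hGi; have -> : ct * s * ct + e * (st * c) * st = s * (ct * ct) + (e * c) * (st * st) by ring.
  by rewrite ec -[RHS]mulr1 -tt; ring.
have : s * ((1 - w) * (h * (2 * (st * ct) + m)) + w * (d * 2) * (st * ct)) = 0.
  have -> : s * ((1 - w) * (h * (2 * (st * ct) + m)) + w * (d * 2) * (st * ct)) =
    ((1 - w) * (h * (e * c + m * G + (s + m * Gi))) + w * (d * (e * c + s))) * (st * ct)
      + (1 - w) * h * m * (s - (G + Gi) * (st * ct)).
    by rewrite ec; ring.
  by rewrite Z eG subrr mul0r mulr0 addr0.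
move/eqP; rewrite mulf_eq0 (negPf (s_neq0 (or_intror ec))) /=.
apply/negP; rewrite gt_eqF //.
have k0 : 0 < st * ct by rewrite mulr_gt0.
have k1 : 0 < h * (2 * (st * ct) + m) by rewrite mulr_gt0 // addr_gt0 // mulr_gt0 // ltr0n.
have k2 : 0 < d * 2 * (st * ct) by rewrite !mulr_gt0 // ltr0n.
by rewrite -[w * _ * _]mulrA; apply: conv_gt; rewrite ?w0.
Qed.

(** Vanishing of the first coordinate gives $Ac=\varepsilon w q_1 s$ with $A>0$. Substituted into
    the second coordinate, this leaves $s$ times a positive quantity. *)
Lemma O_nonzero a p q1 : 0 < a -> 0 < p -> 0 < q1 -> 0 < h ->
  (1 - w) * (a * c) + w * (p * c - e * (q1 * s)) = 0 ->
  (1 - w) * (h * (e * c + m * G)) + w * (e * (p * c) + q1 * s) != 0.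
Proof.
move=> a0 p0 q0 hp Y; apply/eqP => Z.
pose A := (1 - w) * a + w * p.
have A0 : 0 < A by apply: conv_gt; rewrite ?w0.
have Ac : A * c = e * (w * q1 * s) by move: Y; rewrite /A => Y; apply/eqP; rewrite -subr_eq0 -Y; apply/eqP; ring.
have Aec : A * (e * c) = w * q1 * s.
  rewrite (_ : A * (e * c) = e * (A * c)); last by ring.
  by rewrite Ac -[RHS]mul1r -ee; ring.
have s0 : s != 0.
  apply/eqP => s0; move: Ac; rewrite s0 !mulr0 => /eqP.
  rewrite mulf_eq0 gt_eqF //= => /eqP c0.
  by move: cs; rewrite c0 s0 !mulr0 addr0 => /eqP; rewrite eq_sym oner_eq0.
have : s * ((1 - w) * (h * (w * q1 * st + m * (ct * A))) + w * (p * (w * q1) + q1 * A) * st) = 0.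
  transitivity ((((1 - w) * (h * (e * c + m * G)) + w * (e * (p * c) + q1 * s)) * st) * A
     + ((1 - w) * h * st + w * p * st) * (w * q1 * s - A * (e * c))
     + (1 - w) * h * m * A * (ct * s - G * st)); first by ring.
  by rewrite Z Aec hG !subrr !mulr0 !mul0r !addr0.
move/eqP; rewrite mulf_eq0 (negPf s0) /=; apply/negP; rewrite gt_eqF //.
have k1 : 0 < h * (w * q1 * st + m * (ct * A)).
  by rewrite mulr_gt0 // ltr_wpDl ?mulr_gt0 // !mulr_ge0 // ltW.
have k2 : 0 < (p * (w * q1) + q1 * A) * st.
  by rewrite mulr_gt0 // ltr_wpDl ?mulr_gt0 // !mulr_ge0 // ltW.
rewrite -[X in _ + X](mulrA w).
by apply: conv_gt; rewrite ?w0.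
Qed.

(** A combination of the two coordinates that eliminates $s$ and leaves $c$ times a quantity of
    fixed sign. It is stated separately because [fib_inner_origin] uses it quantitatively. *)
Lemma I_combination a p q1 :
  let A := (1 - w) * a + w * p in let B := (1 - w) * h + w * p in
  let Y := (1 - w) * (a * (e * s)) + w * (e * (p * s) - q1 * c) in
  let Z := (1 - w) * (- (h * (s + m * Gi))) + w * (- (p * s) - e * (q1 * c)) in
  (e * B * Y + A * Z) * ct =
  - (e * c) * ((w * q1 * B + A * w * q1) * ct + A * (1 - w) * h * m * st).
Proof.
move=> A B Y Z.
transitivity (- (e * c) * ((w * q1 * B + A * w * q1) * ct + A * (1 - w) * h * m * st)
  + A * (1 - w) * h * m * (e * (st * c) - Gi * ct) + (e * e - 1) * (A * B * s * ct)).
  by rewrite /Y /Z /A /B; ring.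
by rewrite hGi ee !subrr mulr0 mul0r !addr0.
Qed.

Lemma I_nonzero a p q1 : 0 < a -> 0 < p -> 0 < q1 -> 0 < h ->
  (1 - w) * (a * (e * s)) + w * (e * (p * s) - q1 * c) = 0 ->
  (1 - w) * (- (h * (s + m * Gi))) + w * (- (p * s) - e * (q1 * c)) != 0.
Proof.
move=> a0 p0 q0 hp Y; apply/eqP => Z.
have := I_combination a p q1; rewrite /= Y Z !mulr0 addr0 mul0r => /esym/eqP.
pose A := (1 - w) * a + w * p.
have A0 : 0 < A by apply: conv_gt; rewrite ?w0.
pose B := (1 - w) * h + w * p.
have B0 : 0 < B by apply: conv_gt; rewrite ?w0.
have c0 : c != 0.
  apply/eqP => c0; have : e * (A * s) = 0 by rewrite -Y c0 /A; ring.
  move=> /(congr1 (fun x => e * x)); rewrite mulrA ee mul1r mulr0 => /eqP.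
  rewrite mulf_eq0 gt_eqF //= => /eqP s0.
  by move: cs; rewrite c0 s0 !mulr0 addr0 => /eqP; rewrite eq_sym oner_eq0.
have e0 : e != 0 by apply/eqP => e0; move: ee; rewrite e0 mul0r => /eqP; rewrite eq_sym oner_eq0.
rewrite mulf_eq0 oppr_eq0 mulf_eq0 (negPf e0) (negPf c0) /= -/A -/B.
apply/negP; rewrite gt_eqF //.
have k1 : 0 < (q1 * B + A * q1) * ct by rewrite mulr_gt0 // addr_gt0 // mulr_gt0.
have k2 : 0 < A * h * m * st by rewrite !mulr_gt0.
have -> : (w * q1 * B + A * w * q1) * ct + A * (1 - w) * h * m * st =
  (1 - w) * (A * h * m * st) + w * ((q1 * B + A * q1) * ct) by ring.
by apply: conv_gt; rewrite ?w0.
Qed.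

(* Near the left cap the two strands of a pair are closer together than the
   pair is to the axis, so the real part cannot vanish. *)
Lemma pair_nonzero A B : 0 < e * (c * s) -> 0 <= A <= B -> 0 < B ->
  (c + e * s) * B + (c - e * s) * A != 0 /\ (c + e * s) * B - (c - e * s) * A != 0.
Proof.
move=> ecs /andP[A0 AB] B0.
have k : (c - e * s) ^+ 2 < (c + e * s) ^+ 2.
  rewrite -subr_gt0 (_ : _ - _ = 4 * (e * (c * s))); last by ring.
  by rewrite pmulr_rgt0 // ltr0n.
have AB2 : A ^+ 2 <= B ^+ 2 by rewrite lerXn2r ?nnegrE // ltW.
have B2 : 0 < B ^+ 2 by rewrite exprn_gt0.
have sq : ((c + e * s) * B) ^+ 2 != ((c - e * s) * A) ^+ 2.
  rewrite !exprMn gt_eqF //.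
  have := sqr_ge0 (c - e * s); nra.
split; apply: contra sq => /eqP hh; apply/eqP.
  by rewrite (_ : (c + e * s) * B = - ((c - e * s) * A)) ?sqrrN //; apply/eqP; rewrite -addr_eq0 hh.
by rewrite (_ : (c + e * s) * B = (c - e * s) * A) //; apply/eqP; rewrite -subr_eq0 hh.
Qed.

End algebra.

(** * The two ends of the core homotopy *)

Section homotopy.
Variables (R : realType) (n : nat) (T ky kz : R).
Hypotheses (n1 : (1 <= n)%N) (T1 : 1 <= T) (ky0 : 0 < ky) (kz0 : 0 < kz).

Local Notation N := ((dg n)%:R : R).
Local Notation m := (mu R n).
Local Notation e := (eps n : R).
Local Notation q := (cos (pi / 4) : R).
Implicit Types t w : R.

(* The parameter t ranges over [- (2 T - 1), pi / 4]: for 0 <= t the points of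
   the outer and inner strand are those of parameters cos t and sin t, and for
   t <= 0 the outer strand first follows the curve up to parameter T and then
   the closing arc. *)
Definition tau t := Num.max t 0.
Definition ext t := Num.max (- t) 0.
Definition tpar t := cos (tau t) + Num.min (ext t) (T - 1).
Definition bend t := Num.max (ext t - (T - 1)) 0.

(** For $t\ge0$, [XX t] and [yc (4 * t)] are the coordinates of the point of polar angle $a=4t$ on
    the base curve of radius $2-\sin a$. Unlike $\cos 4t$, this abscissa has no critical point at
    $0$ or $\pi/4$, as the gap hypothesis of [iso_strands] demands. *)
Definition XX t := 2 * ext t + cos (4 * tau t) * (2 - sin (4 * tau t)).

(** The term in [bend] is the parabola onto which [bend_ends] maps the straightened ray beyond
    parameter [T]. *)
Definition Yo0 t := (chebyshevT R (dg n)).[tpar t] / ky - bend t * bend t / T.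
Definition Zo0 t := (height R n).[tpar t] / kz - e * (bend t * bend t / T).
Definition Yi0 t := (chebyshevT R (dg n)).[sin t] / ky.
Definition Zi0 t := (height R n).[sin t] / kz.

Definition yc (a : R) := sin a * (2 - sin a).
(** Twice the height of the base curve plus a correction: in the rotated frame the outer strand and
    minus the inner one are at heights $\kappa/2\pm(m/2)\cos 2Nt$, and the absolute value makes one
    of them lie on the base curve and the other on or above it. *)
Definition kap t := 2 * yc (4 * t) + m * `|cos (2 * (N * t))|.
(** [pp] and [qq] are the coefficients obtained by expanding the rotation by $Nt+\varepsilon\pi/4$;
    what matters is $p+q'=q\kappa$ and $p-q'=qm$, where $q'$ is [qq] ([ppDqq], [ppBqq]). *)
Definition pp t := q * (kap t + m) / 2.
Definition qq t := q * (kap t - m) / 2.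

(** [rot_outer] identifies this with the rotation of ([Yo2], [Zo2]) by the angle [psi]; the expanded
    form can be compared with [Yo0] coefficient by coefficient. The last term brings the strand
    linearly to 0 at $t=-(2T-1)$. *)
Definition Yo1 t := pp (tau t) * cos (N * tau t) - e * (qq (tau t) * sin (N * tau t))
  - q * m * (ext t / (2 * T - 1)).
Definition Zo1 t := e * (pp (tau t) * cos (N * tau t)) + qq (tau t) * sin (N * tau t)
  - e * (q * m * (ext t / (2 * T - 1))).
Definition Yi1 t := e * (pp t * sin (N * t)) - qq t * cos (N * t).
Definition Zi1 t := - (pp t * sin (N * t)) - e * (qq t * cos (N * t)).

Let pi2 : 2 <= pi :> R := @pi_ge2 R.
Let N1 : 1 <= N := dg_ge1 R n.
Let m0 : 0 < m := mu_gt0 R n.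
Let mN : m * N = 1 / 4 := mu_dg R n.
Let q0 : 0 < q := cos_pi4_gt0 R.
Let ee : e * e = 1 := eps_sqr R n.
Let T0 : 0 < T := lt_le_trans ltr01 T1.

Ltac slra := have ? := pi2; have ? := m0; have ? := q0; have ? := N1; lra.

Lemma N_ge3 : 3 <= N.
Proof.
by rewrite ler_nat /dg addn1 ltnS (leq_trans _ (leq_mul (leqnn 2) n1)).
Qed.

Lemma tau_id t : 0 <= t -> tau t = t.
Proof. by move=> t0; rewrite /tau (max_idPl _). Qed.

Lemma ext_0 t : 0 <= t -> ext t = 0.
Proof. by move=> t0; rewrite /ext (max_idPr _) // oppr_le0. Qed.

Lemma tau_0 t : t <= 0 -> tau t = 0.
Proof. by move=> t0; rewrite /tau (max_idPr _). Qed.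

Lemma ext_id t : t <= 0 -> ext t = - t.
Proof. by move=> t0; rewrite /ext (max_idPl _) // oppr_ge0. Qed.

Lemma bend_0 t : - (T - 1) <= t -> bend t = 0.
Proof.
move=> t0; rewrite /bend (max_idPr _) // subr_le0 /ext ge_max; apply/andP; split; have ? := T1; lra.
Qed.

Lemma tpar_cos t : 0 <= t -> tpar t = cos t.
Proof. by move=> t0; rewrite /tpar tau_id // ext_0 // (min_idPl _) ?addr0 //; have ? := T1; lra. Qed.

Lemma cos_N_t t : (chebyshevT R (dg n)).[cos t] = cos (N * t).
Proof. exact: chebyshevT_cos. Qed.

Lemma sin_as_cos t : sin t = cos (pi / 2 - t).
Proof. by rewrite -cosN opprB cosBpihalf. Qed.

Lemma chebyshevT_sin t : (chebyshevT R (dg n)).[sin t] = e * sin (N * t).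
Proof. by rewrite sin_as_cos chebyshevT_cos cos_compl. Qed.

(** Polynomial forms of $\sin(Nt)/\tan t$ and, for [HH], of $\varepsilon\cos(Nt)\tan t$, free of
    denominators. *)
Definition GG t := cos t * (chebyshevU R (dg n)).[cos t].
Definition HH t := sin t * (chebyshevU R (dg n)).[sin t].

Lemma GG_sin t : GG t * sin t = cos t * sin (N * t).
Proof. by rewrite /GG -mulrA chebyshevU_cos. Qed.

Lemma HH_cos t : HH t * cos t = e * (sin t * cos (N * t)).
Proof.
rewrite /HH -mulrA [in (chebyshevU R (dg n)).[_]]sin_as_cos.
have <- : sin (pi / 2 - t) = cos t by rewrite -[pi / 2 - t]opprB sinN sinBpihalf opprK.
by rewrite chebyshevU_cos sin_compl mulrCA.
Qed.

Lemma cos2t t : cos (2 * t) = 2 * cos t ^+ 2 - 1.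
Proof.
rewrite (_ : 2 * t = t + t); last by ring.
by rewrite cosD -[X in _ - X]expr2 sin2cos2; ring.
Qed.

Lemma sin2t t : sin (2 * t) = 2 * (sin t * cos t).
Proof. by rewrite (_ : 2 * t = t + t); [rewrite sinD; ring|ring]. Qed.

Lemma height_cos t : (height R n).[cos t] =
  cos (2 * t) * (e * cos (N * t) + m * GG t).
Proof. by rewrite horner_height cos_N_t cos2t. Qed.

Lemma height_sin t : (height R n).[sin t] =
  - (cos (2 * t) * (sin (N * t) + m * HH t)).
Proof.
by rewrite horner_height chebyshevT_sin mulrA ee mul1r cos2t sin2cos2 /HH; ring.
Qed.

Lemma cN_sq t : cos (N * t) * cos (N * t) + sin (N * t) * sin (N * t) = 1.
Proof. by rewrite -!expr2 cos2Dsin2. Qed.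

Lemma c_sq t : sin t * sin t + cos t * cos t = 1.
Proof. by rewrite -!expr2 addrC cos2Dsin2. Qed.

Lemma yc_ge_sin (a : R) : 0 <= a <= pi -> sin a <= yc a.
Proof.
move=> a0; have s0 := sin_ge0_pi a0; have s1 := sin_le1 a; rewrite /yc; nra.
Qed.

Lemma sin_big (a : R) : pi / 2 <= a <= pi -> (pi - a) / 2 <= sin a.
Proof.
move=> /andP[a1 a2].
have -> : sin a = sin (pi - a).
  by rewrite -[pi - a]opprB sinN -{1}(subrK pi a) sinDpi.
by apply: half_le_sin; apply/andP; split; slra.
Qed.

Lemma kap_ge t : 0 <= t <= pi / 4 -> 0 <= yc (4 * t) /\ 2 * yc (4 * t) <= kap t.
Proof.
move=> /andP[t0 t4]; have tt : 0 <= 4 * t <= pi by apply/andP; split; slra.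
have h := yc_ge_sin tt; have h2 := sin_ge0_pi tt; split; first slra.
by rewrite /kap lerDl mulr_ge0 // ltW.
Qed.

Lemma kap_gt0 t : 0 <= t < pi / 4 -> 0 < kap t.
Proof.
move=> /andP[t0 t4]; have [->|tn] := eqVneq t 0.
  by rewrite /kap !mulr0 /yc sin0 mul0r mulr0 add0r cos0 normr1 mulr1.
have tp : 0 < t by rewrite lt_neqAle eq_sym tn.
have tt : 0 < 4 * t < pi by apply/andP; split; slra.
have h := sin_gt0_pi tt.
have [h1 h2] := @kap_ge t ltac:(apply/andP; split; slra).
have := @yc_ge_sin (4 * t) ltac:(apply/andP; split; slra); slra.
Qed.

Lemma kap_quarter : kap (pi / 4) = 0.
Proof.
rewrite /kap (_ : 4 * (pi / 4) = pi); last by field.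
rewrite /yc sinpi mul0r mulr0 add0r.
rewrite (_ : 2 * (N * (pi / 4)) = N * (pi / 2 - 0)); last by field.
by rewrite cos_compl mulr0 sin0 mulr0 normr0 mulr0.
Qed.

Lemma kap_0 : kap 0 = m.
Proof. by rewrite /kap !mulr0 /yc sin0 mul0r mulr0 add0r cos0 normr1 mulr1. Qed.

(* 2 N t with t = pi / 4 - d / N *)
Lemma eps_sin2 t : e * sin (2 * (N * t)) = cos (2 * (N * (pi / 4 - t))).
Proof.
have -> : 2 * (N * (pi / 4 - t)) = N * (pi / 2 - 0) - 2 * (N * t) by field.
by rewrite cosB cos_compl sin_compl mulr0 sin0 cos0; ring.
Qed.

(** The base curve contributes at least $4t$ to $\kappa$, whereas $m|\cos 2Nt|$ falls below $m$ by
    at most $2mNt=t/2$. *)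
Lemma kap_small t : 0 <= t <= pi / 8 -> m + 2 * t <= kap t.
Proof.
move=> /andP[t0 t8].
have [h1 h2] := @kap_ge t ltac:(apply/andP; split; slra).
have h3 := @half_le_sin R (4 * t) ltac:(apply/andP; split; slra).
have h4 := @yc_ge_sin (4 * t) ltac:(apply/andP; split; slra).
have h5 := cos_lip1 0 (2 * (N * t)).
have Nt : 0 <= 2 * (N * t) by rewrite !mulr_ge0 // ler0n.
rewrite cos0 sub0r normrN (ger0_norm Nt) in h5.
have h6 := ler_norm (1 - cos (2 * (N * t))).
have h7 := ler_norm (cos (2 * (N * t))).
have h8 : m * (1 - 2 * (N * t)) <= m * `|cos (2 * (N * t))|.
  by rewrite ler_wpM2l ?(ltW m0) //; slra.
have h9 : m * (1 - 2 * (N * t)) = m - 2 * (m * N) * t by ring.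
rewrite h9 mN in h8; rewrite /kap; slra.
Qed.

(** $\kappa$ can fail to exceed $m$ only near $t=\pi/4$, where the base curve returns to the axis.
    If $N(\pi/4-t)\ge\pi/4$, then $\pi/4-t\ge\pi m$ and the base curve still dominates; otherwise
    $\varepsilon\sin 2Nt=\cos 2N(\pi/4-t)>0$. *)
Lemma kap_or t : 0 < t <= pi / 4 -> m < kap t \/ 0 < e * (cos (N * t) * sin (N * t)).
Proof.
move=> /andP[t0 t4].
have [h1 h2] := @kap_ge t ltac:(apply/andP; split; slra).
have [t8|t8] := leP t (pi / 8).
  left; have := @kap_small t ltac:(apply/andP; split; slra); slra.
have [far|near_] := leP (pi / 4) (N * (pi / 4 - t)); last first.
  right; have : 0 < e * sin (2 * (N * t)).
    have p1 : 0 <= N * (pi / 4 - t) by rewrite mulr_ge0 ?subr_ge0 ?ler0n.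
    by rewrite eps_sin2; apply: cos_gt0_pihalf; apply/andP; split; slra.
  rewrite sin2t (_ : e * (2 * (sin (N * t) * cos (N * t))) =
    2 * (e * (cos (N * t) * sin (N * t)))); last by ring.
  by rewrite pmulr_rgt0 // ltr0n.
left; have h3 := @sin_big (4 * t) ltac:(apply/andP; split; slra).
have h4 := @yc_ge_sin (4 * t) ltac:(apply/andP; split; slra).
have h5 : m * (pi / 4) <= m * N * (pi / 4 - t) by rewrite -mulrA ler_wpM2l // ltW.
rewrite mN in h5.
have h6 : 0 <= m * `|cos (2 * (N * t))| by rewrite mulr_ge0 // ltW.
have h7 : m * 2 <= m * pi by rewrite ler_wpM2l // ltW.
slra.
Qed.

End homotopy.

(** * No two strands collide during the core homotopy *)

Section fibers.
Variables (R : realType) (n : nat) (T ky kz : R).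
Hypotheses (n1 : (1 <= n)%N) (T1 : 1 <= T) (ky0 : 0 < ky) (kz0 : 0 < kz).

Local Notation N := ((dg n)%:R : R).
Local Notation m := (mu R n).
Local Notation e := (eps n : R).
Local Notation q := (cos (pi / 4) : R).
Local Notation cN := (fun t : R => cos (N * t)).
Local Notation sN := (fun t : R => sin (N * t)).
Implicit Types t w : R.

Let pi2 : 2 <= pi :> R := @pi_ge2 R.
Let N3 : 3 <= N := N_ge3 R n1.
Let m0 : 0 < m := mu_gt0 R n.
Let mN : m * N = 1 / 4 := mu_dg R n.
Let q0 : 0 < q := cos_pi4_gt0 R.
Let ee : e * e = 1 := eps_sqr R n.
Let T0 : 0 < T := lt_le_trans ltr01 T1.
Let kyV0 : 0 < ky^-1. Proof. by rewrite invr_gt0. Qed.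
Let kzV0 : 0 < kz^-1. Proof. by rewrite invr_gt0. Qed.

Ltac facts := have ? := pi2; have ? := m0; have ? := q0.
Ltac slra := facts; lra.

Let L := 2 * T - 1.

Lemma Yo0E t : 0 <= t -> Yo0 n T ky t = ky^-1 * cN t.
Proof.
move=> t0; rewrite /Yo0 tpar_cos // bend_0 //; last by have ? := T1; lra.
by rewrite chebyshevT_cos !mul0r subr0 mulrC.
Qed.

Lemma Zo0E t : 0 <= t -> Zo0 n T kz t = cos (2 * t) / kz * (e * cN t + m * GG n t).
Proof.
move=> t0; rewrite /Zo0 tpar_cos // bend_0 //; last by have ? := T1; lra.
by rewrite height_cos !mul0r mulr0 subr0 mulrAC.
Qed.

Lemma Yi0E t : Yi0 n ky t = ky^-1 * (e * sN t).
Proof. by rewrite /Yi0 chebyshevT_sin mulrC. Qed.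

Lemma Zi0E t : Zi0 n kz t = - (cos (2 * t) / kz * (sN t + m * HH n t)).
Proof. by rewrite /Zi0 height_sin mulNr mulrAC. Qed.

Lemma Yo1E t : 0 <= t -> Yo1 n T t = pp n t * cN t - e * (qq n t * sN t).
Proof. by move=> t0; rewrite /Yo1 tau_id // ext_0 // mul0r mulr0 subr0. Qed.

Lemma Zo1E t : 0 <= t -> Zo1 n T t = e * (pp n t * cN t) + qq n t * sN t.
Proof. by move=> t0; rewrite /Zo1 tau_id // ext_0 // mul0r !mulr0 subr0. Qed.

Lemma ppDqq t : pp n t + qq n t = q * kap n t.
Proof. by rewrite /pp /qq; field. Qed.

Lemma ppBqq t : pp n t - qq n t = q * m.
Proof. by rewrite /pp /qq; field. Qed.

Lemma quarter_eq : cN (pi / 4) = e * sN (pi / 4).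
Proof.
have := cos_compl n (pi / 4 : R); rewrite (_ : pi / 2 - pi / 4 = pi / 4) //; by field.
Qed.

Lemma cN_sN_neq0 t : ~ (cN t = 0 /\ sN t = 0).
Proof. by move=> [c0 s0]; have := cN_sq n t; rewrite c0 s0 !mulr0 addr0 => /eqP; rewrite eq_sym oner_eq0. Qed.

(* On [0, pi / (4 N)) the cosine dominates. *)
Lemma sq_lt_of_small t : 0 <= t -> N * t < pi / 4 -> sN t ^+ 2 < cN t ^+ 2.
Proof.
move=> t0 Nt; have Nt0 : 0 <= N * t by rewrite mulr_ge0 // (le_trans _ N3).
have : 0 < cos (2 * (N * t)) by apply: cos_gt0_pihalf; apply/andP; split; slra.
rewrite cos2t; have := cos2Dsin2 (N * t); move: (cos _) (sin _) => c s; lra.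
Qed.

(** $\sin 2t\ge t\ge\pi/(4N)=\pi m>m$. *)
Lemma sin2_gt_mu t : pi / 4 <= N * t -> t <= pi / 4 -> m < 2 * (sin t * cos t).
Proof.
move=> Nt t4; have t0 : 0 < t.
  by rewrite -(pmulr_rgt0 _ (lt_le_trans _ N3)) //; slra.
rewrite -sin2t; have := @half_le_sin R (2 * t) ltac:(apply/andP; split; slra) => h.
have h2 : m * (pi / 4) <= m * N * t by rewrite -mulrA ler_wpM2l // ltW.
rewrite mN in h2; have h3 : m * 2 <= m * pi by rewrite ler_wpM2l // ltW.
slra.
Qed.

Lemma cos2_ge t : t <= pi / 4 -> 0 <= t -> pi / 4 - t <= cos (2 * t).
Proof.
move=> t4 t0; have := @half_le_sin R (pi / 2 - 2 * t) ltac:(apply/andP; split; have ? := pi2; lra).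
by rewrite -[pi / 2 - _]opprB sinN sinBpihalf opprK => h; have ? := pi2; lra.
Qed.

Lemma cos_sin_gt0 t : 0 < t <= pi / 4 -> 0 < sin t /\ 0 < cos t.
Proof.
move=> /andP[t0 t4]; split; first by apply: sin_gt0_pihalf; apply/andP; split; have ? := pi2; lra.
by apply: cos_gt0_pihalf; apply/andP; split; have ? := pi2; lra.
Qed.

Lemma pp_gt0 t : 0 <= t <= pi / 4 -> 0 < pp n t.
Proof.
move=> tt; have [h1 h2] := kap_ge n tt; rewrite /pp !mulr_gt0 //.
by facts; lra.
Qed.

(** The first coordinate of the sum is at all times a positive multiple of $c+\varepsilon s$. So the
    crossings of these two strands in the $xy$-projection stay fixed, and only their over/under
    information has to be compared. *)
Lemma E_neq0 t w : 0 <= t <= pi / 4 -> 0 <= w <= 1 ->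
  ~ (seg w (Yo0 n T ky t + Yi0 n ky t) (Yo1 n T t + Yi1 n t) = 0 /\
     seg w (Zo0 n T kz t + Zi0 n kz t) (Zo1 n T t + Zi1 n t) = 0).
Proof.
move=> /andP[t0 t4] w01; rewrite Yo0E // Zo0E // Yo1E // Zo1E // Yi0E Zi0E /Yi1 /Zi1 /seg.
set c := cos (N * t); set s := sin (N * t).
case=> Y Z; have d0 : 0 < pp n t - qq n t by rewrite ppBqq mulr_gt0.
have : (c + e * s) * ((1 - w) * ky^-1 + w * (pp n t - qq n t)) = 0.
  rewrite -[RHS]Y -[X in _ = _ + w * X]/(_ + _); transitivity
   ((1 - w) * (ky^-1 * c + ky^-1 * (e * s)) + w * ((pp n t - qq n t) * (c + e * s))).
    by ring.
  by ring.
move/eqP; rewrite mulf_eq0 orbC gt_eqF /=; last exact: conv_gt.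
move=> /eqP ces; have ec : e * c = - s.
  by apply/eqP; rewrite -addr_eq0 -[s]mul1r -ee -mulrA -mulrDr ces mulr0.
(* At such a crossing $|c|=|s|$, which is impossible while $Nt<\pi/4$; this provides the bound on
   $m$ needed by [E_nonzero]. *)
have big : pi / 4 <= N * t.
  rewrite leNgt; apply/negP => /(sq_lt_of_small t0); rewrite -/c -/s.
  have -> : c = - (e * s) by apply/eqP; rewrite -addr_eq0 ces.
  by rewrite sqrrN exprMn (expr2 e) ee mul1r ltxx.
have tn : t != pi / 4.
  apply/eqP => tE; have := quarter_eq; rewrite /= -tE -/c -/s => h.
  have c0 : c = 0 by move: ces; rewrite -h => /eqP; rewrite -mulr2n mulrn_eq0 /= => /eqP.
  apply: (@cN_sN_neq0 t); split=> //; rewrite -/s.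
  by apply/eqP; rewrite -oppr_eq0 -ec c0 mulr0.
have t4' : t < pi / 4 by rewrite lt_neqAle tn.
have tp : 0 < t by rewrite -(pmulr_rgt0 _ (lt_le_trans _ N3)) //; slra.
have [st ct] := @cos_sin_gt0 t ltac:(by rewrite tp t4).
have hp : 0 < cos (2 * t) / kz by rewrite mulr_gt0 //; have := cos2_ge t4 t0; lra.
case/andP: w01 => w0 w1.
have := E_nonzero ee (cN_sq n t) (c_sq t) (GG_sin n t) (HH_cos n t) st ct
  w0 w1 ec (sin2_gt_mu big t4) hp d0.
by rewrite -Z => /eqP; apply; rewrite -/c -/s; ring.
Qed.

(** The crossings are again fixed, now at the zeros of $c-\varepsilon s$. The endpoint $\pi/4$ is
    left out because there $\cos t=\sin t$ and the strands are joined. *)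
Lemma F_neq0 t w : 0 <= t < pi / 4 -> 0 <= w <= 1 ->
  ~ (seg w (Yo0 n T ky t - Yi0 n ky t) (Yo1 n T t - Yi1 n t) = 0 /\
     seg w (Zo0 n T kz t - Zi0 n kz t) (Zo1 n T t - Zi1 n t) = 0).
Proof.
move=> /andP[t0 t4] w01; rewrite Yo0E // Zo0E // Yo1E // Zo1E // Yi0E Zi0E /Yi1 /Zi1 /seg.
set c := cos (N * t); set s := sin (N * t).
case=> Y Z; have d0 : 0 < pp n t + qq n t.
  by rewrite ppDqq mulr_gt0 //; apply: kap_gt0; rewrite t0 t4.
have : (c - e * s) * ((1 - w) * ky^-1 + w * (pp n t + qq n t)) = 0.
  by rewrite -[RHS]Y; ring.
move/eqP; rewrite mulf_eq0 orbC gt_eqF /=; last exact: conv_gt.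
move=> /eqP ces; have ec : e * c = s.
  by apply/eqP; rewrite -subr_eq0 -[s]mul1r -ee -mulrA -mulrBr ces mulr0.
have tn : t != 0.
  apply/eqP => tE; move: ces; rewrite /c /s tE mulr0 cos0 sin0 mulr0 subr0.
  by move/eqP; rewrite oner_eq0.
have tp : 0 < t by rewrite lt_neqAle eq_sym tn.
have [st ct] := @cos_sin_gt0 t ltac:(by rewrite tp ltW).
have hp : 0 < cos (2 * t) / kz by rewrite mulr_gt0 //; have := cos2_ge (ltW t4) t0; lra.
case/andP: w01 => w0 w1.
have := F_nonzero ee (cN_sq n t) (c_sq t) (GG_sin n t) (HH_cos n t) st ct m0
  w0 w1 ec hp d0.
by rewrite -Z => /eqP; apply; rewrite -/c -/s; ring.
Qed.

(** Twice the first coordinates are $(c+\varepsilon s)B\pm(c-\varepsilon s)A$. The factor that is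
    larger in absolute value carries the larger weight, since $\kappa\le m$ means $A\le B$. *)
Lemma pair_neq0 t w : 0 <= t <= pi / 4 -> 0 <= w <= 1 -> kap n t <= m ->
  0 < e * (cN t * sN t) ->
  seg w (Yo0 n T ky t) (Yo1 n T t) != 0 /\ seg w (Yi0 n ky t) (Yi1 n t) != 0.
Proof.
move=> /andP[t0 t4] w01 km ecs; rewrite Yo0E // Yo1E // Yi0E /Yi1 /seg.
set c := cos (N * t); set s := sin (N * t).
pose A := (1 - w) * ky^-1 + w * (q * kap n t); pose B := (1 - w) * ky^-1 + w * (q * m).
have [k1 k2] := @kap_ge _ n t ltac:(by rewrite t0 t4).
have /andP[w0 w1] := w01.
have A0 : 0 <= A.
  by rewrite addr_ge0 // mulr_ge0 ?subr_ge0 ?(ltW kyV0) // mulr_ge0 ?(ltW q0) //; lra.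
have AB : A <= B by rewrite lerD2l ler_wpM2l // ler_wpM2l // ltW.
have B0 : 0 < B by apply: conv_gt => //; rewrite mulr_gt0.
have {}ecs : 0 < e * (c * s) by [].
have [h1 h2] := pair_nonzero ecs (introT andP (conj A0 AB)) B0.
split; apply/eqP => h; [move/eqP: h1|move/eqP: h2]; apply.
  transitivity (2 * ((1 - w) * (ky^-1 * c) + w * (pp n t * c - e * (qq n t * s)))).
    by rewrite /A /B -(ppDqq t) -(ppBqq t); ring.
  by rewrite h mulr0.
transitivity (2 * ((1 - w) * (ky^-1 * (e * s)) + w * (e * (pp n t * s) - qq n t * c))).
  by rewrite /A /B -(ppDqq t) -(ppBqq t); ring.
by rewrite h mulr0.
Qed.

(** For $\kappa>m$ the coefficient [qq] is positive and [O_nonzero] applies; otherwise [kap_or]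
    leads to [pair_neq0], where the first coordinate alone is nonzero. *)
Lemma O_neq0 t w : 0 <= t <= pi / 4 -> 0 <= w <= 1 ->
  ~ (seg w (Yo0 n T ky t) (Yo1 n T t) = 0 /\ seg w (Zo0 n T kz t) (Zo1 n T t) = 0).
Proof.
move=> tt w01 [Y Z]; have /andP[t0 t4] := tt; have /andP[w0 w1] := w01.
have [tE|tn] := eqVneq t 0.
  have := pp_gt0 tt; move: Y; rewrite Yo0E // Yo1E // /seg /= tE mulr0 cos0 sin0 !mulr0 subr0 !mulr1.
  by move=> Y pp0; have := conv_gt w01 kyV0 pp0; rewrite Y ltxx.
have tp : 0 < t by rewrite lt_neqAle eq_sym tn.
have [km|km] := leP (kap n t) m.
  have [|ecs] := @kap_or _ n t ltac:(by rewrite tp t4); first by rewrite ltNge km.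
  by have [/eqP] := pair_neq0 tt w01 km ecs.
have t4' : t < pi / 4.
  rewrite lt_neqAle t4 andbT; apply/eqP => tE; move: km; rewrite tE kap_quarter; slra.
have [st ct] := @cos_sin_gt0 t ltac:(by rewrite tp t4).
have hp : 0 < cos (2 * t) / kz by rewrite mulr_gt0 //; have := cos2_ge t4 t0; lra.
have q1 : 0 < qq n t by rewrite /qq !mulr_gt0 // subr_gt0.
move: Y Z; rewrite Yo0E // Zo0E // Yo1E // Zo1E // /seg => Y Z.
have := O_nonzero ee (cN_sq n t) (GG_sin n t) st ct m0 w0 w1 kyV0 (pp_gt0 tt) q1 hp Y.
by rewrite Z eqxx.
Qed.

Lemma I_neq0 t w : 0 < t <= pi / 4 -> 0 <= w <= 1 ->
  ~ (seg w (Yi0 n ky t) (Yi1 n t) = 0 /\ seg w (Zi0 n kz t) (Zi1 n t) = 0).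
Proof.
move=> tt w01 [Y Z]; have /andP[tp t4] := tt; have /andP[w0 w1] := w01.
have t0 := ltW tp; have tt' : 0 <= t <= pi / 4 by rewrite t0 t4.
have [km|km] := leP (kap n t) m.
  have [|ecs] := @kap_or _ n t ltac:(by rewrite tp t4); first by rewrite ltNge km.
  by have [_ /eqP] := pair_neq0 tt' w01 km ecs.
have t4' : t < pi / 4.
  rewrite lt_neqAle t4 andbT; apply/eqP => tE; move: km; rewrite tE kap_quarter; slra.
have [st ct] := @cos_sin_gt0 t ltac:(by rewrite tp t4).
have hp : 0 < cos (2 * t) / kz by rewrite mulr_gt0 //; have := cos2_ge t4 t0; lra.
have q1 : 0 < qq n t by rewrite /qq !mulr_gt0 // subr_gt0.
move: Y Z; rewrite Yi0E Zi0E /Yi1 /Zi1 /seg => Y Z.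
have := I_nonzero ee (cN_sq n t) (HH_cos n t) st ct m0 w0 w1 kyV0 (pp_gt0 tt') q1 hp Y.
by rewrite Z eqxx.
Qed.

End fibers.

Lemma slope_ge (R : realType) (f df : R -> R) (a b c : R) : a <= b ->
  (forall x : R, is_derive x (1 : R) f (df x)) -> (forall x, a <= x <= b -> c <= df x) ->
  c * (b - a) <= f b - f a.
Proof.
move=> ab fd cdf.
have cf : {within `[a, b], continuous f}.
  apply: continuous_subspaceT => z; apply: differentiable_continuous.
  by apply/derivable1_diffP; have := fd z => -[].
have [x] := MVT_segment ab (fun z _ => fd z) cf.
rewrite in_itv /= => xab ->; apply: ler_wpM2r; first by rewrite subr_ge0.
exact: cdf.
Qed.

Lemma cont_of_lip (R : realType) (f : R -> R) : (forall a b, lip a b f) -> continuous f.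
Proof.
move=> lf x; have [L L0 fL] := lf (x - 1) (x + 1).
apply/(@cvgrPdist_le _ _ _ (nbhs x)) => d d0; near=> y.
have xy : `|x - y| <= 1 by near: y; exists 1 => //= y; exact: ltW.
have xy' : `|x - y| <= d / (L + 1).
  near: y; exists (d / (L + 1)) => /=; first by rewrite divr_gt0 // ltr_wpDl.
  by move=> y; exact: ltW.
move: xy; rewrite ler_norml => /andP[h1 h2].
apply: (le_trans (fL x y _ _)); try (by apply/andP; split; lra).
have L1 : 0 < L + 1 by lra.
move: xy'; rewrite ler_pdivlMr // => h; have := normr_ge0 (x - y); nra.
Unshelve. all: by end_near.
Qed.

Ltac lips := repeat first [apply lip_id | apply lip_cst | apply: lipB | apply: lipD
 | apply: lipN | apply: lipM | apply: lip_cos | apply: lip_sin | apply: lip_norm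
 | apply: lip_max | apply: lip_min | apply: lip_poly].

Lemma conv_bounds (R : realType) (w x y l u : R) : 0 <= w <= 1 -> l <= x <= u ->
  l <= y <= u -> l <= (1 - w) * x + w * y <= u.
Proof.
move=> /andP[w0 w1] /andP[lx xu] /andP[ly yu].
have w1' : 0 <= 1 - w by lra.
have := ler_wpM2l w0 ly; have := ler_wpM2l w0 yu.
have := ler_wpM2l w1' lx; have := ler_wpM2l w1' xu.
by move=> *; apply/andP; split; lra.
Qed.

(** * Linear lower bounds where strands meet, and the core isotopy *)

Section homotopy_estimates.
Variables (R : realType) (n : nat) (T ky kz : R).
Hypotheses (n1 : (1 <= n)%N) (T1 : 1 <= T) (ky0 : 0 < ky) (kz0 : 0 < kz).
Hypotheses (kyT : (chebyshevT R (dg n)).[T] = ky * T)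
  (kzT : (height R n).[T] = eps n * (kz * T)).

Local Notation N := ((dg n)%:R : R).
Local Notation m := (mu R n).
Local Notation e := (eps n : R).
Local Notation q := (cos (pi / 4) : R).
Local Notation cN := (fun t : R => cos (N * t)).
Local Notation sN := (fun t : R => sin (N * t)).
Implicit Types t w : R.

Let pi2 : 2 <= pi :> R := @pi_ge2 R.
Let N3 : 3 <= N := N_ge3 R n1.
Let m0 : 0 < m := mu_gt0 R n.
Let m1 : m < 1 := mu_lt1 R n.
Let mN : m * N = 1 / 4 := mu_dg R n.
Let q0 : 0 < q := cos_pi4_gt0 R.
Let ee : e * e = 1 := eps_sqr R n.
Let T0 : 0 < T := lt_le_trans ltr01 T1.
Let kyV0 : 0 < ky^-1. Proof. by rewrite invr_gt0. Qed.
Let kzV0 : 0 < kz^-1. Proof. by rewrite invr_gt0. Qed.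

Ltac facts := have ? := T1; have ? := pi2; have ? := m0; have ? := m1; have ? := q0;
  have ? := N3; have ? := T0; have ? := kyV0; have ? := kzV0.
Ltac slra := facts; lra.

Let L := 2 * T - 1.
Let L1 : 1 <= L. Proof. by rewrite /L; slra. Qed.

Lemma lip_XX a b : lip a b (@XX R).
Proof. by rewrite /XX /ext /tau; lips. Qed.
Lemma lip_Yo0 a b : lip a b (Yo0 n T ky).
Proof. by rewrite /Yo0 /tpar /bend /ext /tau; lips. Qed.
Lemma lip_Zo0 a b : lip a b (Zo0 n T kz).
Proof. by rewrite /Zo0 /tpar /bend /ext /tau; lips. Qed.
Lemma lip_Yi0 a b : lip a b (Yi0 n ky).
Proof. by rewrite /Yi0; lips. Qed.
Lemma lip_Zi0 a b : lip a b (Zi0 n kz).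
Proof. by rewrite /Zi0; lips. Qed.
Lemma lip_Yo1 a b : lip a b (Yo1 n T).
Proof. by rewrite /Yo1 /pp /qq /kap /yc /ext /tau; lips. Qed.
Lemma lip_Zo1 a b : lip a b (Zo1 n T).
Proof. by rewrite /Zo1 /pp /qq /kap /yc /ext /tau; lips. Qed.
Lemma lip_Yi1 a b : lip a b (@Yi1 R n).
Proof. by rewrite /Yi1 /pp /qq /kap /yc /ext /tau; lips. Qed.
Lemma lip_Zi1 a b : lip a b (@Zi1 R n).
Proof. by rewrite /Zi1 /pp /qq /kap /yc /ext /tau; lips. Qed.

Let min_l (a b : R) : Num.min a b <= a. Proof. by rewrite ge_min lexx. Qed.
Let min_r (a b : R) : Num.min a b <= b. Proof. by rewrite ge_min lexx orbT. Qed.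

Let XX_slope_pos t t' : 0 <= t -> t <= t' -> t' <= pi / 4 -> t' - t <= XX t - XX t'.
Proof.
move=> t0 tt t4; rewrite /XX !ext_0 ?tau_id ?(le_trans t0) // mulr0 !add0r.
pose f (x : R) : R := cos x * (sin x - 2).
(* On $[0,\pi]$ this derivative is at least 1 because $0\le\sin x\le1$. *)
have fd (x : R) : is_derive x 1 f (1 + 2 * sin x - 2 * sin x * sin x).
  have h1 : is_derive x 1 (sin : R -> R) (cos x) by exact: is_derive_sin.
  have h2 : is_derive x 1 (cos : R -> R) (- sin x) by exact: is_derive_cos.
  have h := is_deriveM h2 (is_deriveB h1 (is_derive_cst (2 : R) x (1 : R))).
  apply: is_derive_eq h _; rewrite /GRing.scale /= subr0.
  have := cos2Dsin2 x; rewrite !expr2 => /(canRL (addrK _)) hc.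
  by rewrite hc !fctE; ring.
have := @slope_ge R f _ (4 * t) (4 * t') 1 ltac:(lra) fd.
rewrite mul1r /f => h.
have {h} h := h _; have : 4 * t' - 4 * t <= cos (4 * t') * (sin (4 * t') - 2) -
  cos (4 * t) * (sin (4 * t) - 2).
  apply: h => x /andP[x0 x1].
  have s0 : 0 <= sin x by apply: sin_ge0_pi; apply/andP; split; lra.
  have s1 := sin_le1 x; nra.
move=> k; have ? : 0 <= t' - t by lra.
by move: (cos (4 * t)) (cos (4 * t')) (sin (4 * t)) (sin (4 * t')) k => *; lra.
Qed.

Lemma XX_slope t t' : t <= t' -> t' <= pi / 4 -> t' - t <= XX t - XX t'.
Proof.
move=> tt ht4'.
have neg (s s' : R) : s <= s' -> s' <= 0 -> s' - s <= XX s - XX s'.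
  move=> ss s0; rewrite /XX !tau_0 ?ext_id ?(le_trans ss) //; lra.
have [t0|/ltW t0] := leP 0 t; first exact: XX_slope_pos.
have [t'0|/ltW t'0] := leP t' 0; first exact: neg.
by have := neg t 0 t0 (lexx _); have := XX_slope_pos (lexx 0) t'0 ht4'; lra.
Qed.

Lemma XX_gap t t' : - L <= t <= pi / 4 -> - L <= t' <= pi / 4 ->
  1 * `|t - t'| <= `|XX t - XX t'|.
Proof.
rewrite mul1r; wlog tt : t t' / t <= t'.
  move=> W h h'; have [k|/ltW k] := leP t t'; first exact: W.
  by rewrite distrC [leRHS]distrC; exact: W.
move=> _ /andP[_ ht4']; have h := XX_slope tt ht4'.
by rewrite distrC ger0_norm ?subr_ge0 // (le_trans h) // ler_norm.
Qed.

Lemma outer_closing_ge t : - L <= t <= 0 ->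
  Num.min (ky * L)^-1 1 * (t + L) <= Yo0 n T ky t.
Proof.
move=> /andP[tL t0]; rewrite /Yo0 /bend /tpar tau_0 // cos0 ext_id //.
have c0 : 0 <= Num.min (ky * L)^-1 1 by rewrite le_min ler01 invr_ge0 mulr_ge0 ?ltW // (lt_le_trans ltr01).
have tL0 : 0 <= t + L by lra.
have kyL : 0 < ky * L by rewrite mulr_gt0 // (lt_le_trans ltr01).
have [a|a] := leP (- t) (T - 1).
  rewrite (max_idPr _) ?subr_le0 // mul0r mul0r subr0.
  have /andP[T1' _] := @chebyshevT_ge1 R (dg n) (1 - t) ltac:(lra).
  rewrite (le_trans (ler_wpM2r tL0 (min_l _ _))) //.
  rewrite mulrC ler_pdivrMr // mulrA mulfVK ?gt_eqF //; nra.
rewrite (max_idPl _); last by rewrite subr_ge0 ltW.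
rewrite (_ : 1 + (T - 1) = T) ?kyT; last by ring.
rewrite (le_trans (ler_wpM2r tL0 (min_r _ _))) // mul1r.
rewrite [ky * T]mulrC mulfK ?gt_eqF //.
set d := - t - (T - 1); have -> : t + L = T - d by rewrite /d /L; ring.
have d0 : 0 <= d by rewrite /d; lra.
have dT : d <= T by move: tL; rewrite /d /L; lra.
by rewrite lerD2l lerN2 ler_pdivrMr //; nra.
Qed.

(** The two symmetric outer strands meet at $t=-L$, the former point at infinity. Along the closing
    part the first coordinates at both ends of the homotopy are bounded below by $K(t+L)$, so the
    second coordinate can be ignored. *)
Lemma fib_outer_closing : fib (- L) 0 (Yo0 n T ky) (Zo0 n T kz) (Yo1 n T) (Zo1 n T).
Proof.
have L0 : 0 < L by rewrite (lt_le_trans ltr01).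
pose K := Num.min (Num.min (ky * L)^-1 1) (q * m / L).
have K0 : 0 < K.
  have a1 : 0 < (ky * L)^-1 by rewrite invr_gt0 mulr_gt0.
  have a2 : 0 < q * m / L by rewrite divr_gt0 // mulr_gt0.
  by rewrite /K !lt_min ltr01 a1 a2.
have ext_L : ext (- L) = L by rewrite ext_id ?opprK // oppr_le0 ltW.
have tau_L : tau (- L) = 0 by rewrite tau_0 // oppr_le0 ltW.
have bend_L : bend T (- L) = T.
  by rewrite /bend ext_L /L (max_idPl _); slra.
have tpar_L : tpar T (- L) = T.
  by rewrite /tpar tau_L cos0 ext_L (min_idPr _) /L; slra.
have pp_0 : pp n (0 : R) = q * m by rewrite /pp kap_0; field.
apply: (@fib_near _ _ _ (- L) K) => //.
- by rewrite lexx oppr_le0 ltW.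
- exact: lip_Yo0.
- exact: lip_Zo0.
- exact: lip_Yo1.
- exact: lip_Zo1.
- rewrite /Yo0 /Yo1 bend_L tpar_L kyT tau_L ext_L mulr0 cos0 sin0 pp_0 -/L.
  by field; rewrite !gt_eqF.
- rewrite /Zo0 /Zo1 bend_L tpar_L kzT tau_L ext_L mulr0 cos0 sin0 pp_0 -/L.
  by field; rewrite !gt_eqF.
move=> t s /andP[tL t0] s01.
rewrite opprK ger0_norm; last by lra.
suff h : K * (t + L) <= seg s (Yo0 n T ky t) (Yo1 n T t).
  by rewrite /pnorm le_max (le_trans h (ler_norm _)).
have tL0 : 0 <= t + L by lra.
have /andP[s0 s1] := s01.
have h0 : K * (t + L) <= Yo0 n T ky t.
  apply: le_trans (outer_closing_ge _); last by rewrite tL.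
  by rewrite ler_wpM2r // min_l.
have h1 : K * (t + L) <= Yo1 n T t.
  rewrite /Yo1 tau_0 // ext_id // mulr0 cos0 sin0 pp_0 -/L.
  have -> : q * m * 1 - e * (qq n 0 * 0) - q * m * (- t / L) = q * m / L * (t + L).
    by field; rewrite gt_eqF.
  by rewrite ler_wpM2r // min_r.
by rewrite /seg; nra.
Qed.

Lemma fib_outer : fib (- L) (pi / 4) (Yo0 n T ky) (Zo0 n T kz) (Yo1 n T) (Zo1 n T).
Proof.
apply: fib_cat fib_outer_closing _; apply: fib_compact.
- by apply: cont_of_lip => a b; exact: lip_Yo0.
- by apply: cont_of_lip => a b; exact: lip_Zo0.
- by apply: cont_of_lip => a b; exact: lip_Yo1.
- by apply: cont_of_lip => a b; exact: lip_Zo1.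
exact: O_neq0.
Qed.

Lemma fib_sum : fib 0 (pi / 4)
  (fun t => Yo0 n T ky t + Yi0 n ky t) (fun t => Zo0 n T kz t + Zi0 n kz t)
  (fun t => Yo1 n T t + Yi1 n t) (fun t => Zo1 n T t + Zi1 n t).
Proof.
apply: fib_compact.
- by apply: cont_of_lip => a b; apply: lipD; [exact: lip_Yo0|exact: lip_Yi0].
- by apply: cont_of_lip => a b; apply: lipD; [exact: lip_Zo0|exact: lip_Zi0].
- by apply: cont_of_lip => a b; apply: lipD; [exact: lip_Yo1|exact: lip_Yi1].
- by apply: cont_of_lip => a b; apply: lipD; [exact: lip_Zo1|exact: lip_Zi1].
exact: E_neq0.
Qed.

Lemma cN_sq_ge_half t : 0 <= t -> N * t <= pi / 4 -> 1 / 2 <= cN t * cN t.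
Proof.
move=> t0 Nt; have Nt0 : 0 <= N * t by rewrite mulr_ge0 // (le_trans _ N3).
have : 0 <= cos (2 * (N * t)) by apply: cos_ge0_pihalf; apply/andP; split; slra.
by rewrite cos2t /= expr2; move: (cos _) => c; lra.
Qed.

Lemma pp_bounds t : 0 <= t <= pi / 4 -> q * m / 2 <= pp n t <= 4.
Proof.
move=> tt; have [h1 h2] := kap_ge n tt; rewrite /pp.
have q1 : q <= 1 by exact: cos_le1.
have k3 : kap n t <= 7.
  have : yc (4 * t) <= 3.
    rewrite /yc; have := sin_le1 (4 * t); have := sin_geN1 (4 * t).
    by move: (sin _) => s *; nra.
  have a1 : `|cos (2 * (N * t))| <= 1 by rewrite ler_norml cos_geN1 cos_le1.
  have := ler_wpM2l (ltW m0) a1; rewrite /kap; slra.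
by apply/andP; split; facts; nra.
Qed.

(** The two inner strands meet at the origin. Near $t=0$ one has $c^2\ge1/2$, so the right side of
    [I_combination] is at least a multiple of $t$, while its left side is at most a multiple of the
    length of ([Y], [Z]). *)
Lemma fib_inner_origin : fib 0 (pi / 4 / N) (Yi0 n ky) (Zi0 n kz) (@Yi1 R n) (@Zi1 R n).
Proof.
have N0 : 0 < N by rewrite (lt_le_trans _ N3).
pose hm : R := 1 / 3 * kz^-1; have hm0 : 0 < hm by rewrite /hm; slra.
pose A0 := Num.min ky^-1 (q * m / 2).
have A00 : 0 < A0 by rewrite lt_min kyV0 !mulr_gt0.
pose Q := Num.min q (hm * m).
have Q0 : 0 < Q by rewrite lt_min q0 mulr_gt0.
(* [S] bounds $A+B$ from above, [A0] bounds $A$ from below, and [Q * t] bounds both [qq n t] and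
   twice $hm\sin t$ from below. *)
pose S := ky^-1 + kz^-1 + 8; have S0 : 0 < S by rewrite /S; slra.
pose K := A0 * Q / 4 / S.
have K0 : 0 < K by rewrite /K !mulr_gt0 // invr_gt0.
have kap0 : kap n (0 : R) = m := kap_0 R n.
have qq0 : qq n (0 : R) = 0 by rewrite /qq kap0 subrr mulr0 mul0r.
apply: (@fib_near _ _ _ 0 K) => //.
- by rewrite lexx !divr_ge0 // ltW // (lt_le_trans _ pi2).
- exact: lip_Yi0.
- exact: lip_Zi0.
- exact: lip_Yi1.
- exact: lip_Zi1.
- by rewrite Yi0E /Yi1 qq0 mulr0 sin0 !mulr0 mul0r subr0.
- by rewrite Zi0E /Zi1 /HH qq0 !mulr0 sin0; ring.
move=> t w /andP[t0 tN] w01; rewrite subr0 ger0_norm //.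
have Nt : N * t <= pi / 4 by rewrite mulrC -ler_pdivlMr.
have t12 : 3 * t <= pi / 4 by apply: le_trans Nt; rewrite ler_wpM2r.
have t4 : t <= pi / 4 by lra.
have t04 : 0 <= t <= pi / 4 by rewrite t0.
have /andP[p1 p4] := pp_bounds t04.
have k := @kap_small R n t ltac:(apply/andP; split; lra).
have qt : q * t <= qq n t by rewrite /qq -[X in _ <= X]mulrA ler_wpM2l ?(ltW q0) //; lra.
have c2 := @cos2_ge R t t4 t0.
have c21 := cos_le1 (2 * t).
have st : t / 2 <= sin t by apply: half_le_sin; apply/andP; split; slra.
have ct1 := cos_le1 t.
have ct : 1 / 2 <= cos t.
  have := cos_lip1 0 t; rewrite cos0 sub0r normrN (ger0_norm t0) => h.
  by have := ler_norm (1 - cos t); have := @pihalf_lt2 R; lra.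
have ct0 : 0 <= cos t by lra.
have cc := cN_sq_ge_half t0 Nt.
rewrite Yi0E Zi0E /Yi1 /Zi1; set c := cos (N * t) in cc *; set s := sin (N * t).
set h := cos (2 * t) / kz.
have hhm : hm <= h by rewrite /hm /h ler_wpM2r // ?(ltW kzV0) //; slra.
have h1 : h <= kz^-1 by rewrite /h ler_piMl // ltW.
have := I_combination s m h w ee (HH_cos n t) ky^-1 (pp n t) (qq n t).
rewrite /= -/c -/s /seg; set A := (1 - w) * ky^-1 + _; set B := (1 - w) * h + _.
set Y := (1 - w) * _ + w * _; set Z := (1 - w) * _ + w * _ => YZ.
have w0 : 0 <= w by case/andP: w01. have w1 : w <= 1 by case/andP: w01.
have p0 : 0 <= pp n t by apply: le_trans p1; rewrite divr_ge0 // mulr_ge0 // ltW.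
have hp0 : 0 <= h by exact: le_trans (ltW hm0) hhm.
have A0l : A0 <= ky^-1 := min_l _ _; have A0r : A0 <= q * m / 2 := min_r _ _.
have /andP[A0A AS] : A0 <= A <= ky^-1 + 4.
  apply: conv_bounds => //.
    by rewrite A0l lerDl ler0n.
  by rewrite (le_trans A0r p1) ler_wpDl ?(ltW kyV0).
have /andP[B0 BS] : 0 <= B <= kz^-1 + 4.
  apply: conv_bounds => //; first by rewrite hp0 ler_wpDr ?ler0n.
  by rewrite p0 ler_wpDl // ltW.
set P := pnorm Y Z.
have YP : `|Y| <= P by rewrite /P /pnorm le_max lexx.
have ZP : `|Z| <= P by rewrite /P /pnorm le_max lexx orbT.
have en : `|e| = 1 by case: (eps_cases R n) => ->; rewrite ?normrN normr1.
have up : `|(e * B * Y + A * Z) * cos t| <= S * P.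
  rewrite normrM; have ctn : `|cos t| <= 1 by rewrite ler_norml cos_geN1 cos_le1.
  have A0' : 0 <= A by exact: le_trans (ltW A00) A0A.
  have h2 : `|e * B * Y + A * Z| <= B * P + A * P.
    rewrite (le_trans (ler_normD _ _)) // !normrM en mul1r (ger0_norm B0) (ger0_norm A0').
    by rewrite lerD // ler_wpM2l.
  have h3 := normr_ge0 (e * B * Y + A * Z); have h4 := normr_ge0 (cos t).
  have P0 : 0 <= P by apply: le_trans YP.
  rewrite -[S * P]mulr1; apply: ler_pM => //; apply: (le_trans h2).
  by rewrite -mulrDl ler_wpM2r // /S; lra.
have lo : 1 / 2 * (A0 * Q / 2 * t) <= `|(e * B * Y + A * Z) * cos t|.
  rewrite YZ normrM normrN normrM en (mul1r `|c|).
  have c12 : 1 / 2 <= `|c|.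
    have c1 : `|c| <= 1 by rewrite ler_norml cos_geN1 cos_le1.
    by rewrite (le_trans cc) // (le_trans (ler_norm _)) // normrM ler_piMl.
  suff lo : A0 * Q / 2 * t <= (w * qq n t * B + A * w * qq n t) * cos t +
      A * (1 - w) * h * m * sin t.
        apply: ler_pM c12 (le_trans lo (ler_norm _)); first by rewrite divr_ge0.
    by rewrite !mulr_ge0 // ?invr_ge0 ?ler0n // ltW.
  have q1 : Q * t <= qq n t.
    by apply: le_trans qt; rewrite ler_wpM2r // min_l.
  have q2 : Q * t / 2 <= h * m * sin t.
    have : Q <= h * m by apply: le_trans (min_r _ _) _; rewrite ler_wpM2r // ltW.
    by move=> k1; rewrite -mulrA; apply: ler_pM => //; [exact: ltW|rewrite divr_ge0].
  have Qt : 0 <= Q * t by rewrite mulr_ge0 // ltW.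
  have qq_0 : 0 <= qq n t by exact: le_trans q1.
  have l1 : w * (A0 * Q / 2 * t) <= (w * qq n t * B + A * w * qq n t) * cos t.
    have z1 : 0 <= w * qq n t * B * cos t by apply: mulr_ge0 => //; apply: mulr_ge0 => //; exact: mulr_ge0.
    have z2 : A0 * (Q * t) <= A * qq n t by apply: ler_pM A0A q1 => //; exact: ltW.
    have z3 : A0 * (Q * t) * (1 / 2) <= A * qq n t * cos t.
      apply: ler_pM z2 ct; last by rewrite divr_ge0.
      by rewrite mulr_ge0 // ltW.
    have := ler_wpM2l w0 z3; lra.
  have l2 : (1 - w) * (A0 * Q / 2 * t) <= A * (1 - w) * h * m * sin t.
    have z2 : A0 * (Q * t / 2) <= A * (h * m * sin t).
      by apply: ler_pM A0A q2; [exact: ltW|rewrite divr_ge0].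
    have w1' : 0 <= 1 - w by lra.
    have := ler_wpM2l w1' z2; lra.
  lra.
suff -> : K * t = S^-1 * (1 / 2 * (A0 * Q / 2 * t)) by rewrite ler_pdivrMl // (le_trans lo up).
by rewrite /K; field; rewrite gt_eqF.
Qed.

Lemma fib_inner : fib 0 (pi / 4) (Yi0 n ky) (Zi0 n kz) (@Yi1 R n) (@Zi1 R n).
Proof.
apply: fib_cat fib_inner_origin _; apply: fib_compact.
- by apply: cont_of_lip => a b; exact: lip_Yi0.
- by apply: cont_of_lip => a b; exact: lip_Zi0.
- by apply: cont_of_lip => a b; exact: lip_Yi1.
- by apply: cont_of_lip => a b; exact: lip_Zi1.
move=> t s /andP[ht t4]; apply: I_neq0 => //; rewrite t4 andbT.
by rewrite (lt_le_trans _ ht) // divr_gt0 ?(lt_le_trans _ N3) // divr_gt0 // (lt_le_trans _ pi2).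
Qed.

(** Outer and inner strand meet at $\pi/4$, where both $\cos 2t$ and $\kappa$ vanish to first order.
    Multiplying the second coordinate by $\varepsilon c+s$ makes all terms nonnegative; the interval
    is so short that $\varepsilon sc\ge0$ on it, whence $(\varepsilon c+s)^2\ge1$. *)
Lemma fib_diff_quarter : fib (pi / 4 - pi / 8 / N) (pi / 4)
  (fun t => Yo0 n T ky t - Yi0 n ky t) (fun t => Zo0 n T kz t - Zi0 n kz t)
  (fun t => Yo1 n T t - Yi1 n t) (fun t => Zo1 n T t - Zi1 n t).
Proof.
have N0 : 0 < N by rewrite (lt_le_trans _ N3).
have d0 : 0 < pi / 8 / N by rewrite divr_gt0 //; slra.
have d8 : pi / 8 / N <= pi / 8 by rewrite ler_pdivrMr // ler_peMr //; slra.
pose K := Num.min kz^-1 (4 * q) / 2.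
have K0 : 0 < K by rewrite divr_gt0 // lt_min kzV0 mulr_gt0.
have t4 : 0 <= pi / 4 :> R by slra.
have c0 : cos (2 * (pi / 4)) = 0 :> R by rewrite (_ : 2 * (pi / 4) = pi / 2) ?cos_pihalf //; field.
have cs : cos (N * (pi / 4)) - e * sin (N * (pi / 4)) = 0.
  by have /= -> := quarter_eq R n; rewrite subrr.
have pq (t : R) : pp n t + qq n t = q * kap n t := ppDqq n t.
apply: (@fib_near _ _ _ (pi / 4) K) => //.
- by apply/andP; split; lra.
- by apply: lipB; [exact: lip_Yo0|exact: lip_Yi0].
- by apply: lipB; [exact: lip_Zo0|exact: lip_Zi0].
- by apply: lipB; [exact: lip_Yo1|exact: lip_Yi1].
- by apply: lipB; [exact: lip_Zo1|exact: lip_Zi1].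
- rewrite Yo0E // Yi0E Yo1E // /Yi1 -mulrBr /= cs mulr0.
  transitivity ((pp n (pi / 4) + qq n (pi / 4)) * (cos (N * (pi / 4)) - e * sin (N * (pi / 4)))).
    by rewrite cs mulr0.
  by ring.
- rewrite Zo0E // Zi0E Zo1E // /Zi1 c0 !mul0r oppr0 subr0 /=.
  transitivity ((pp n (pi / 4) + qq n (pi / 4)) * (e * cos (N * (pi / 4)) + sin (N * (pi / 4)))).
    by rewrite pq kap_quarter mulr0 mul0r.
  by ring.
move=> t w /andP[ta tb] /andP[w0 w1].
have t0 : 0 < t by slra.
have t0' := ltW t0.
have [st ct] := @cos_sin_gt0 R t ltac:(by rewrite t0 tb).
rewrite distrC ger0_norm ?subr_ge0 //.
rewrite Yo0E // Zo0E // Yo1E // Zo1E // Yi0E Zi0E /Yi1 /Zi1.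
have := cN_sq n t; have := GG_sin n t; have := HH_cos n t.
have ecs : 0 <= e * sin (2 * (N * t)).
  have d1 : N * (pi / 4 - t) <= pi / 8 by rewrite mulrC -ler_pdivlMr //; lra.
  have d2 : 0 <= N * (pi / 4 - t) by rewrite mulr_ge0 ?subr_ge0 ?(ltW N0).
  by rewrite eps_sin2; apply: cos_ge0_pihalf; apply/andP; split; slra.
have {}ecs : 0 <= e * (sin (N * t) * cos (N * t)).
  by move: ecs; rewrite sin2t (_ : e * _ = 2 * (e * (sin (N * t) * cos (N * t)))); [lra|ring].
move: ecs; rewrite /=; move: (GG n t) (HH n t) (cos (N * t)) (sin (N * t)) => G H c s ecs hH hG cs1.
set h := cos (2 * t) / kz.
have hh : (pi / 4 - t) * kz^-1 <= h.
  by rewrite /h ler_wpM2r ?(ltW kzV0) //; exact: cos2_ge.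
have kk : 4 * (pi / 4 - t) <= kap n t.
  have [k1 k2] := @kap_ge R n t ltac:(by rewrite t0' tb).
  have k3 := @yc_ge_sin R (4 * t) ltac:(apply/andP; split; slra).
  have k4 := @sin_big R n (4 * t) ltac:(apply/andP; split; slra).
  lra.
set D := pi / 4 - t in hh kk *; have D0 : 0 <= D by rewrite /D; lra.
set Y := seg _ _ _; set Z := seg _ _ _.
have ZE : Z = (1 - w) * (h * (e * c + s + m * (G + H))) + w * ((q * kap n t) * (e * c + s)).
  by rewrite /Z /seg -pq; ring.
have g2 : (e * c + s) * (e * c + s) = 1 + 2 * (e * (s * c)).
  transitivity ((e * e) * (c * c) + s * s + 2 * (e * (s * c))); first by ring.
  by rewrite ee mul1r cs1.
have gG : 0 <= (e * c + s) * G.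
  have E : (e * c + s) * G * sin t = cos t * (e * (s * c) + s * s).
    by rewrite -mulrA hG; ring.
  rewrite -(pmulr_lge0 _ st) E.
  by rewrite mulr_ge0 ?(ltW ct) // addr_ge0 // -expr2 sqr_ge0.
have gH : 0 <= (e * c + s) * H.
  have E : (e * c + s) * H * cos t = sin t * (c * c + e * (s * c)).
    by rewrite -mulrA hH -[in RHS](mul1r (c * c)) -ee; ring.
  rewrite -(pmulr_lge0 _ ct) E.
  by rewrite mulr_ge0 ?(ltW st) // addr_ge0 // -expr2 sqr_ge0.
have g4 : 1 <= `|e * c + s| <= 2.
  have : `|e * c + s| * `|e * c + s| = 1 + 2 * (e * (s * c)) by rewrite -normrM g2 ger0_norm //; lra.
  have k1 : 2 * (e * (s * c)) <= 1.
    have : 0 <= (e * c - s) * (e * c - s) by rewrite -expr2 sqr_ge0.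
    rewrite (_ : _ * _ = e * e * (c * c) + s * s - 2 * (e * (s * c))); last by ring.
    by rewrite ee mul1r cs1; lra.
  by have := normr_ge0 (e * c + s); move: `|_| => x x0 xx; apply/andP; split; nra.
have g1 : 2 * (K * D) <= (e * c + s) * Z.
  have k1 : 2 * K <= kz^-1 by rewrite /K mulrC mulfVK ?min_l // pnatr_eq0.
  have k2 : 2 * K <= 4 * q by rewrite /K mulrC mulfVK ?min_r // pnatr_eq0.
  have h1 : 2 * K * D <= h by apply: le_trans hh; rewrite mulrC ler_wpM2l.
  have h2 : 2 * K * D <= q * kap n t by rewrite (le_trans (ler_wpM2r D0 k2)) // mulrAC mulrC ler_wpM2l ?(ltW q0).
  have KD : 0 <= 2 * K * D by rewrite mulr_ge0 // mulr_ge0 ?ler0n // (ltW K0).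
  rewrite ZE (_ : (e * c + s) * _ = (1 - w) * (h * ((e * c + s) * (e * c + s) +
    m * ((e * c + s) * G + (e * c + s) * H))) +
    w * (q * kap n t * ((e * c + s) * (e * c + s)))); last by ring.
  rewrite g2; set X1 := 1 + _ + m * _; set X2 := 1 + 2 * _.
  have x1 : 1 <= X1.
    have a1 : 0 <= 2 * (e * (s * c)) by rewrite mulr_ge0 ?ler0n.
    have a2 := mulr_ge0 (ltW m0) (addr_ge0 gG gH).
    by rewrite /X1 -addrA lerDl addr_ge0.
  have x2 : 1 <= X2 by rewrite /X2 lerDl mulr_ge0 ?ler0n.
  have h0 : 0 <= h by exact: le_trans h1.
  have qk0 : 0 <= q * kap n t by exact: le_trans h2.
  have h3 : 2 * K * D <= h * X1 by rewrite (le_trans h1) // ler_peMr.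
  have h4 : 2 * K * D <= q * kap n t * X2 by rewrite (le_trans h2) // ler_peMr.
  have w1' : 0 <= 1 - w by lra.
  have := ler_wpM2l w0 h4; have := ler_wpM2l w1' h3; lra.
have g3 : (e * c + s) * Z <= 2 * `|Z|.
  rewrite (le_trans (ler_norm _)) // normrM ler_wpM2r //; by case/andP: g4.
have : K * D <= `|Z| by lra.
by move/le_trans; apply; rewrite /pnorm le_max lexx orbT.
Qed.

Lemma fib_diff : fib 0 (pi / 4)
  (fun t => Yo0 n T ky t - Yi0 n ky t) (fun t => Zo0 n T kz t - Zi0 n kz t)
  (fun t => Yo1 n T t - Yi1 n t) (fun t => Zo1 n T t - Zi1 n t).
Proof.
apply: fib_cat _ fib_diff_quarter; apply: fib_compact.
- by apply: cont_of_lip => a b; apply: lipB; [exact: lip_Yo0|exact: lip_Yi0].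
- by apply: cont_of_lip => a b; apply: lipB; [exact: lip_Zo0|exact: lip_Zi0].
- by apply: cont_of_lip => a b; apply: lipB; [exact: lip_Yo1|exact: lip_Yi1].
- by apply: cont_of_lip => a b; apply: lipB; [exact: lip_Zo1|exact: lip_Zi1].
move=> t s /andP[t0 t4]; apply: F_neq0 => //; rewrite t0 /= (le_lt_trans t4) //.
rewrite gtrBl divr_gt0 ?(lt_le_trans _ N3) //; slra.
Qed.

Lemma iso_untwisted : iso R
  (some3 (strands L (pi / 4) (@XX R) (Yo0 n T ky) (Zo0 n T kz) (Yi0 n ky) (Zi0 n kz)))
  (some3 (strands L (pi / 4) (@XX R) (Yo1 n T) (Zo1 n T) (@Yi1 R n) (@Zi1 R n))).
Proof.
apply: (@iso_strands R L (pi / 4) 1) => //.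
- by rewrite (le_trans _ L1).
- by slra.
- exact: lip_XX.
- exact: XX_gap.
- exact: lip_Yo0.
- exact: lip_Zo0.
- exact: lip_Yo1.
- exact: lip_Zo1.
- exact: lip_Yi0.
- exact: lip_Zi0.
- exact: lip_Yi1.
- exact: lip_Zi1.
- exact: fib_outer.
- exact: fib_inner.
- exact: fib_sum.
- exact: fib_diff.
Qed.

End homotopy_estimates.

(** * The twist removing the rotation of the frame *)

Section acos_clamped.
Variable R : realType.
Implicit Types x y a b : R.

Definition clamp11 x : R := Num.max (-1) (Num.min x 1).

Lemma clamp11_itv x : -1 <= clamp11 x <= 1.
Proof. by rewrite /clamp11 le_max lexx /= ge_max ge_min lexx orbT andbT; lra. Qed.

Lemma clamp11_id x : -1 <= x <= 1 -> clamp11 x = x.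
Proof. by move=> /andP[a b]; rewrite /clamp11 (min_idPl b) (max_idPr a). Qed.

Lemma clamp11_ge1 x : 1 <= x -> clamp11 x = 1.
Proof. by move=> h; rewrite /clamp11 (min_idPr h) (max_idPr _) //; lra. Qed.

Lemma clamp11_leN1 x : x <= -1 -> clamp11 x = -1.
Proof.
by move=> h; rewrite /clamp11 (min_idPl _) ?(max_idPl _) //; lra.
Qed.

Lemma clamp11_continuous : continuous clamp11.
Proof.
apply: cont_max; first exact: cont_cst.
by apply: cont_min; [move=> x; exact: cvg_id|exact: cont_cst].
Qed.

(** With $S=(a+b)/2$ and $D=(b-a)/2$ one has $\cos a-\cos b=2\sin S\sin D$, and both sines are at
    least $D/2$. Hence the arc cosine is Hölder of exponent $1/2$, and the twisting angle is
    continuous up to the ends. *)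
Lemma cos_gap a b : 0 <= a -> a <= b -> b <= pi -> (b - a) ^+ 2 <= 8 * (cos a - cos b).
Proof.
move=> a0 ab bpi; pose S := (a + b) / 2; pose D := (b - a) / 2.
have pi2 := @pi_ge2 R.
have sD : D / 2 <= sin D by apply: half_le_sin; apply/andP; split; rewrite /D; lra.
have sS : D / 2 <= sin S.
  have [S2|S2] := leP S (pi / 2).
    have : S / 2 <= sin S by apply: half_le_sin; rewrite S2 andbT /S; lra.
    by rewrite /S /D; lra.
  have -> : sin S = sin (pi - S) by rewrite -[pi - S]opprB sinN -{1}(subrK pi S) sinDpi.
  have : (pi - S) / 2 <= sin (pi - S) by apply: half_le_sin; apply/andP; split; rewrite /S in S2 *; lra.
  by rewrite /S /D; lra.
have -> : cos a - cos b = 2 * (sin S * sin D).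
  have -> : a = S - D by rewrite /S /D; field.
  have -> : b = S + D by rewrite /S /D; field.
  by rewrite cosB cosD; ring.
have -> : b - a = 2 * D by rewrite /D; field.
have D0 : 0 <= D / 2 by rewrite /D; lra.
have := ler_pM D0 D0 sS sD; rewrite expr2; lra.
Qed.

Lemma acos_clamp_continuous : continuous (fun x => acos (clamp11 x)).
Proof.
have key x y : clamp11 x <= clamp11 y ->
    `|acos (clamp11 x) - acos (clamp11 y)| ^+ 2 <= 8 * `|clamp11 x - clamp11 y|.
  move=> xy; have hx := clamp11_itv x; have hy := clamp11_itv y.
  have ax : acos (clamp11 y) <= acos (clamp11 x).
    rewrite leNgt; apply/negP => lt_.
    have h := cos_gap (acos_ge0 hx) (ltW lt_) (acos_lepi hy).
    rewrite !acosK ?in_itv //= in h.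
    have : 0 < (acos (clamp11 y) - acos (clamp11 x)) ^+ 2 by rewrite exprn_gt0 // subr_gt0.
    lra.
  have h := cos_gap (acos_ge0 hy) ax (acos_lepi hx).
  rewrite !acosK ?in_itv //= in h.
  by rewrite real_normK ?num_real // (le_trans h) // ler_wpM2l // distrC ler_norm.
have {}key x y : `|acos (clamp11 x) - acos (clamp11 y)| ^+ 2 <= 8 * `|clamp11 x - clamp11 y|.
  have [/key //|/ltW/key] := leP (clamp11 x) (clamp11 y).
  by rewrite distrC [in X in _ <= X]distrC.
move=> x; apply/(@cvgrPdist_le _ _ _ (nbhs x)) => e e0.
have /cvgrPdist_le /(_ (e ^+ 2 / 8)) h := @clamp11_continuous x.
have {}h := h ltac:(by rewrite divr_gt0 // exprn_gt0).
near=> y.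
have : `|acos (clamp11 x) - acos (clamp11 y)| ^+ 2 <= e ^+ 2.
  rewrite (le_trans (key x y)) // mulrC -ler_pdivlMr //; near: y; exact: h.
by rewrite ler_sqr // nnegrE // ltW.
Unshelve. all: by end_near. Qed.

(** Carries $\cos a$ to $(2-\sin a)\cos a$ for $0\le a\le\pi$, turning the natural abscissa [xc]
    into [XX]. *)
Definition unround x : R := 2 * x - clamp11 x * Num.sqrt (1 - clamp11 x ^+ 2).

Lemma line_homeo_unround : line_homeo unround.
Proof.
have s01 x : 0 <= Num.sqrt (1 - clamp11 x ^+ 2) <= 1.
  have /andP[a b] := clamp11_itv x; rewrite sqrtr_ge0 /=.
  by rewrite -[leRHS]sqrtr1 ler_wsqrtr // gerBl sqr_ge0.
split.
- apply: contB; first by apply: contM; [exact: cont_cst|move=> x; exact: cvg_id].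
  apply: contM; first exact: clamp11_continuous.
  apply: (@comp_continuous _ _ _ (fun x => 1 - clamp11 x ^+ 2)); last exact: sqrt_continuous.
  apply: contB; first exact: cont_cst.
  rewrite (_ : (fun x => _) = fun x => clamp11 x * clamp11 x); last by apply/funext => x; rewrite expr2.
  by apply: contM; exact: clamp11_continuous.
- move=> x y xy; rewrite /unround.
  (* With [c = clamp11 x] the value is [2 * x - c + f c]: the first part increases strictly because
     clamping is 1-Lipschitz, and [f] is nondecreasing. *)
  pose f c : R := c * (1 - Num.sqrt (1 - c ^+ 2)).
  have f_pos a b : 0 <= a -> a <= b -> b <= 1 -> f a <= f b.
    move=> a0 ab b1; rewrite /f; apply: ler_pM => //.
      by rewrite subr_ge0 -[leRHS]sqrtr1 ler_wsqrtr // gerBl sqr_ge0.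
    rewrite lerD2l lerN2 ler_wsqrtr // lerD2l lerN2.
    by rewrite ler_sqr // nnegrE // (le_trans a0).
  have fN c : f (- c) = - f c by rewrite /f sqrrN mulNr.
  have f_mono a b : -1 <= a -> a <= b -> b <= 1 -> f a <= f b.
    move=> a1 ab b1; have [a0|/ltW a0] := leP 0 a; first exact: f_pos.
    have [b0|/ltW b0] := leP 0 b; last first.
      by rewrite -lerN2 -!fN; apply: f_pos; lra.
    have f0 : f 0 = 0 by rewrite /f mul0r.
    have h1 := f_pos 0 b (lexx _) b0 b1.
    have := f_pos 0 (- a) (lexx _) ltac:(lra) ltac:(lra); rewrite fN; lra.
  have /andP[x1 x2] := clamp11_itv x; have /andP[y1 y2] := clamp11_itv y.
  have cxy : clamp11 x <= clamp11 y /\ clamp11 y - clamp11 x <= y - x.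
    by rewrite /clamp11; split; case: (leP x 1); case: (leP y 1) => *;
      case: (leP (-1) x); case: (leP (-1) y); case: (leP (-1 : R) 1) => *; lra.
  have [h1 h2] := cxy; have := f_mono _ _ x1 h1 y2; rewrite /f.
  move: (clamp11 x) (clamp11 y) (Num.sqrt _) (Num.sqrt _) h1 h2 => *; lra.
- move=> B; exists (`|B| + 1) => x.
  have /andP[c1 c2] := clamp11_itv x; have /andP[s0 s1] := s01 x.
  have h : - 1 <= clamp11 x * Num.sqrt (1 - clamp11 x ^+ 2) <= 1.
    by move: (clamp11 x) (Num.sqrt _) c1 c2 s0 s1 => c s *; apply/andP; split; nra.
  have b1 := ler_norm B; have b2 : - B <= `|B| by rewrite -normrN ler_norm.
  have b3 := normr_ge0 B; case/andP: h => *.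
  by rewrite /unround; split => *; lra.
Qed.

End acos_clamped.

Section rotated.
Variables (R : realType) (n : nat) (T : R).
Hypotheses (n1 : (1 <= n)%N) (T1 : 1 <= T).

Local Notation N := ((dg n)%:R : R).
Local Notation m := (mu R n).
Local Notation e := (eps n : R).
Local Notation q := (cos (pi / 4) : R).
Implicit Types t : R.
Let L := 2 * T - 1.
Let ee : e * e = 1 := eps_sqr R n.

Definition xc t : R := ext t + cos (4 * tau t).
(** In the plane of complex numbers $y+iz$ and for $t\ge0$, outer and inner strand are
    $\pm\kappa/2+(m/2)e^{-2iNt}$; with their images under the half-turn they form two pairs, each
    rotating about its centre $\pm\kappa/2$. *)
Definition Yo2 t : R :=
  (kap n (tau t) + m * cos (2 * (N * tau t))) / 2 - m * (ext t / (2 * T - 1)).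
Definition Zo2 t : R := - (m * sin (2 * (N * tau t)) / 2).
Definition Yi2 t : R := - ((kap n t - m * cos (2 * (N * t))) / 2).
Definition Zi2 t : R := - (m * sin (2 * (N * t)) / 2).
Definition psi x : R := N * (acos (clamp11 x) / 4) + e * (pi / 4).

Lemma xc_unround t : t <= pi / 4 -> unround (xc t) = XX t.
Proof.
move=> t4; rewrite /unround /xc /XX; have [t0|t0] := leP 0 t.
  rewrite ext_0 // tau_id // mulr0 !add0r clamp11_id ?cos_geN1 ?cos_le1 //.
  rewrite -sin2cos2 sqrtr_sqr ger0_norm; first by ring.
  by apply: sin_ge0_pi; apply/andP; split; lra.
have t0' := ltW t0; rewrite tau_0 // ext_id // !mulr0 cos0 sin0 clamp11_ge1; last lra.
by rewrite expr1n subrr sqrtr0; ring.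
Qed.

Lemma psi_xc t : t <= pi / 4 -> psi (xc t) = N * tau t + e * (pi / 4).
Proof.
move=> t4; rewrite /psi /xc; have [t0|t0] := leP 0 t.
  rewrite ext_0 // tau_id // add0r clamp11_id ?cos_geN1 ?cos_le1 //.
  rewrite cosK ?in_itv /=; last by apply/andP; split; lra.
  by congr (_ + _); field.
have t0' := ltW t0; rewrite tau_0 // ext_id // !mulr0 cos0 clamp11_ge1; last lra.
by rewrite acos1 mul0r mulr0.
Qed.

Let tau_ext t : ext t = 0 \/ tau t = 0.
Proof.
by have [t0|/ltW t0] := leP 0 t; [left; exact: ext_0|right; exact: tau_0].
Qed.

Let double (x : R) : cos (2 * x) = cos x * cos x - sin x * sin x /\
  sin (2 * x) = 2 * (sin x * cos x) /\ cos x * cos x + sin x * sin x = 1.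
Proof.
rewrite (_ : 2 * x = x + x); last by ring.
by rewrite cosD sinD -!expr2 cos2Dsin2; split => //; split => //; ring.
Qed.

Lemma rot_outer t : t <= pi / 4 ->
  plane_rot (psi (xc t)) (Yo2 t) (Zo2 t) = (Yo1 n T t, Zo1 n T t).
Proof.
move=> t4; rewrite psi_xc // /plane_rot cosD sinD cos_eps_pi4 sin_eps_pi4.
have [c2 [s2 cs]] := double (N * tau t).
rewrite /Yo2 /Zo2 /Yo1 /Zo1 c2 s2 /pp /qq.
have eq0 : ext t * sin (N * tau t) = 0 /\ ext t * cos (N * tau t) = ext t.
  by case: (tau_ext t) => ->; rewrite ?mul0r ?mulr0 ?sin0 ?cos0 ?mulr0 ?mulr1.
case: eq0 => es ec.
move: es ec cs; set c := cos (N * tau t); set s := sin (N * tau t).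
move: (kap n (tau t)) (ext t) => k x es ec cs.
congr (_, _).
  transitivity (q * (k + m * (c * c + s * s)) / 2 * c - e * (q * (k - m * (c * c + s * s)) / 2 * s)
     - q * m * ((x * c - e * (x * s)) / (2 * T - 1))); last by rewrite cs es ec; ring.
  by field; have := T1; lra.
transitivity (e * (q * (k + m * (c * c + s * s)) / 2 * c) + q * (k - m * (c * c + s * s)) / 2 * s
     - e * (q * m * ((x * c + e * (x * s)) / (2 * T - 1))) + (e * e - 1) * (q * m * (x * s) / (2 * T - 1)));
  last by rewrite cs es ec ee; ring.
by field; have := T1; lra.
Qed.

Lemma rot_inner t : 0 <= t <= pi / 4 ->
  plane_rot (psi (xc t)) (Yi2 t) (Zi2 t) = (Yi1 n t, Zi1 n t).
Proof.
move=> /andP[t0 t4]; rewrite psi_xc // tau_id // /plane_rot cosD sinD cos_eps_pi4 sin_eps_pi4.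
have [c2 [s2 cs]] := double (N * t).
rewrite /Yi2 /Zi2 /Yi1 /Zi1 c2 s2 /pp /qq.
move: cs; set c := cos (N * t); set s := sin (N * t); move: (kap n t) => k cs.
congr (_, _).
  transitivity (e * (q * (k + m * (c * c + s * s)) / 2 * s) - q * (k - m * (c * c + s * s)) / 2 * c);
    last by rewrite cs; ring.
  by field.
transitivity (- (q * (k + m * (c * c + s * s)) / 2 * s) - e * (q * (k - m * (c * c + s * s)) / 2 * c));
  last by rewrite cs; ring.
by field.
Qed.

Lemma twist_strands : twist psi @` strands L (pi / 4) xc Yo2 Zo2 Yi2 Zi2 =
  strands L (pi / 4) xc (Yo1 n T) (Zo1 n T) (@Yi1 R n) (@Zi1 R n).
Proof.
rewrite /strands image_comp; apply: eq_imagel => -[[b i] t]; rewrite /strand_dom /= => ht.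
rewrite /twist !c_vec3 /=.
have /andP[_ t4] := ht.
case: i ht => /= ht.
  by have := rot_inner ht; rewrite /plane_rot => -[<- <-]; congr vec3; ring.
by have := rot_outer t4; rewrite /plane_rot => -[<- <-]; congr vec3; ring.
Qed.

Lemma coord_strands Yo Zo Yi Zi : coord_map (@unround R) id id @`
  strands L (pi / 4) xc Yo Zo Yi Zi = strands L (pi / 4) (@XX R) Yo Zo Yi Zi.
Proof.
rewrite /strands image_comp; apply: eq_imagel => -[[b i] t]; rewrite /strand_dom /= => ht.
rewrite /coord_map !c_vec3 /= xc_unround //.
by case/andP: ht.
Qed.

Lemma line_homeo_id : line_homeo (@id R).
Proof.
split => //; first by move=> x; exact: cvg_id.
by move=> B; exists B => x; split.
Qed.

Lemma iso_some3 (h : 'rV[R]_3 -> 'rV[R]_3) (A : set 'rV[R]_3) :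
  ambient R (omap h : sphere3 R -> sphere3 R) -> iso R (some3 A) (some3 (h @` A)).
Proof.
move=> ah; exists (omap h : sphere3 R -> sphere3 R) => //.
by rewrite /some3 !image_comp.
Qed.

(** The angle is a function of $\cos 4t$, so [unround] is undone before the twist and redone after
    it. *)
Lemma iso_rotated : iso R
  (some3 (strands L (pi / 4) (@XX R) Yo2 Zo2 Yi2 Zi2))
  (some3 (strands L (pi / 4) (@XX R) (Yo1 n T) (Zo1 n T) (@Yi1 R n) (@Zi1 R n))).
Proof.
have cpsi : continuous psi.
  apply: contD; last exact: cont_cst.
  apply: contM; first exact: cont_cst.
  by apply: contM; [exact: acos_clamp_continuous|exact: cont_cst].
have hc := ambient_coord_map (line_homeo_unround R) line_homeo_id line_homeo_id.
rewrite -!coord_strands -twist_strands.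
apply: iso_trans (iso_sym (iso_some3 _ hc)) _.
apply: iso_trans (iso_some3 _ (ambient_twist cpsi)) _.
exact: iso_some3.
Qed.

End rotated.

(** * Reparametrizing an arc of the upper half-plane by its polar angle *)

Section polar.
Variables (R : realType) (l c : R) (X G : R -> R).
Local Notation b := (pi / 4 : R).
Local Notation h := (pi / 8 : R).
Hypotheses (l0 : l <= 0) (c0 : 0 < c).
Hypotheses (lX : lip l b X) (cX : continuous X) (cG : continuous G) (lG : lip l b G).
Hypothesis X_decr : forall t t', l <= t -> t < t' -> t' <= b -> X t' < X t.
Hypotheses (X_h : X h = 0) (G_l : G l = 0) (G_b : G b = 0).
Hypothesis G_ge0 : forall t, l <= t <= b -> 0 <= G t.
Hypothesis norm_ge1 : forall t, l <= t <= b -> 1 <= X t * X t + G t * G t.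
(* The curve turns counterclockwise in each quadrant. *)
Hypothesis cross_ge : forall t t', l <= t -> t <= t' -> t' <= b -> t' <= h \/ h <= t ->
  c * (t' - t) <= X t * G t' - X t' * G t.

Let pi2 : 2 <= pi :> R := @pi_ge2 R.
Ltac plra := have ? := pi2; have ? := l0; lra.

Definition polar_radius (a t : R) := X t * cos a + G t * sin a.
Definition on_ray (a t : R) := X t * sin a = G t * cos a /\ 1 <= polar_radius a t.

Let csq (a : R) : cos a * cos a + sin a * sin a = 1.
Proof. by rewrite -!expr2 cos2Dsin2. Qed.

Lemma on_rayX a t : on_ray a t -> X t = polar_radius a t * cos a.
Proof.
move=> [xg _]; rewrite /polar_radius -[LHS]mulr1 -(csq a) [LHS]mulrDr.
transitivity (X t * (cos a * cos a) + X t * sin a * sin a); first by ring.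
by rewrite xg; ring.
Qed.

Lemma on_rayG a t : on_ray a t -> G t = polar_radius a t * sin a.
Proof.
move=> [xg _]; rewrite /polar_radius -[LHS]mulr1 -(csq a) [LHS]mulrDr.
transitivity (G t * cos a * cos a + G t * sin a * sin a); first by ring.
by rewrite -xg; ring.
Qed.

Let X_le t t' : l <= t -> t <= t' -> t' <= b -> X t' <= X t.
Proof. by move=> lt; rewrite le_eqVlt => /orP[/eqP -> //|tt tb]; exact/ltW/X_decr. Qed.

Let X_l : 0 <= X l.
Proof. by rewrite -X_h; apply: X_le; plra. Qed.

Let X_b : X b <= 0.
Proof. by rewrite -X_h; apply: X_le; plra. Qed.

Lemma on_ray_0 : on_ray 0 l.
Proof.
rewrite /on_ray /polar_radius G_l sin0 cos0 !(mulr0, mul0r, mulr1, addr0); split=> //.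
have lb : l <= l <= b by rewrite lexx; plra.
have := norm_ge1 lb; have := X_l; rewrite G_l mulr0 addr0 => *; nra.
Qed.

Lemma on_ray_pi : on_ray pi b.
Proof.
rewrite /on_ray /polar_radius G_b sinpi cospi !(mulr0, mul0r, mulr1, addr0); split=> //.
have lb : l <= b <= b by rewrite lexx andbT; plra.
have := norm_ge1 lb; have := X_b; rewrite G_b mulr0 addr0 => *; nra.
Qed.

(** The intermediate value theorem finds a point on the line of angle $a$, and $G\ge0$ puts it on
    the ray rather than on the opposite one. The angles $0$ and $\pi$ are separate because their
    sine vanishes. *)
Lemma on_ray_exists a : 0 <= a <= pi -> exists2 t, l <= t <= b & on_ray a t.
Proof.
move=> a0pi; have /andP[a0 api] := a0pi.
have lb : l <= b by plra.
have Xl := X_l; have Xb := X_b.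
have [->|an0] := eqVneq a 0.
  by exists l; [rewrite lexx lb|exact: on_ray_0].
have [->|anpi] := eqVneq a pi.
  by exists b; [rewrite lexx lb|exact: on_ray_pi].
have s0 : 0 < sin a by apply: sin_gt0_pi; rewrite !lt_neqAle eq_sym an0 a0 anpi.
have cf : {within `[l, b], continuous (fun t => X t * sin a - G t * cos a)}.
  by apply: continuous_subspaceT; apply: contB; apply: contM => //; exact: cont_cst.
have hm : Num.min (X l * sin a - G l * cos a) (X b * sin a - G b * cos a) <= 0 <=
    Num.max (X l * sin a - G l * cos a) (X b * sin a - G b * cos a).
  rewrite G_l G_b !mul0r !subr0 ge_min le_max.
  by apply/andP; split; apply/orP; [right; nra|left; nra].
have [t] := IVT lb cf hm; rewrite in_itv /= => tlb /eqP.
rewrite subr_eq0 => /eqP xg; exists t => //; split => //.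
have hn := norm_ge1 tlb; have hG := G_ge0 tlb.
have r2 : 1 <= polar_radius a t * polar_radius a t.
  rewrite (_ : _ * _ = (X t * X t + G t * G t) * (cos a * cos a + sin a * sin a)
    - (X t * sin a - G t * cos a) * (X t * sin a - G t * cos a)).
    by rewrite csq xg subrr mul0r subr0 mulr1.
  by rewrite /polar_radius; ring.
have rG : G t = polar_radius a t * sin a.
  transitivity (G t * (cos a * cos a + sin a * sin a)); first by rewrite csq mulr1.
  transitivity (G t * cos a * cos a + G t * sin a * sin a); first by ring.
  by rewrite -xg /polar_radius; ring.
have r0 : 0 <= polar_radius a t by rewrite -(pmulr_lge0 _ s0) -rG.
nra.
Qed.

Let X_lt0 t : h < t -> t <= b -> X t < 0.
Proof. by move=> ht tb; rewrite -X_h; apply: X_decr => //; plra. Qed.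

Let X_gt0 t : l <= t -> t < h -> 0 < X t.
Proof. by move=> lt th; rewrite -X_h; apply: X_decr => //; plra. Qed.

Lemma on_ray_quadrant1 a t : l <= t <= b -> 0 <= a <= pi / 2 -> on_ray a t -> t <= h.
Proof.
move=> /andP[lt tb] /andP[a0 a2] ray; rewrite leNgt; apply/negP => ht.
have c1 : 0 <= cos a by apply: cos_ge0_pihalf; apply/andP; split; plra.
have := X_lt0 ht tb; rewrite (on_rayX ray); case: ray => _ r1.
by rewrite ltNge mulr_ge0 // (le_trans ler01).
Qed.

Let cos_obtuse (a : R) : pi / 2 <= a <= pi -> cos a <= 0.
Proof.
move=> /andP[a2 api].
have := @cos_ge0_pihalf R (a - pi); rewrite cosB cospi sinpi mulr0 addr0 mulrN1 oppr_ge0.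
by apply; apply/andP; split; plra.
Qed.

Lemma on_ray_quadrant2 a t : l <= t <= b -> pi / 2 <= a <= pi -> on_ray a t -> h <= t.
Proof.
move=> /andP[lt tb] a2 ray; rewrite leNgt; apply/negP => ht.
have c1 := cos_obtuse a2.
have := X_gt0 lt ht; rewrite (on_rayX ray); case: ray => _ r1.
by rewrite ltNge mulr_ge0_le0 // (le_trans ler01).
Qed.

Definition same_quadrant (a a' : R) :=
  (0 <= a <= pi / 2 /\ 0 <= a' <= pi / 2) \/ (pi / 2 <= a <= pi /\ pi / 2 <= a' <= pi).

(** The cross product of the two points is $rr'\sin(a'-a)$, which lies between $0$ and $rr'(a'-a)$;
    [cross_ge] compares it with $c(t'-t)$ and also fixes the order of $t$ and $t'$. *)
Lemma ray_monotone a a' t t' : same_quadrant a a' -> a <= a' ->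
  l <= t <= b -> l <= t' <= b -> on_ray a t -> on_ray a' t' ->
  t <= t' /\ c * (t' - t) <= polar_radius a t * polar_radius a' t' * (a' - a).
Proof.
move=> sq aa tb tb' ray ray'.
have hh : (t <= h /\ t' <= h) \/ (h <= t /\ h <= t').
  case: sq => -[q q']; [left|right]; split.
  - exact: on_ray_quadrant1 tb q ray.
  - exact: on_ray_quadrant1 tb' q' ray'.
  - exact: on_ray_quadrant2 tb q ray.
  - exact: on_ray_quadrant2 tb' q' ray'.
have /andP[lt tb1] := tb; have /andP[lt' tb1'] := tb'.
have r1 : 0 <= polar_radius a t by case: ray => _; exact: le_trans.
have r1' : 0 <= polar_radius a' t' by case: ray' => _; exact: le_trans.
have cr : X t * G t' - X t' * G t = polar_radius a t * polar_radius a' t' * sin (a' - a).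
  by rewrite (on_rayX ray) (on_rayX ray') (on_rayG ray) (on_rayG ray') sinB; ring.
have s0 : 0 <= sin (a' - a).
  by apply: sin_ge0_pi; case: sq => -[/andP[q1 q2] /andP[q3 q4]]; apply/andP; split; plra.
have s1 : sin (a' - a) <= a' - a.
  have := sin_lip1 (a' - a) 0; rewrite sin0 !subr0 [X in _ <= X]ger0_norm ?subr_ge0 //.
  by apply: le_trans; exact: ler_norm.
have rr := mulr_ge0 r1 r1'.
have tt : t <= t'.
  rewrite leNgt; apply/negP => t't.
  have := @cross_ge t' t lt' (ltW t't) tb1 ltac:(by case: hh => -[? ?]; [left|right]).
  have : 0 < c * (t - t') by rewrite mulr_gt0 // subr_gt0.
  have := mulr_ge0 rr s0; rewrite -cr.
  by move: (c * _) (X t * _) (X t' * _) => u v w *; lra.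
split=> //.
have := @cross_ge t t' lt tt tb1' ltac:(by case: hh => -[? ?]; [left|right]).
rewrite cr => /le_trans; apply; exact: ler_wpM2l.
Qed.

Lemma on_ray_unique a t t' : 0 <= a <= pi -> l <= t <= b -> l <= t' <= b ->
  on_ray a t -> on_ray a t' -> t = t'.
Proof.
move=> /andP[a0 a1] tb tb' ray ray'.
have sq : same_quadrant a a.
  by have [a2|/ltW a2] := leP a (pi / 2); [left|right]; rewrite a2 ?a0 ?a1.
have [tt _] := ray_monotone sq (lexx a) tb tb' ray ray'.
have [tt' _] := ray_monotone sq (lexx a) tb' tb ray' ray.
by apply/eqP; rewrite eq_le tt tt'.
Qed.

Lemma on_ray_surjective t : l <= t <= b -> exists2 a, 0 <= a <= pi & on_ray a t.
Proof.
move=> tb; pose r := Num.sqrt (X t * X t + G t * G t).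
have n1 := norm_ge1 tb.
have rr : r * r = X t * X t + G t * G t by rewrite -expr2 sqr_sqrtr // (le_trans ler01).
have r0 : 0 <= r := sqrtr_ge0 _.
have r1 : 1 <= r by nra.
have rn0 : r != 0 by rewrite gt_eqF // (lt_le_trans ltr01).
have gg : 0 <= G t * G t by rewrite -expr2 sqr_ge0.
have xr : -1 <= X t / r <= 1.
  rewrite ler_pdivlMr ?(lt_le_trans ltr01) // ler_pdivrMr ?(lt_le_trans ltr01) //.
  by apply/andP; split; nra.
exists (acos (X t / r)); first by rewrite acos_ge0 // acos_lepi.
have ca : cos (acos (X t / r)) = X t / r by rewrite acosK // in_itv.
have sa : sin (acos (X t / r)) = G t / r.
  rewrite sin_acos // (_ : 1 - _ = (G t / r) ^+ 2).
    by rewrite sqrtr_sqr ger0_norm // divr_ge0 // G_ge0.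
  rewrite !expr2 [1](_ : _ = (X t * X t + G t * G t) / (r * r)); first by field.
  by rewrite -rr divff // mulf_neq0.
rewrite /on_ray /polar_radius ca sa; split; first by rewrite mulrA mulrCA mulrA.
rewrite !mulrA -mulrDl -rr mulfK //.
Qed.

(** Within a quadrant [ray_monotone] gives the Lipschitz constant $K^2/c$, where $K$ bounds the
    radius; the two quadrants are glued at $\pi/2$. *)
Lemma polar_parameter : exists tg : R -> R, exists K,
  [/\ forall a, 0 <= a <= pi -> l <= tg a <= b /\ on_ray a (tg a),
      forall t, l <= t <= b -> exists2 a, 0 <= a <= pi & tg a = t,
      lip 0 pi tg, tg 0 = l /\ tg pi = b
    & forall a, 0 <= a <= pi -> polar_radius a (tg a) <= K].
Proof.
have /choice[tg tgP] : forall a, exists t, 0 <= a <= pi -> l <= t <= b /\ on_ray a t.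
  move=> a; have [/on_ray_exists[t tb ray]|a0] := boolP (0 <= a <= pi).
    by exists t.
  by exists 0.
have [MX MX0 hX] := lip_bounded lX; have [MG MG0 hG] := lip_bounded lG.
pose K := MX + MG.
have rK a : 0 <= a <= pi -> polar_radius a (tg a) <= K.
  move=> a0; have [tb _] := tgP a a0.
  have c1 : `|cos a| <= 1 by rewrite ler_norml cos_geN1 cos_le1.
  have s1 : `|sin a| <= 1 by rewrite ler_norml sin_geN1 sin_le1.
  rewrite (le_trans (ler_norm _)) // /polar_radius (le_trans (ler_normD _ _)) // !normrM.
  by rewrite lerD // -[leRHS]mulr1 ler_pM // ?hX ?hG.
have lipq a a' : same_quadrant a a' -> 0 <= a <= pi -> 0 <= a' <= pi -> a <= a' ->
    `|tg a - tg a'| <= K * K / c * `|a - a'|.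
  move=> sq a0 a0' aa; have [tb ray] := tgP a a0; have [tb' ray'] := tgP a' a0'.
  have [tt ct] := ray_monotone sq aa tb tb' ray ray'.
  rewrite distrC ger0_norm ?subr_ge0 // distrC ger0_norm ?subr_ge0 //.
  rewrite mulrAC ler_pdivlMr // mulrC (le_trans ct) // ler_wpM2r ?subr_ge0 //.
  have r0 : 0 <= polar_radius a (tg a) by case: ray => _; exact: le_trans.
  have r0' : 0 <= polar_radius a' (tg a') by case: ray' => _; exact: le_trans.
  by rewrite ler_pM // rK.
have lq u v : (forall a a', u <= a <= v -> u <= a' <= v -> same_quadrant a a') ->
    0 <= u -> v <= pi -> lip u v tg.
  move=> sq u0 vpi; exists (K * K / c); first by rewrite divr_ge0 ?mulr_ge0 ?addr_ge0 // ltW.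
  have sub a : u <= a <= v -> 0 <= a <= pi.
    by move=> /andP[ua av]; rewrite (le_trans u0) ?(le_trans av).
  move=> a a' ha ha'; have [aa|/ltW aa] := leP a a'.
    by apply: lipq => //; [exact: sq|exact: sub|exact: sub].
  rewrite distrC [X in _ <= _ * X]distrC.
  by apply: lipq => //; [exact: sq|exact: sub|exact: sub].
exists tg, K; split => //.
- move=> t tb; have [a a0 ray] := on_ray_surjective tb; exists a => //.
  by have [tb' ray'] := tgP a a0; exact: on_ray_unique a0 tb' tb ray' ray.
- apply: (@lip_cat _ _ (pi / 2)); first by apply/andP; split; plra.
    by apply: lq; [move=> *; left|plra|plra].
  by apply: lq; [move=> *; right|plra|plra].
- have i0 : 0 <= (0 : R) <= pi by rewrite lexx; plra.
  have ip : 0 <= (pi : R) <= pi by rewrite lexx andbT; plra.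
  have lb : l <= b by plra.
  have [t0 r0] := tgP 0 i0; have [tp rp] := tgP pi ip; split.
    by apply: (on_ray_unique i0 t0 _ r0 on_ray_0); rewrite lexx.
  by apply: (on_ray_unique ip tp _ rp on_ray_pi); rewrite lexx andbT.
Qed.

(* A point above the base curve (2 - sin a) (cos a, sin a) lies further out. *)
Lemma radius_above a t p : 0 <= a <= pi -> l <= t <= b -> on_ray a t -> 0 <= p ->
  X (a / 4) = (2 - sin a) * cos a -> G (a / 4) = (2 - sin a) * sin a + p ->
  (p = 0 -> t = a / 4 /\ polar_radius a t = 2 - sin a) /\ (0 < p -> 2 - sin a < polar_radius a t).
Proof.
move=> a0 tb ray p0 Xa Ga; have /andP[a00 api] := a0.
have tb4 : l <= a / 4 <= b by apply/andP; split; plra.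
have /andP[l4 b4] := tb4; have /andP[lt tb1] := tb.
have rho : polar_radius a (a / 4) = 2 - sin a + p * sin a.
  transitivity ((2 - sin a) * (cos a * cos a + sin a * sin a) + p * sin a).
    by rewrite /polar_radius Xa Ga; ring.
  by rewrite csq mulr1.
split=> [p00|pp].
  have ray4 : on_ray a (a / 4).
    split; first by rewrite Xa Ga p00 addr0; ring.
    by rewrite rho p00 mul0r addr0; have := sin_le1 a; lra.
  by rewrite (on_ray_unique a0 tb tb4 ray ray4) rho p00 mul0r addr0.
have r1 : 0 < polar_radius a t by case: ray => _; exact: lt_le_trans.
have [a2|a2|a2] := ltgtP a (pi / 2).
- have c1 : 0 < cos a by apply: cos_gt0_pihalf; apply/andP; split; plra.
  have th : t <= h by apply: on_ray_quadrant1 tb _ ray; rewrite a00 ltW.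
  have t4 : t < a / 4.
    rewrite ltNge; apply/negP => at_.
    have := @cross_ge (a / 4) t l4 at_ tb1 (or_introl th).
    rewrite (on_rayX ray) (on_rayG ray) Xa Ga.
    have : 0 <= c * (t - a / 4) by rewrite mulr_ge0 ?subr_ge0 // ltW.
    have : 0 < polar_radius a t * (p * cos a) by rewrite !mulr_gt0.
    by move: (polar_radius a t) => r *; lra.
  by have := X_decr lt t4 b4; rewrite Xa (on_rayX ray) ltr_pM2r.
- have c1 : cos a < 0.
    have := @cos_gt0_pihalf R (a - pi); rewrite cosB cospi sinpi mulr0 addr0 mulrN1 oppr_gt0.
    by apply; apply/andP; split; plra.
  have th : h <= t by apply: on_ray_quadrant2 tb _ ray; rewrite api ltW.
  have t4 : a / 4 < t.
    rewrite ltNge; apply/negP => at_.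
    have := @cross_ge t (a / 4) lt at_ b4 (or_intror th).
    rewrite (on_rayX ray) (on_rayG ray) Xa Ga.
    have : 0 <= c * (a / 4 - t) by rewrite mulr_ge0 ?subr_ge0 // ltW.
    have : 0 < polar_radius a t * (p * - cos a) by rewrite !mulr_gt0 ?oppr_gt0.
    by move: (polar_radius a t) => r *; lra.
  by have := X_decr l4 t4 tb1; rewrite Xa (on_rayX ray) ltr_nM2r.
- have Xt : X t = 0 by rewrite (on_rayX ray) a2 cos_pihalf mulr0.
  have th : t = h.
    apply/eqP; rewrite eq_le !leNgt; apply/andP; split; apply/negP => k.
      by have := X_lt0 k tb1; rewrite Xt ltxx.
    by have := X_gt0 lt k; rewrite Xt ltxx.
  have -> : t = a / 4 by rewrite th a2; field.
  by rewrite rho a2 sin_pihalf mulr1 ltrDl.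
Qed.

End polar.

(** * Closed 2-braids around the vertical axis *)

Section pages.
Variable R : realType.

(* The closed 2-braid meeting the page of angle 2 d in the points of radius r d
   and height z d; its two halves are exchanged by (x, y, z) -> (x, -y, -z). *)
Definition page (r z : R -> R) (u : bool * R) : 'rV[R]_3 :=
  vec3 (r u.2 * cos (2 * u.2)) (sg u.1 * (r u.2 * sin (2 * u.2))) (sg u.1 * z u.2).

Definition page_dom : set (bool * R) := [set u | 0 <= u.2 <= pi].

Definition page_set r z : set 'rV[R]_3 := page r z @` page_dom.

(* The other point on the same page. *)
Definition partner (u : bool * R) : bool * R := (~~ u.1, pi - u.2).

(** Half the polar angle, with a sign for the copy. Two points lie on the same page exactly when
    their phases agree modulo $\pi$. *)
Definition phase (u : bool * R) : R := sg u.1 * u.2.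

Lemma sg_sqr (e : bool) : sg e * sg e = 1 :> R.
Proof. by rewrite /sg -expr2 sqrr_sign. Qed.

Lemma sgN (e : bool) : sg (~~ e) = - sg e :> R.
Proof. by apply: sg_neq; case: e. Qed.

Lemma norm_sg (e : bool) : `|sg e| = 1 :> R.
Proof. by rewrite /sg normrX normrN1 expr1n. Qed.

Lemma trig_double (x : R) : cos (2 * x) = cos x * cos x - sin x * sin x /\
  sin (2 * x) = 2 * (sin x * cos x) /\ cos x * cos x + sin x * sin x = 1.
Proof.
rewrite (_ : 2 * x = x + x); last by ring.
by rewrite cosD sinD -!expr2 cos2Dsin2; split => //; split => //; ring.
Qed.

Lemma cos_double_phase u : cos (2 * phase u) = cos (2 * u.2).
Proof. by rewrite /phase /sg; case: u.1; rewrite ?expr0 ?expr1 ?mulN1r ?mul1r ?mulrN ?cosN. Qed.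

Lemma sin_double_phase u : sin (2 * phase u) = sg u.1 * sin (2 * u.2).
Proof.
by rewrite /phase /sg; case: u.1; rewrite ?expr0 ?expr1 ?mulN1r ?mul1r ?mulrN ?sinN.
Qed.

(** The squared horizontal distance is $(r-r')^2+4rr'\sin^2$ of the difference of phases. *)
Lemma page_gap (r z : R -> R) (c : R) u v : 0 <= c -> c <= r u.2 -> c <= r v.2 ->
  c * `|sin (phase u - phase v)| <= `|page r z u - page r z v|.
Proof.
move=> c0 cu cv; set D := `|_ - _|.
have hx : `|r u.2 * cos (2 * phase u) - r v.2 * cos (2 * phase v)| <= D.
  by rewrite !cos_double_phase (le_trans _ (le_norm_cx _)) // vec3B c_vec3.
have hy : `|r u.2 * sin (2 * phase u) - r v.2 * sin (2 * phase v)| <= D.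
  rewrite !sin_double_phase (le_trans _ (le_norm_cy _)) // vec3B c_vec3.
  by rewrite !(mulrCA (r _)).
move: hx hy; set x := r u.2 * _ - _; set y := r u.2 * _ - _ => hx hy.
set S := sin _.
have key : 4 * (r u.2 * r v.2) * (S * S) <= x * x + y * y.
  have [c2u [s2u nu]] := trig_double (phase u); have [c2v [s2v nv]] := trig_double (phase v).
  have -> : x * x + y * y = (r u.2 - r v.2) * (r u.2 - r v.2) + 4 * (r u.2 * r v.2) * (S * S).
    have sS : S * S = (sin (phase u) * cos (phase v) - cos (phase u) * sin (phase v)) *
        (sin (phase u) * cos (phase v) - cos (phase u) * sin (phase v)) by rewrite /S sinB.
    rewrite sS /x /y c2u s2u c2v s2v.
    have su : sin (phase u) * sin (phase u) = 1 - cos (phase u) * cos (phase u) by lra.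
    have sv : sin (phase v) * sin (phase v) = 1 - cos (phase v) * cos (phase v) by lra.
    move: (cos (phase u)) (sin (phase u)) (cos (phase v)) (sin (phase v)) nu nv {c2u s2u c2v s2v sS} su sv.
    move: (r u.2) (r v.2) => a b' cu' su' cv' sv' nu nv su sv.
    transitivity (a * a * ((cu' * cu' + su' * su') * (cu' * cu' + su' * su')) +
      b' * b' * ((cv' * cv' + sv' * sv') * (cv' * cv' + sv' * sv')) -
      2 * a * b' * ((cu' * cv' + su' * sv') * (cu' * cv' + su' * sv') -
        (su' * cv' - cu' * sv') * (su' * cv' - cu' * sv'))); first by ring.
    have -> : (cu' * cv' + su' * sv') * (cu' * cv' + su' * sv') =
      (cu' * cu' + su' * su') * (cv' * cv' + sv' * sv') -
      (su' * cv' - cu' * sv') * (su' * cv' - cu' * sv') by ring.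
    by rewrite nu nv; ring.
  by rewrite lerDr -expr2 sqr_ge0.
have D0 : 0 <= D := normr_ge0 _.
have xx : x * x <= D * D.
  by rewrite -[x * x]ger0_norm -?expr2 ?sqr_ge0 // expr2 normrM ler_pM.
have yy : y * y <= D * D.
  by rewrite -[y * y]ger0_norm -?expr2 ?sqr_ge0 // expr2 normrM ler_pM.
have cc : c * c <= r u.2 * r v.2 by rewrite ler_pM.
have SS : 0 <= S * S by rewrite -expr2 sqr_ge0.
have h := ler_wpM2r SS cc.
have : (c * `|S|) ^+ 2 <= D ^+ 2.
  have DD := mulr_ge0 D0 D0.
  by rewrite exprMn real_normK ?num_real // !expr2; lra.
by rewrite ler_sqr // nnegrE // mulr_ge0.
Qed.

Lemma sin_lower (x : R) : 0 <= x <= pi / 2 -> x <= 2 * sin x.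
Proof. by move=> /half_le_sin; lra. Qed.

(** If the phases nearly agree modulo $\pi$, then [u] is near [v] or near the partner of [v] along
    the closed parameter curve. That curve consists of two copies of $[0,\pi]$ glued at both ends,
    whence the two detours through a joint. *)
Lemma page_cases u v : page_dom u -> page_dom v -> exists d,
  0 <= d <= 2 * `|sin (phase u - phase v)| /\
  ((u.1 = v.1 /\ d = `|u.2 - v.2|) \/
   (u.1 = ~~ v.1 /\ (d = u.2 + v.2 \/ d = (pi - u.2) + (pi - v.2))) \/
   (u.1 = (partner v).1 /\ d = `|u.2 - (partner v).2|) \/
   (u.1 = ~~ (partner v).1 /\
     (d = u.2 + (partner v).2 \/ d = (pi - u.2) + (pi - (partner v).2)))).
Proof.
case: u v => [e d1] [e' d2]; rewrite /page_dom /partner /phase /= => /andP[d10 d1p] /andP[d20 d2p].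
have pi2 := @pi_ge2 R.
have sinpiB (x : R) : sin (pi - x) = sin x.
  by rewrite -[pi - x]opprB sinN -{2}(subrK pi x) sinDpi.
have [ee|ee] := eqVneq e e'.
  have -> : `|sin (sg e * d1 - sg e' * d2)| = sin `|d1 - d2| :> R.
    rewrite ee -mulrBr /sg; have s0 : 0 <= sin `|d1 - d2|.
      apply: sin_ge0_pi; rewrite normr_ge0 ler_norml; apply/andP; split; lra.
    have sn : `|sin (d1 - d2)| = sin `|d1 - d2|.
      case: (ger0P (d1 - d2)) s0 => _ s0; first by rewrite ger0_norm.
      by rewrite sinN in s0 *; rewrite ler0_norm // -oppr_ge0.
    by case: e' {ee}; rewrite ?expr1 ?expr0 ?mulN1r ?mul1r ?sinN ?normrN.
  have x0 := normr_ge0 (d1 - d2).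
  have xpi : `|d1 - d2| <= pi by rewrite ler_norml; apply/andP; split; lra.
  have [x2|x2] := leP `|d1 - d2| (pi / 2).
    exists `|d1 - d2|; split; last by left.
    by rewrite x0; apply: sin_lower; rewrite x0.
  exists (pi - `|d1 - d2|); split.
    by rewrite -sinpiB; apply/andP; split; [|apply: sin_lower; apply/andP; split]; lra.
  right; right; right; rewrite negbK ee; split => //.
  by case: (ger0P (d1 - d2)) => _; [right|left]; ring.
have eN : e = ~~ e' by case: (e) (e') ee => -[].
have -> : `|sin (sg e * d1 - sg e' * d2)| = `|sin (d1 + d2)| :> R.
  rewrite eN sgN mulNr -opprD -mulrDr sinN normrN /sg.
  by case: e' {ee eN}; rewrite ?expr1 ?expr0 ?mulN1r ?mul1r ?sinN ?normrN.
have near0 (x : R) : 0 <= x <= pi / 2 -> x <= 2 * `|sin x|.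
  by move=> /sin_lower h; rewrite (le_trans h) // ler_wpM2l // ler_norm.
have [x1|x1] := leP (d1 + d2) (pi / 2).
  exists (d1 + d2); split; last by right; left; split => //; left.
  apply/andP; split; first lra.
  by apply: near0; apply/andP; split; lra.
have [x2|x2] := leP (d1 + d2) pi.
  exists (pi - (d1 + d2)); split.
    by rewrite -sinpiB; apply/andP; split; [|apply: near0; apply/andP; split]; lra.
  right; right; left; split => //.
  by rewrite ler0_norm; [ring|lra].
have sinBpi (x : R) : `|sin x| = `|sin (x - pi)|.
  by rewrite sinB cospi sinpi mulr0 subr0 mulrN1 normrN.
have [x3|x3] := leP (d1 + d2) (3 * (pi / 2)).
  exists (d1 + d2 - pi); split.
    by rewrite sinBpi; apply/andP; split; [|apply: near0; apply/andP; split]; lra.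
  right; right; left; split => //.
  by rewrite ger0_norm; [ring|lra].
exists ((pi - d1) + (pi - d2)); split; last by right; left; split => //; right.
rewrite sinBpi -sinpiB (_ : pi - (d1 + d2 - pi) = pi - d1 + (pi - d2)); last by ring.
by apply/andP; split; [|apply: near0; apply/andP; split]; lra.
Qed.

Lemma page_lip (r z : R -> R) : lip 0 pi r -> lip 0 pi z -> z 0 = 0 -> z pi = 0 ->
  exists2 L, 0 <= L & forall u v d, page_dom u -> page_dom v -> 0 <= d ->
  ((u.1 = v.1 /\ d = `|u.2 - v.2|) \/
   (u.1 = ~~ v.1 /\ (d = u.2 + v.2 \/ d = (pi - u.2) + (pi - v.2)))) ->
  `|page r z u - page r z v| <= L * d.
Proof.
move=> lr lz z0 zpi.
have l2 : lip 0 pi (fun d : R => 2 * d) by apply: lipM; [exact: lip_cst|exact: lip_id].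
have lx : lip 0 pi (fun d => r d * cos (2 * d)) by apply: lipM => //; exact: lip_cos.
have ly : lip 0 pi (fun d => r d * sin (2 * d)) by apply: lipM => //; exact: lip_sin.
have [L L0 hL] := lip_vec3 lx ly lz.
have pi0 : 0 <= pi :> R := pi_ge0 R.
have norm_sgv (e : bool) x1 y1 z1 x2 y2 z2 :
    `|vec3 x1 (sg e * y1) (sg e * z1) - vec3 x2 (sg e * y2) (sg e * z2)| <=
    `|vec3 x1 y1 z1 - vec3 x2 y2 z2 : 'rV[R]_3|.
  rewrite !vec3B -!mulrBr; apply: norm_vec3_le; rewrite ?normrM ?norm_sg ?mul1r.
  - by have := le_norm_cx (vec3 (x1 - x2) (y1 - y2) (z1 - z2)); rewrite c_vec3.
  - by have := le_norm_cy (vec3 (x1 - x2) (y1 - y2) (z1 - z2)); rewrite c_vec3.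
  - by have := le_norm_cz (vec3 (x1 - x2) (y1 - y2) (z1 - z2)); rewrite c_vec3.
have same e d1 d2 : 0 <= d1 <= pi -> 0 <= d2 <= pi ->
    `|page r z (e, d1) - page r z (e, d2)| <= L * `|d1 - d2|.
  by move=> h1 h2; apply: le_trans (hL _ _ h1 h2); exact: norm_sgv.
have joint e : page r z (e, 0) = page r z (~~ e, 0) /\ page r z (e, pi) = page r z (~~ e, pi).
  rewrite /page /= z0 zpi mulr0 sin0 !mulr0 (_ : 2 * pi = 0 + 2 * pi) ?add0r //.
  by rewrite (_ : sin (2 * pi) = 0) ?mulr0 // mulr_natl sin2pi.
exists L => // -[e d1] [e' d2] d; rewrite /page_dom /= => h1 h2 d0.
have /andP[d10 d1p] := h1; have /andP[d20 d2p] := h2.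
have i0 : 0 <= (0 : R) <= pi by rewrite lexx.
have ip : 0 <= (pi : R) <= pi by rewrite lexx andbT.
case=> [[-> ->]|[-> [->|->]]]; first exact: same.
  apply: (le_trans (ler_distD (page r z (e', 0)) _ _)).
  have [-> _] := joint e'; rewrite {1}mulrDr lerD //.
    by apply: le_trans (same _ _ _ h1 i0) _; rewrite subr0 ger0_norm.
  have [<- _] := joint e'.
  by apply: le_trans (same _ _ _ i0 h2) _; rewrite sub0r normrN ger0_norm.
apply: (le_trans (ler_distD (page r z (e', pi)) _ _)).
have [_ jp] := joint e'; rewrite mulrDr lerD //.
  by rewrite jp; apply: le_trans (same _ _ _ h1 ip) _; rewrite ler0_norm ?opprB // subr_le0.
by apply: le_trans (same _ _ _ ip h2) _; rewrite ger0_norm // subr_ge0.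
Qed.

(** Points on different pages are kept apart by [page_gap]. On one page only a point and its partner
    can collide, so the radial and vertical differences of partners decide everything; exchanging
    partners reduces the check to $d\le\pi/2$. *)
Lemma iso_pages (c : R) (r0 z0 r1 z1 : R -> R) : 0 < c ->
  lip 0 pi r0 -> lip 0 pi z0 -> lip 0 pi r1 -> lip 0 pi z1 ->
  (forall d, 0 <= d <= pi -> c <= r0 d) -> (forall d, 0 <= d <= pi -> c <= r1 d) ->
  z0 0 = 0 -> z0 pi = 0 -> z1 0 = 0 -> z1 pi = 0 ->
  fib 0 (pi / 2) (fun d => r0 d - r0 (pi - d)) (fun d => z0 d + z0 (pi - d))
                 (fun d => r1 d - r1 (pi - d)) (fun d => z1 d + z1 (pi - d)) ->
  iso R (some3 (page_set r0 z0)) (some3 (page_set r1 z1)).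
Proof.
move=> c0 lr0 lz0 lr1 lz1 cr0 cr1 z00 z0p z10 z1p [M M0 hM].
have pi2 := @pi_ge2 R.
pose f := page r0 z0; pose g u := page r1 z1 u - page r0 z0 u.
have -> : page_set r1 z1 = (fun u => f u + g u) @` page_dom.
  by apply: eq_imagel => u _; rewrite /f /g addrC subrK.
have [L0 L00 hL0] := page_lip lr0 lz0 z00 z0p.
have [L1 L10 hL1] := page_lip lr1 lz1 z10 z1p.
pose L := L0 + L1; have LL : 0 <= L by exact: addr_ge0.
pose close u v (d : R) := (u.1 = v.1 /\ d = `|u.2 - v.2|) \/
   (u.1 = ~~ v.1 /\ (d = u.2 + v.2 \/ d = (pi - u.2) + (pi - v.2))).
have hf u v d : page_dom u -> page_dom v -> 0 <= d -> close u v d -> `|f u - f v| <= L * d.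
  by move=> H1 H2 d0 H; rewrite (le_trans (hL0 u v d H1 H2 d0 H)) // ler_wpM2r // lerDl.
have hg u v d : page_dom u -> page_dom v -> 0 <= d -> close u v d -> `|g u - g v| <= L * d.
  move=> H1 H2 d0 H; rewrite /g opprD addrACA -opprD (le_trans (ler_normB _ _)) //.
  by rewrite /L mulrDl [leRHS]addrC lerD //; [exact: hL1|exact: hL0].
have fgE s u : f u + s *: g u =
    page (fun d => seg s (r0 d) (r1 d)) (fun d => seg s (z0 d) (z1 d)) u.
  by rewrite /f /g /page /seg vec3B vec3Z vec3D; congr vec3; ring.
have gap s u v : 0 <= s <= 1 -> page_dom u -> page_dom v ->
    c * `|sin (phase u - phase v)| <= `|(f u + s *: g u) - (f v + s *: g v)|.
  move=> /andP[s0 s1] hu hv; rewrite !fgE; apply: page_gap; first exact: ltW.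
    by rewrite /seg; have := cr0 _ hu; have := cr1 _ hu; nra.
  by rewrite /seg; have := cr0 _ hv; have := cr1 _ hv; nra.
have partner_dom u : page_dom u -> page_dom (partner u).
  by rewrite /page_dom /= => /andP[? ?]; apply/andP; split; lra.
have trigP (d : R) : cos (2 * (pi - d)) = cos (2 * d) /\ sin (2 * (pi - d)) = - sin (2 * d).
  have [c1 [s1 _]] := trig_double (pi - d); have [c2 [s2 _]] := trig_double d.
  by rewrite c1 s1 c2 s2 cosB sinB cospi sinpi; split; ring.
have partnerE r z u : page r z (partner u) - page r z u =
    vec3 ((r (pi - u.2) - r u.2) * cos (2 * u.2))
      (sg u.1 * ((r (pi - u.2) - r u.2) * sin (2 * u.2)))
      (- (sg u.1 * (z u.2 + z (pi - u.2)))).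
  have [c1 s1] := trigP u.2.
  by rewrite /page /= sgN c1 s1 vec3B; congr vec3; ring.
have fibM s u : 0 <= s <= 1 -> page_dom u ->
    `|g (partner u) - g u| <= 2 * M * `|(f (partner u) + s *: g (partner u)) - (f u + s *: g u)|.
  move=> s01 hu; rewrite !fgE partnerE /g opprD addrACA -opprD !partnerE.
  rewrite vec3B.
  set dr1 := r1 _ - _; set dr0 := r0 _ - _; set dz1 := z1 _ + _; set dz0 := z0 _ + _.
  set drs := seg _ _ _ - seg _ _ _; set dzs := seg _ _ _ + seg _ _ _.
  have fibu : pnorm (dr1 - dr0) (dz1 - dz0) <= M * pnorm drs dzs.
    move: hu; rewrite /page_dom /= => /andP[u0 up].
    have [u2|u2] := leP u.2 (pi / 2).
      have := hM u.2 s ltac:(by rewrite u0 u2) s01.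
      rewrite (_ : r1 _ - _ - _ = - (dr1 - dr0)); last by rewrite /dr1 /dr0; ring.
      rewrite (_ : seg s (r0 _ - _) _ = - drs); last by rewrite /drs /seg; ring.
      rewrite (_ : seg s (z0 _ + _) _ = dzs); last by rewrite /dzs /seg; ring.
      by rewrite /pnorm !normrN.
    have := hM (pi - u.2) s ltac:(by apply/andP; split; lra) s01.
    rewrite !subKr.
    rewrite (_ : z1 (pi - u.2) + _ = dz1); last by rewrite /dz1 addrC.
    rewrite (_ : z0 (pi - u.2) + _ = dz0); last by rewrite /dz0 addrC.
    rewrite (_ : seg s (r0 _ - _) _ = drs); last by rewrite /drs /seg; ring.
    by rewrite (_ : seg s dz0 dz1 = dzs) //; rewrite /dzs /dz0 /dz1 /seg; ring.
  have cs : `|cos (2 * u.2)| <= 1 by rewrite ler_norml cos_geN1 cos_le1.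
  have ss : `|sin (2 * u.2)| <= 1 by rewrite ler_norml sin_geN1 sin_le1.
  have up : `|vec3 (dr1 * cos (2 * u.2) - dr0 * cos (2 * u.2))
      (sg u.1 * (dr1 * sin (2 * u.2)) - sg u.1 * (dr0 * sin (2 * u.2)))
      (- (sg u.1 * dz1) - - (sg u.1 * dz0))| <= pnorm (dr1 - dr0) (dz1 - dz0).
    apply: norm_vec3_le.
    - by rewrite -mulrBl normrM /pnorm le_max ler_piMr.
    - by rewrite -mulrBr -mulrBl !normrM norm_sg mul1r /pnorm le_max ler_piMr.
    - by rewrite -opprD normrN -mulrBr normrM norm_sg mul1r /pnorm le_max lexx orbT.
  apply: (le_trans up); apply: (le_trans fibu); rewrite -(mulrA 2) mulrCA ler_wpM2l //.
  set V := vec3 _ _ _.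
  have hx := le_norm_cx V; have hy := le_norm_cy V; have hz := le_norm_cz V.
  rewrite /V !c_vec3 -/V in hx hy hz.
  rewrite normrN normrM norm_sg mul1r in hz.
  rewrite !normrM norm_sg mul1r in hx hy.
  (* Source of the factor 2 in [2 * M]: the radial difference is at most the sum of its two
     horizontal components, hence at most twice the maximum norm. *)
  have cs1 : 1 <= `|cos (2 * u.2)| + `|sin (2 * u.2)|.
    have [_ [_ n2]] := trig_double (2 * u.2); have a1 := normr_ge0 (cos (2 * u.2)).
    have a2 := normr_ge0 (sin (2 * u.2)).
    have e1 : cos (2 * u.2) * cos (2 * u.2) <= `|cos (2 * u.2)|.
      by rewrite (le_trans (ler_norm _)) // normrM ler_piMr.
    have e2 : sin (2 * u.2) * sin (2 * u.2) <= `|sin (2 * u.2)|.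
      by rewrite (le_trans (ler_norm _)) // normrM ler_piMr.
    lra.
  rewrite /pnorm ge_max; apply/andP; split; last by have := normr_ge0 V; lra.
  have := ler_wpM2l (normr_ge0 drs) cs1; rewrite mulr1 mulrDr; lra.
pose K := 2 * L / c + ((L + 2 * M * (L + L)) / (c / 2) + 2 * M).
have c2 : 0 < c / 2 by rewrite divr_gt0.
have K1 : 0 <= 2 * L / c by rewrite divr_ge0 ?mulr_ge0 // ltW.
have M2 : 0 <= 2 * M by rewrite mulr_ge0.
have K2 : 0 <= (L + 2 * M * (L + L)) / (c / 2) + 2 * M.
  by rewrite addr_ge0 // divr_ge0 ?(ltW c2) // addr_ge0 // mulr_ge0 // addr_ge0.
apply: (@iso_linear R _ _ f g K) => // s u v s01 hu hv.
have G := gap s u v s01 hu hv.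
have [d [/andP[d0 ds] cases]] := page_cases hu hv.
have cd : c / 2 * d <= `|(f u + s *: g u) - (f v + s *: g v)|.
  apply: le_trans G; have := ler_wpM2l (ltW c2) ds.
  by rewrite mulrA mulfVK // pnatr_eq0.
have n0 := normr_ge0 ((f u + s *: g u) - (f v + s *: g v)).
have near : `|g u - g v| <= L * d \/ (`|f u - f (partner v)| <= L * d /\
    `|g u - g (partner v)| <= L * d).
  have hp := partner_dom v hv.
  case: cases => [k|[k|[k|k]]].
  - by left; apply: hg => //; left.
  - by left; apply: hg => //; right.
  - by right; split; [apply: hf|apply: hg] => //; left.
  - by right; split; [apply: hf|apply: hg] => //; right.
rewrite /K mulrDl; case: near => [h|[h1 h2]].
  rewrite (le_trans h) // ler_wpDr ?mulr_ge0 //.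
  set V := `|_ - _| in cd *.
  have k : d <= 2 / c * V.
    rewrite -(ler_pM2l c2) mulrA (_ : c / 2 * (2 / c) = 1) ?mul1r //.
    by field; rewrite gt_eqF.
  rewrite (_ : 2 * L / c * V = L * (2 / c * V)); last by ring.
  exact: ler_wpM2l.
rewrite ler_wpDl //; first exact: mulr_ge0.
by apply: (fibered_estimate c2 LL M2 s01 h1 h2 cd); exact: fibM.
Qed.

End pages.

Lemma lip_comp (R : realType) (a b u v : R) (f g : R -> R) :
  (forall x, a <= x <= b -> u <= f x <= v) -> lip a b f -> lip u v g ->
  lip a b (fun x => g (f x)).
Proof.
move=> uv [L L0 fL] [M M0 gM]; exists (M * L); first exact: mulr_ge0.
move=> x y ax ay; rewrite (le_trans (gM _ _ (uv _ ax) (uv _ ay))) // -mulrA ler_wpM2l //.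
exact: fL.
Qed.

(** Composing with the retraction [cl] onto $[a,b]$ gives functions continuous on the whole line, as
    [fib_compact] requires. *)
Lemma fib_lip (R : realType) (a b : R) (y0 z0 y1 z1 : R -> R) : a <= b ->
  lip a b y0 -> lip a b z0 -> lip a b y1 -> lip a b z1 ->
  (forall t s, a <= t <= b -> 0 <= s <= 1 ->
    ~ (seg s (y0 t) (y1 t) = 0 /\ seg s (z0 t) (z1 t) = 0)) ->
  fib a b y0 z0 y1 z1.
Proof.
move=> ab ly0 lz0 ly1 lz1 nz.
pose cl (x : R) := Num.max (Num.min x b) a.
have cl_itv x : a <= cl x <= b.
  by rewrite /cl le_max lexx orbT ge_max ge_min lexx orbT.
have cl_id x : a <= x <= b -> cl x = x.
  by move=> /andP[ax xb]; rewrite /cl (min_idPl xb) (max_idPl ax).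
have cf f : lip a b f -> continuous (fun x => f (cl x)).
  move=> lf; apply: cont_of_lip => u v; apply: (lip_comp _ _ lf) => [x _|]; first exact: cl_itv.
  by apply: lip_max; apply: lip_min; exact: lip_id.
have [M M0 hM] : fib a b (fun x => y0 (cl x)) (fun x => z0 (cl x))
    (fun x => y1 (cl x)) (fun x => z1 (cl x)).
  by apply: fib_compact; [exact: cf..|move=> t s _; apply: nz; exact: cl_itv].
by exists M => // t s tab s01; have := hM t s tab s01; rewrite !cl_id.
Qed.

(** * The derotated strands in polar coordinates *)

Section strand_polar.
Variables (R : realType) (l c : R) (G p : R -> R).
Local Notation b := (pi / 4 : R).
Hypotheses (l0 : l <= 0) (c0 : 0 < c) (lG : forall u v, lip u v G).
Hypotheses (G_l : G l = 0) (G_b : G b = 0).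
Hypothesis G_neg : forall t, l <= t <= 0 -> 0 <= G t.
Hypothesis G_pos : forall t, 0 <= t <= b -> 0 <= p t /\ G t = yc (4 * t) + p t.
Hypothesis cross_ge : forall t t', l <= t -> t <= t' -> t' <= b ->
  t' <= pi / 8 \/ pi / 8 <= t -> c * (t' - t) <= XX t * G t' - XX t' * G t.

Let pi2 : 2 <= pi :> R := @pi_ge2 R.

Lemma XX_pos (t : R) : 0 <= t -> XX t = (2 - sin (4 * t)) * cos (4 * t).
Proof. by move=> t0; rewrite /XX ext_0 // tau_id // mulr0 add0r mulrC. Qed.

Lemma XX_neg (t : R) : t <= 0 -> XX t = 2 - 2 * t.
Proof. by move=> t0; rewrite /XX tau_0 // ext_id // mulr0 cos0 sin0; ring. Qed.

Let trig1 (x : R) : cos x * cos x + sin x * sin x = 1.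
Proof. by rewrite -!expr2 cos2Dsin2. Qed.

Lemma strand_polar : exists tg rho : R -> R,
  [/\ forall a, 0 <= a <= pi -> [/\ l <= tg a <= b, XX (tg a) = rho a * cos a,
        G (tg a) = rho a * sin a & 1 <= rho a],
      forall t, l <= t <= b -> exists2 a, 0 <= a <= pi & tg a = t,
      lip 0 pi tg /\ lip 0 pi rho, tg 0 = l /\ tg pi = b
    & forall a, 0 <= a <= pi ->
      (p (a / 4) = 0 -> tg a = a / 4 /\ rho a = 2 - sin a) /\
      (0 < p (a / 4) -> 2 - sin a < rho a)].
Proof.
have G_ge0 t : l <= t <= b -> 0 <= G t.
  move=> /andP[lt tb]; have [t0|/ltW t0] := leP 0 t; last by apply: G_neg; rewrite lt.
  have [p0 ->] := @G_pos t ltac:(by rewrite t0); rewrite addr_ge0 // /yc.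
  have s0 : 0 <= sin (4 * t) by apply: sin_ge0_pi; apply/andP; split; lra.
  by rewrite mulr_ge0 // subr_ge0; have := sin_le1 (4 * t); lra.
have norm_ge1 t : l <= t <= b -> 1 <= XX t * XX t + G t * G t.
  move=> tb; have /andP[lt t4] := tb; have gg : 0 <= G t * G t by rewrite -expr2 sqr_ge0.
  have [t0|/ltW t0] := leP 0 t; last by rewrite XX_neg //; nra.
  have [p0 GE] := @G_pos t ltac:(by rewrite t0).
  have s0 : 0 <= sin (4 * t) by apply: sin_ge0_pi; apply/andP; split; lra.
  have s1 := sin_le1 (4 * t).
  have y0 : 0 <= yc (4 * t) by rewrite /yc mulr_ge0 // subr_ge0; lra.
  have yG : yc (4 * t) * yc (4 * t) <= G t * G t by rewrite ler_pM // GE lerDl.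
  have : (2 - sin (4 * t)) * (2 - sin (4 * t)) = XX t * XX t + yc (4 * t) * yc (4 * t).
    rewrite -[LHS]mulr1; transitivity ((2 - sin (4 * t)) * (2 - sin (4 * t)) *
      (cos (4 * t) * cos (4 * t) + sin (4 * t) * sin (4 * t))); first by rewrite trig1.
    by rewrite XX_pos // /yc; ring.
  by nra.
have X_decr t t' : l <= t -> t < t' -> t' <= b -> XX t' < XX t.
  by move=> _ tt tb; have := XX_slope (ltW tt) tb; lra.
have X_h : XX (pi / 8 : R) = 0.
  rewrite XX_pos; last by have := pi2; lra.
  by rewrite (_ : 4 * (pi / 8) = pi / 2) ?cos_pihalf ?mulr0 //; field.
have cX : continuous (@XX R) by apply: cont_of_lip => u v; exact: lip_XX.
have cG : continuous G by apply: cont_of_lip => u v; exact: lG.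
have [tg [K [h1 h2 h3 h4 h5]]] := polar_parameter l0 c0 (lip_XX l b) cX cG (lG l b)
  X_decr X_h G_l G_b G_ge0 norm_ge1 cross_ge.
exists tg, (fun a => polar_radius (@XX R) G a (tg a)); split => //.
- move=> a a0; have [tb ray] := h1 a a0; split => //.
  + exact: on_rayX ray.
  + exact: on_rayG ray.
  + by case: ray.
- split => //; have itv a : 0 <= a <= pi -> l <= tg a <= b by move=> /h1[].
  apply: lipD; apply: lipM.
  + exact: lip_comp itv h3 (lip_XX l b).
  + by apply: lip_cos; exact: lip_id.
  + exact: lip_comp itv h3 (lG l b).
  + by apply: lip_sin; exact: lip_id.
- move=> a a0; have [tb ray] := h1 a a0; have /andP[a00 api] := a0.
  have [p0 GE] := @G_pos (a / 4) ltac:(apply/andP; split; lra).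
  have a4 : 4 * (a / 4) = a by field.
  apply: (radius_above l0 c0 X_decr X_h cross_ge a0 tb ray p0).
    by rewrite XX_pos ?a4 //; lra.
  by rewrite GE a4 /yc mulrC.
Qed.

End strand_polar.

Section torus_end.
Variables (R : realType) (n : nat) (T : R).
Hypotheses (n1 : (1 <= n)%N) (T1 : 1 <= T).

Local Notation N := ((dg n)%:R : R).
Local Notation m := (mu R n).
Local Notation e := (eps n : R).
Implicit Types t : R.
Let L := 2 * T - 1.
Let pi2 : 2 <= pi :> R := @pi_ge2 R.
Let N3 : 3 <= N := N_ge3 R n1.
Let m0 : 0 < m := mu_gt0 R n.
Let m1 : m < 1 := mu_lt1 R n.
Let mN : m * N = 1 / 4 := mu_dg R n.
Let L1 : 1 <= L. Proof. by have := T1; rewrite /L; lra. Qed.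

(** The heights of the outer strand and of minus the inner strand above the base curve. At every
    parameter at least one of [outward] and [inward] vanishes, according to the sign of $\cos
    2Nt$. *)
Definition outward t : R := m * (`|cos (2 * (N * t))| + cos (2 * (N * t))) / 2.
Definition inward t : R := m * (`|cos (2 * (N * t))| - cos (2 * (N * t))) / 2.
Definition Yp t : R := - Yi2 n t.

Lemma outward_ge0 t : 0 <= outward t.
Proof.
rewrite /outward divr_ge0 // mulr_ge0 ?(ltW m0) //.
by have := ler_norm (- cos (2 * (N * t))); rewrite normrN; lra.
Qed.

Lemma inward_ge0 t : 0 <= inward t.
Proof.
rewrite /inward divr_ge0 // mulr_ge0 ?(ltW m0) //.
by have := ler_norm (cos (2 * (N * t))); lra.
Qed.

Lemma cos_lipN t t' : `|cos (2 * (N * t)) - cos (2 * (N * t'))| <= 2 * N * `|t - t'|.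
Proof.
by apply: le_trans (cos_lip1 _ _) _; rewrite -!mulrBr mulrA normrM ger0_norm // mulr_ge0.
Qed.

Lemma outward_lip t t' : `|outward t - outward t'| <= 1 / 2 * `|t - t'|.
Proof.
rewrite /outward; set C := cos _; set C' := cos _.
have h := cos_lipN t t'; rewrite -/C -/C' in h.
have h2 : `| `|C| - `|C'| | <= `|C - C'| := ler_dist_dist C C'.
have -> : m * (`|C| + C) / 2 - m * (`|C'| + C') / 2 = m / 2 * ((`|C| - `|C'|) + (C - C')) by ring.
have m2 : 0 <= m / 2 by rewrite divr_ge0 // ltW.
rewrite normrM ger0_norm //.
have h3 := ler_normD (`|C| - `|C'|) (C - C').
have h4 : `|(`|C| - `|C'|) + (C - C')| <= 2 * (2 * N * `|t - t'|) by lra.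
apply: (le_trans (ler_wpM2l m2 h4)).
have -> : m / 2 * (2 * (2 * N * `|t - t'|)) = 2 * (m * N) * `|t - t'| by field.
by rewrite mN; lra.
Qed.

Lemma inward_lip t t' : `|inward t - inward t'| <= 1 / 2 * `|t - t'|.
Proof.
rewrite /inward; set C := cos _; set C' := cos _.
have h := cos_lipN t t'; rewrite -/C -/C' in h.
have h2 : `| `|C| - `|C'| | <= `|C - C'| := ler_dist_dist C C'.
have -> : m * (`|C| - C) / 2 - m * (`|C'| - C') / 2 = m / 2 * ((`|C| - `|C'|) - (C - C')) by ring.
have m2 : 0 <= m / 2 by rewrite divr_ge0 // ltW.
rewrite normrM ger0_norm //.
have h3 := ler_normB (`|C| - `|C'|) (C - C').
have h4 : `|(`|C| - `|C'|) - (C - C')| <= 2 * (2 * N * `|t - t'|) by lra.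
apply: (le_trans (ler_wpM2l m2 h4)).
have -> : m / 2 * (2 * (2 * N * `|t - t'|)) = 2 * (m * N) * `|t - t'| by field.
by rewrite mN; lra.
Qed.

Lemma Yo2_pos t : 0 <= t -> Yo2 n T t = yc (4 * t) + outward t.
Proof.
move=> t0; rewrite /Yo2 /outward /kap tau_id // ext_0 // mul0r mulr0 subr0.
by field.
Qed.

Lemma Yo2_neg t : t <= 0 -> Yo2 n T t = m * (1 + t / L).
Proof.
move=> t0; rewrite /Yo2 tau_0 // ext_id // !mulr0 cos0 kap_0 -/L.
by field; rewrite gt_eqF // (lt_le_trans ltr01).
Qed.

Lemma YpE t : Yp t = yc (4 * t) + inward t.
Proof. by rewrite /Yp /Yi2 opprK /inward /kap; field. Qed.

Lemma cos_quarter : cos (2 * (N * (pi / 4))) = 0 :> R.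
Proof.
rewrite (_ : 2 * (N * (pi / 4)) = N * (pi / 2 - 0)); last by field.
by rewrite cos_compl mulr0 sin0 mulr0.
Qed.

(** Within a quadrant the base curve contributes at least $2(2-s)(t'-t)$ to the cross product, where
    $s=\sin 4t$; a perturbation with Lipschitz constant $1/2$ takes away at most a quarter of
    this. *)
Lemma cross_pos (G p : R -> R) t t' :
  (forall x, 0 <= x -> 0 <= p x /\ G x = yc (4 * x) + p x) ->
  (forall x y, `|p x - p y| <= 1 / 2 * `|x - y|) ->
  0 <= t -> t <= t' -> t' <= pi / 4 -> t' <= pi / 8 \/ pi / 8 <= t ->
  t' - t <= XX t * G t' - XX t' * G t.
Proof.
move=> Gp plip t0 tt tb sq.
have t'0 := le_trans t0 tt.
have sl := XX_slope tt tb.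
have [p0 ->] := Gp t t0; have [p0' ->] := Gp t' t'0.
set s := sin (4 * t); set s' := sin (4 * t'); set C := cos (4 * t); set C' := cos (4 * t').
have s1 : s <= 1 := sin_le1 _; have s1' : s' <= 1 := sin_le1 _.
have C1 : `|C| <= 1 by rewrite ler_norml cos_geN1 cos_le1.
have sd : 2 * (t' - t) <= sin (4 * t' - 4 * t).
  have := @half_le_sin R (4 * t' - 4 * t) ltac:(case: sq => ?; apply/andP; split; lra); lra.
have pl := plip t' t; rewrite (ger0_norm (_ : 0 <= t' - t)) ?subr_ge0 // in pl.
have E : XX t * (yc (4 * t') + p t') - XX t' * (yc (4 * t) + p t) =
    (2 - s) * (2 - s') * sin (4 * t' - 4 * t) + XX t * (p t' - p t) + (XX t - XX t') * p t.
  by rewrite !XX_pos // /yc sinB -/s -/s' -/C -/C'; ring.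
rewrite E.
have a1 : 0 <= (XX t - XX t') * p t by rewrite mulr_ge0 //; lra.
have d0 : 0 <= t' - t by lra.
have a2 : (2 - s) * (2 * (t' - t)) <= (2 - s) * (2 - s') * sin (4 * t' - 4 * t).
  rewrite -mulrA ler_wpM2l //; first by lra.
  by rewrite (le_trans sd) // ler_peMl //; lra.
have a3 : `|XX t * (p t' - p t)| <= (2 - s) * (1 / 2 * (t' - t)).
  rewrite normrM ler_pM // XX_pos // normrM -/s -/C ger0_norm; last by lra.
  by rewrite ler_piMr //; lra.
have a4 := ler_norm (- (XX t * (p t' - p t))); rewrite normrN in a4.
have a5 : 1 * (t' - t) <= (2 - s) * (t' - t) by rewrite ler_wpM2r //; lra.
move: a1 a2 a3 a4 a5; move: (sin (4 * t' - 4 * t)) (XX t * _) (_ * p t) => *; lra.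
Qed.

Let mL0 : 0 < m / L. Proof. by rewrite divr_gt0 // (lt_le_trans ltr01). Qed.
Let mLm : m / L <= m. Proof. by rewrite ler_pdivrMr ?(lt_le_trans ltr01) // ler_peMr // ltW. Qed.

(** On the closing part both coordinates are affine in the parameter; an interval containing 0 is
    handled by combining the affine formula with [cross_pos] from 0 onwards. *)
Lemma cross_outer t t' : - L <= t -> t <= t' -> t' <= pi / 4 -> t' <= pi / 8 \/ pi / 8 <= t ->
  m / L * (t' - t) <= XX t * Yo2 n T t' - XX t' * Yo2 n T t.
Proof.
move=> tL tt tb sq.
have cp x x' := @cross_pos (Yo2 n T) outward x x'
  (fun y y0 => conj (outward_ge0 y) (Yo2_pos y0)) outward_lip.
have d0 : 0 <= t' - t by lra.
have mL1 : m / L <= 1 by have := mLm; have := m1; lra.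
have [t0|/ltW t0] := leP 0 t.
  by apply: le_trans (cp t t' t0 tt tb sq); rewrite ler_piMl.
have h8 : t' <= pi / 8 by case: sq => // h; have := pi2; lra.
have [t'0|/ltW t'0] := leP t' 0.
  rewrite !XX_neg // !Yo2_neg //.
  have -> : (2 - 2 * t) * (m * (1 + t' / L)) - (2 - 2 * t') * (m * (1 + t / L)) =
    2 * (m + m / L) * (t' - t) by ring.
  by rewrite ler_wpM2r //; have := mL0; have := m0; lra.
have := cp 0 t' (lexx _) t'0 tb (or_introl h8).
have -> : XX (0 : R) = 2 by rewrite XX_neg // mulr0 subr0.
have -> : Yo2 n T 0 = m by rewrite Yo2_neg // mul0r addr0 mulr1.
rewrite (XX_neg t0) (Yo2_neg t0) subr0 => h.
have s0 : 0 <= sin (4 * t') by apply: sin_ge0_pi; apply/andP; split; lra.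
have s1 := sin_le1 (4 * t').
have X0 : 0 <= XX t'.
  rewrite XX_pos //; apply: mulr_ge0; first lra.
  by apply: cos_ge0_pihalf; apply/andP; split; have ? := pi2; lra.
have Y0 : yc (4 * t') <= Yo2 n T t' by rewrite Yo2_pos // lerDl outward_ge0.
have y0 : 0 <= yc (4 * t') by rewrite /yc mulr_ge0 //; lra.
have XY : 1 <= XX t' + Yo2 n T t'.
  apply: le_trans (lerD (lexx _) Y0); rewrite XX_pos // /yc.
  have c0 : 0 <= cos (4 * t') by apply: cos_ge0_pihalf; apply/andP; split; have ? := pi2; lra.
  have := cos2Dsin2 (4 * t'); rewrite !expr2; move: (cos _) (sin _) c0 s0 s1 => C S *; nra.
have key : m / L <= 2 * Yo2 n T t' + XX t' * (m / L).
  have := ler_wpM2l (ltW mL0) XY; rewrite mulr1 mulrDr.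
  have := ler_wpM2r (le_trans y0 Y0) mL1; rewrite mul1r.
  move: (m / L) (XX t') (Yo2 n T t') Y0 => k x y *; lra.
have nt : 0 <= - t by lra.
have := ler_wpM2l nt key.
have := ler_wpM2r t'0 mL1; rewrite mul1r.
rewrite (_ : m * (1 + t / L) = m + t * (m / L)); last by ring.
move: (m / L) (XX t') (Yo2 n T t') h => k x y *; lra.
Qed.

Lemma lip_Yo2 u v : lip u v (Yo2 n T).
Proof. by rewrite /Yo2 /kap /yc /ext /tau; lips. Qed.
Lemma lip_Zo2 u v : lip u v (@Zo2 R n).
Proof. by rewrite /Zo2 /tau; lips. Qed.
Lemma lip_Yp u v : lip u v Yp.
Proof. by rewrite /Yp /Yi2 /kap /yc; lips. Qed.
Lemma lip_Zi2 u v : lip u v (@Zi2 R n).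
Proof. by rewrite /Zi2; lips. Qed.

End torus_end.

(** * Identification with the torus knot *)

Section torus.
Variables (R : realType) (n : nat) (T : R).
Hypotheses (n1 : (1 <= n)%N) (T1 : 1 <= T).

Local Notation N := ((dg n)%:R : R).
Local Notation m := (mu R n).
Implicit Types t d a : R.
Let L := 2 * T - 1.
Let pi2 : 2 <= pi :> R := @pi_ge2 R.
Let m0 : 0 < m := mu_gt0 R n.
Let L1 : 1 <= L. Proof. by have := T1; rewrite /L; lra. Qed.
Let b := pi / 4 : R.

Let trig_N d : cos (N * (pi - d)) = - cos (N * d) /\ sin (N * (pi - d)) = sin (N * d).
Proof.
have NE : N * pi = pi + n%:R * (2 * pi) by rewrite /dg natrD natrM; ring.
have cn (k : nat) (x : R) : cos (x + k%:R * (2 * pi)) = cos x /\ sin (x + k%:R * (2 * pi)) = sin x.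
  have -> : x + k%:R * (2 * pi) = x + (2 * k)%:R * pi by rewrite natrM; ring.
  by rewrite cosDnpi sinDnpi /eps exprM sqrrN expr1n expr1n !mul1r.
have -> : N * (pi - d) = (pi - N * d) + n%:R * (2 * pi) by rewrite mulrBr NE; ring.
have [-> ->] := cn n (pi - N * d).
by rewrite cosB sinB cospi sinpi; split; ring.
Qed.

Let inner_polar := @strand_polar R 0 1 (Yp n) (inward n) (lexx 0) ltr01.
Let outer_polar := @strand_polar R (- L) (m / L) (Yo2 n T) (outward n).

(** The outer strand sweeps the angles from $0$ to $\pi$, the inner one those from $\pi$ to $2\pi$.
    On a page, the strand above the base curve is the outer of the two partners ([strand_polar]);
    with $t=d/2$ the deciding sign is that of $\cos Nd$. If it vanishes, both lie on the base curve
    and the heights are explicit. *)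
Lemma rotated_as_pages : exists r z : R -> R,
  [/\ strands L b (@XX R) (Yo2 n T) (@Zo2 R n) (@Yi2 R n) (@Zi2 R n) = page_set r z,
      lip 0 pi r /\ lip 0 pi z, z 0 = 0 /\ z pi = 0,
      forall d, 0 <= d <= pi -> 1 <= r d
    & forall d, 0 <= d <= pi / 2 ->
      [/\ 0 < cos (N * d) -> r (pi - d) < r d, cos (N * d) < 0 -> r d < r (pi - d)
        & cos (N * d) = 0 -> z d + z (pi - d) = - (m * sin (N * d))] ].
Proof.
have L0 : 0 < L by rewrite (lt_le_trans ltr01).
have b0 : 0 <= b by have := pi2; rewrite /b; lra.
have tau_b : tau b = b by rewrite tau_id.
have Zb : Zo2 n b = Zi2 n b :> R by rewrite /Zo2 tau_b.
have [tq [rq [q1 q2 [q3 q3'] [q4 q5] q6]]] : exists tg rho : R -> R,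
  [/\ forall a, 0 <= a <= pi -> [/\ - L <= tg a <= b, XX (tg a) = rho a * cos a,
        Yo2 n T (tg a) = rho a * sin a & 1 <= rho a],
      forall t, - L <= t <= b -> exists2 a, 0 <= a <= pi & tg a = t,
      lip 0 pi tg /\ lip 0 pi rho, tg 0 = - L /\ tg pi = b
    & forall a, 0 <= a <= pi ->
      (outward n (a / 4) = 0 -> tg a = a / 4 /\ rho a = 2 - sin a) /\
      (0 < outward n (a / 4) -> 2 - sin a < rho a)].
  apply: outer_polar.
  - by rewrite oppr_le0 ltW.
  - by rewrite divr_gt0.
  - exact: lip_Yo2.
  - by rewrite Yo2_neg ?oppr_le0 ?(ltW L0) // -/L mulNr divff ?gt_eqF // subrr mulr0.
  - by rewrite Yo2_pos // /outward cos_quarter normr0 addr0 mulr0 mul0r addr0 /yc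
      (_ : 4 * (pi / 4) = pi) ?sinpi ?mul0r //; field.
  - move=> t /andP[tL t0]; rewrite Yo2_neg // -/L mulr_ge0 ?(ltW m0) //.
    have : - L / L <= t / L by rewrite ler_wpM2r // invr_ge0 ltW.
    by rewrite mulNr divff ?gt_eqF //; lra.
  - by move=> t /andP[t0 _]; split; [exact: outward_ge0|exact: Yo2_pos].
  - exact: cross_outer.
have [tp [rp [p1 p2 [p3 p3'] [p4 p5] p6]]] : exists tg rho : R -> R,
  [/\ forall a, 0 <= a <= pi -> [/\ 0 <= tg a <= b, XX (tg a) = rho a * cos a,
        Yp n (tg a) = rho a * sin a & 1 <= rho a],
      forall t, 0 <= t <= b -> exists2 a, 0 <= a <= pi & tg a = t,
      lip 0 pi tg /\ lip 0 pi rho, tg 0 = 0 /\ tg pi = b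
    & forall a, 0 <= a <= pi ->
      (inward n (a / 4) = 0 -> tg a = a / 4 /\ rho a = 2 - sin a) /\
      (0 < inward n (a / 4) -> 2 - sin a < rho a)].
  apply: inner_polar.
  - exact: lip_Yp.
  - by rewrite YpE /inward /yc !mulr0 cos0 sin0 normr1 subrr mulr0 !mul0r addr0.
  - by rewrite YpE /inward cos_quarter normr0 subr0 mulr0 mul0r addr0 /yc
      (_ : 4 * (pi / 4) = pi) ?sinpi ?mul0r //; field.
  - move=> t /andP[t0 t0']; have -> : t = 0 by apply/eqP; rewrite eq_le t0 t0'.
    by rewrite YpE /inward /yc !mulr0 cos0 sin0 normr1 subrr mulr0 !mul0r addr0.
  - by move=> t /andP[t0 _]; split; [exact: inward_ge0|exact: YpE].
  - move=> t t' t0 tt tb sq; rewrite mul1r.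
    apply: (@cross_pos R (Yp n) (inward n)) => // [x _|x y]; last exact: inward_lip.
    by split; [exact: inward_ge0|exact: YpE].
(* [d] runs along the outer strand up to $\pi/2$ and then back along the inner one, which it meets
   at polar angle $\pi$. *)
pose r d := if d <= pi / 2 then rq (2 * d) else rp (2 * (pi - d)).
pose z d := if d <= pi / 2 then Zo2 n (tq (2 * d)) else Zi2 n (tp (2 * (pi - d))).
have pih : 2 * (pi / 2) = pi :> R by field.
have pihB : 2 * (pi - pi / 2) = pi :> R by field.
have ipi : 0 <= (pi : R) <= pi by rewrite lexx andbT pi_ge0.
have i0 : 0 <= (0 : R) <= pi by rewrite lexx pi_ge0.
have r_far d : pi / 2 <= d -> r d = rp (2 * (pi - d)).
  rewrite /r le_eqVlt => /orP[/eqP <-|h]; last by rewrite leNgt h.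
  rewrite lexx pih pihB.
  have [_ + _ _] := q1 pi ipi; have [_ + _ _] := p1 pi ipi.
  by rewrite q5 p5 cospi => ->; rewrite !mulrN1 => /oppr_inj.
have z_far d : pi / 2 <= d -> z d = Zi2 n (tp (2 * (pi - d))).
  rewrite /z le_eqVlt => /orP[/eqP <-|h]; last by rewrite leNgt h.
  by rewrite lexx pih pihB q5 p5.
have near_dom d : 0 <= d <= pi / 2 -> 0 <= 2 * d <= pi.
  by move=> /andP[? ?]; apply/andP; split; lra.
have far_dom d : pi / 2 <= d <= pi -> 0 <= 2 * (pi - d) <= pi.
  by move=> /andP[? ?]; apply/andP; split; lra.
have l2 : lip 0 (pi / 2) (fun d => 2 * d) by apply: lipM; [exact: lip_cst|exact: lip_id].
have l2' : lip (pi / 2) pi (fun d => 2 * (pi - d)).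
  by apply: lipM; [exact: lip_cst|apply: lipB; [exact: lip_cst|exact: lip_id]].
have hpi : 0 <= (pi / 2 : R) <= pi by have := pi2; lra.
exists r, z; split.
- apply/seteqP; split => [P [[[e i] t]]|P [[e d]]].
  + rewrite /strand_dom /= => tb <-.
    case: i tb => /= tb.
      have [a a0 ta] := p2 t tb; have [_ xa ya _] := p1 a a0.
      exists (e, pi - a / 2); first by rewrite /page_dom /=; case/andP: a0 => *; apply/andP; split; lra.
      have far : pi / 2 <= pi - a / 2 by case/andP: a0 => *; lra.
      have aE : 2 * (pi - (pi - a / 2)) = a by field.
      rewrite /page /= r_far // z_far // aE ta.
      have -> : 2 * (pi - a / 2) = 2 * pi - a by field.
      rewrite ta in xa ya.
      rewrite cosB sinB (mulr_natl pi) sin2pi cos2pi !mul1r !mul0r addr0 sub0r.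
      by rewrite mulrN -xa -ya /Yp opprK.
    have [a a0 ta] := q2 t tb; have [_ xa ya _] := q1 a a0.
    exists (e, a / 2); first by rewrite /page_dom /=; case/andP: a0 => *; apply/andP; split; lra.
    have near : a / 2 <= pi / 2 by case/andP: a0 => *; lra.
    have aE : 2 * (a / 2) = a by field.
    by rewrite /page /= /r /z near aE -xa -ya ta.
  + rewrite /page_dom /= => /andP[d0 dp] <-.
    have [near|/ltW far] := leP d (pi / 2).
      have [tb xa ya _] := q1 (2 * d) ltac:(by apply: near_dom; rewrite d0).
      exists (e, false, tq (2 * d)) => //.
      by rewrite /page /strand /= xa ya /r /z near.
    have [tb xa ya _] := p1 (2 * (pi - d)) ltac:(by apply: far_dom; rewrite far).
    exists (e, true, tp (2 * (pi - d))) => //.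
    rewrite /page /strand /= r_far // z_far // xa.
    have -> : Yi2 n (tp (2 * (pi - d))) = - Yp n (tp (2 * (pi - d))) by rewrite opprK.
    rewrite ya.
    have -> : 2 * (pi - d) = 2 * pi - 2 * d by ring.
    rewrite cosB sinB (mulr_natl pi) sin2pi cos2pi !mul1r !mul0r addr0 sub0r.
    by congr vec3; ring.
- split; apply: (lip_cat hpi).
  + apply: (@lip_eq _ _ _ (fun d => rq (2 * d))); first by move=> d /andP[_ h]; rewrite /r h.
    exact: lip_comp near_dom l2 q3'.
  + apply: (@lip_eq _ _ _ (fun d => rp (2 * (pi - d)))); first by move=> d /andP[h _]; rewrite r_far.
    exact: lip_comp far_dom l2' p3'.
  + apply: (@lip_eq _ _ _ (fun d => Zo2 n (tq (2 * d)))); first by move=> d /andP[_ h]; rewrite /z h.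
    apply: (lip_comp _ (lip_comp near_dom l2 q3) (lip_Zo2 n (- L) b)).
    by move=> d hd; have [] := q1 _ (near_dom d hd).
  + apply: (@lip_eq _ _ _ (fun d => Zi2 n (tp (2 * (pi - d))))); first by move=> d /andP[h _]; rewrite z_far.
    apply: (lip_comp _ (lip_comp far_dom l2' p3) (lip_Zi2 n 0 b)).
    by move=> d hd; have [] := p1 _ (far_dom d hd).
- split.
    rewrite /z (_ : 0 <= pi / 2); last by case/andP: hpi.
    by rewrite mulr0 q4 /Zo2 tau_0 ?oppr_le0 ?(ltW L0) // !mulr0 sin0 mulr0 mul0r oppr0.
  rewrite z_far; last by case/andP: hpi.
  by rewrite subrr mulr0 p4 /Zi2 !mulr0 sin0 mulr0 mul0r oppr0.
- move=> d /andP[d0 dp]; have [near|/ltW far] := leP d (pi / 2).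
    rewrite /r near; have [] := q1 (2 * d) => //; by apply: near_dom; rewrite d0.
  by rewrite r_far //; have [] := p1 (2 * (pi - d)) => //; apply: far_dom; rewrite far.
- move=> d hd; have /andP[d0 d2] := hd; have a0 := near_dom d hd.
  have far : pi / 2 <= pi - d by lra.
  have rE : r (pi - d) = rp (2 * d) by rewrite r_far // subKr.
  have zE : z (pi - d) = Zi2 n (tp (2 * d)) by rewrite z_far // subKr.
  have [q61 q62] := q6 _ a0; have [p61 p62] := p6 _ a0.
  have aE : 2 * (N * (2 * d / 4)) = N * d by field.
  rewrite /outward aE in q61 q62; rewrite /inward aE in p61 p62.
  rewrite rE zE /r /z d2; split => h.
  + have [|_ ->] := p61; first by rewrite gtr0_norm // subrr mulr0 mul0r.
    by apply: q62; rewrite gtr0_norm // divr_gt0 // mulr_gt0 // addr_gt0.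
  + have [|_ ->] := q61; first by rewrite ltr0_norm // addNr mulr0 mul0r.
    by apply: p62; rewrite ltr0_norm // divr_gt0 // mulr_gt0 //; lra.
  + have [|-> _] := q61; first by rewrite h normr0 addr0 mulr0 mul0r.
    have [|-> _] := p61; first by rewrite h normr0 subr0 mulr0 mul0r.
    rewrite /Zo2 /Zi2 tau_id; last by lra.
    by rewrite aE; field.
Qed.

Lemma torus_knot_pages : torus_knot 2 (dg n) =
  some3 (page_set (fun d => 2 + cos (N * d)) (fun d => - sin (N * d))).
Proof.
apply/seteqP; split => [P [t _ <-]|P].
  pose d := acos (cos t).
  have ct : -1 <= cos t <= 1 by rewrite cos_geN1 cos_le1.
  have cd : cos d = cos t by rewrite /d acosK // in_itv.
  have d0 : 0 <= d <= pi by rewrite acos_ge0 ?acos_lepi.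
  have [e se] : exists e : bool, sin t = sg e * sin d.
    have : (sin t - sin d) * (sin t + sin d) = 0.
      have := cos2Dsin2 t; have := cos2Dsin2 d; rewrite cd !expr2 => *; lra.
    move/eqP; rewrite mulf_eq0 => /orP[|] /eqP h; [exists false|exists true].
      by rewrite /sg expr0 mul1r; lra.
    by rewrite /sg expr1 mulN1r; lra.
  (* Cosines of multiples are polynomials in $\cos t$, and sines of multiples are such polynomials
     times $\sin t$; so replacing $t$ by its representative in $[0,\pi]$ changes only signs. *)
  have ck (k : nat) : cos (k%:R * t) = cos (k%:R * d) by rewrite -!chebyshevT_cos cd.
  have sk (k : nat) : sin (k%:R * t) = sg e * sin (k%:R * d).
    by rewrite -!chebyshevU_cos cd se mulrCA.
  exists (page (fun d => 2 + cos (N * d)) (fun d => - sin (N * d)) (e, d)); first by exists (e, d).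
  rewrite /torus_curve /page /= !ck !sk; congr (Some (vec3 _ _ _)); ring.
case=> Q [[e d]]; rewrite /page_dom /= => d0 <- <-; exists (sg e * d) => //.
have ck (k : nat) : cos (k%:R * (sg e * d)) = cos (k%:R * d).
  by rewrite /sg; case: e; rewrite ?expr1 ?expr0 ?mulN1r ?mul1r ?mulrN ?cosN.
have sk (k : nat) : sin (k%:R * (sg e * d)) = sg e * sin (k%:R * d).
  by rewrite /sg; case: e {ck}; rewrite ?expr1 ?expr0 ?mulN1r ?mul1r ?mulrN ?sinN.
rewrite /torus_curve /page /= !ck !sk; congr (Some (vec3 _ _ _)); ring.
Qed.

(** For both braids the radial difference of partners has the sign of $\cos Nd$; where this
    vanishes, the vertical differences are $-m\sin Nd$ and $-2\sin Nd$, nonzero and of equal sign.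
    So no segment meets 0. *)
Lemma iso_torus : iso R
  (some3 (strands L b (@XX R) (Yo2 n T) (@Zo2 R n) (@Yi2 R n) (@Zi2 R n)))
  (torus_knot 2 (dg n)).
Proof.
have [r [z [-> [lr lz] [z0 zp] r1 rz]]] := rotated_as_pages; rewrite torus_knot_pages.
have lN f : (forall u v (g : R -> R), lip u v g -> lip u v (fun x => f (g x))) ->
    forall u v, lip u v (fun d => f (N * d)).
  by move=> H u v; apply: H; apply: lipM; [exact: lip_cst|exact: lip_id].
have lc := lN cos (fun u v g => @lip_cos _ u v g).
have ls := lN sin (fun u v g => @lip_sin _ u v g).
have hpi : 0 <= pi / 2 :> R by have := pi2; lra.
have sub u v (f : R -> R) : lip 0 pi f -> 0 <= u -> v <= pi -> lip u v f.
  by move=> lf u0 vp; exact: lip_sub u0 vp lf.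
have lB (f : R -> R) : lip 0 pi f -> lip 0 (pi / 2) (fun d => f (pi - d)).
  move=> lf; apply: (lip_comp _ _ lf); last by apply: lipB; [exact: lip_cst|exact: lip_id].
  by move=> x /andP[? ?]; apply/andP; split; have := pi2; lra.
have hp2 : pi / 2 <= pi :> R by have := pi2; lra.
have lr1 u v : lip u v (fun d : R => 2 + cos (N * d)) by apply: lipD; [exact: lip_cst|exact: lc].
have lz1 u v : lip u v (fun d : R => - sin (N * d)) by apply: lipN; exact: ls.
apply: (@iso_pages R 1 r z) => //.
- by move=> d _; have := cos_geN1 (N * d); lra.
- by rewrite mulr0 sin0 oppr0.
- have [_] := trig_N 0; rewrite subr0 => ->; by rewrite mulr0 sin0 oppr0.
apply: fib_lip => //.
- by apply: lipB; [exact: sub|exact: (lB r)].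
- by apply: lipD; [exact: sub|exact: (lB z)].
- by apply: lipB; [exact: lr1|exact: (lB _ (lr1 0 pi))].
- by apply: lipD; [exact: lz1|exact: (lB _ (lz1 0 pi))].
move=> d s hd s01; have [h1 h2 h3] := rz d hd; have [cB sB] := trig_N d.
rewrite cB sB => -[E1 E2].
have [c0|c0|c0] := ltgtP 0 (cos (N * d)).
- have k1 := h1 c0.
  have := @conv_gt R s 0 (r d - r (pi - d)) (2 + cos (N * d) - (2 - cos (N * d))) s01
    ltac:(lra) ltac:(lra).
  by rewrite -/(seg _ _ _) E1 ltxx.
- have k1 := h2 c0.
  have := @conv_gt R s 0 (- (r d - r (pi - d))) (- (2 + cos (N * d) - (2 - cos (N * d)))) s01
    ltac:(lra) ltac:(lra).
  by rewrite !mulrN -opprD -/(seg _ _ _) E1 oppr0 ltxx.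
move: E2; rewrite h3 // /seg => E2.
have s0 : sin (N * d) != 0.
  by have := cN_sq n d; rewrite -c0 mulr0 add0r => ss; apply: contra_eq_neq ss => ->;
    rewrite mulr0 eq_sym oner_neq0.
have : ((1 - s) * m + s * 2) * sin (N * d) = 0 by rewrite -oppr0 -E2; ring.
move/eqP; rewrite mulf_eq0 (negPf s0) orbF gt_eqF //.
exact: conv_gt.
Qed.

End torus.

(** * Growth of polynomials and straightening maps of the line *)

Section growth.
Variable R : realType.
Implicit Types (p : {poly R}) (x y : R).

Lemma is_derive_horner p x : is_derive x (1 : R) (horner p) p^`().[x].
Proof.
have h : derivable (horner p) x 1 by exact: derivable_horner.
by apply: (DeriveDef h); rewrite -derive1E -derivE.
Qed.

Definition grows (f : R -> R) (M c : R) := forall x y, M <= x -> x <= y ->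
  c * (y - x) <= f y - f x.

(** Beyond some point the derivative is at least its own positive leading coefficient, which serves
    as the rate. *)
Lemma poly_grows p : (1 < size p)%N -> 0 < lead_coef p ->
  exists M c, 0 < c /\ grows (horner p) M c.
Proof.
move=> sp lp; have lp' : 0 < lead_coef p^`().
  case E: (size p) sp => [|[|k]] // _.
  have ck : p^`()`_k = lead_coef p *+ k.+1 by rewrite coef_deriv /lead_coef E.
  have pos : 0 < p^`()`_k by rewrite ck pmulrn_lgt0.
  have p0 : p != 0 by rewrite -size_poly_eq0 E.
  suff -> : lead_coef p^`() = p^`()`_k by [].
  have := lt_size_deriv p0; rewrite E ltnS leq_eqVlt => /orP[/eqP s'|s'].
    by rewrite /lead_coef s'.
  by move: pos; rewrite nth_default ?ltxx // -ltnS.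
have [M hM] := @polyrcf.poly_pinfty_gt_lc _ _ lp'.
exists M, (lead_coef p^`()); split=> // x y Mx xy.
apply: (slope_ge xy (is_derive_horner p)) => z /andP[xz _].
by apply: hM; exact: le_trans xz.
Qed.

Lemma poly_dominates p M c : 0 < c -> grows (horner p) M c ->
  (forall x, `|p.[- x]| = `|p.[x]|) ->
  exists T0, forall T, T0 <= T ->
    [/\ M <= T, 0 < p.[T] & forall x, `|x| <= T -> `|p.[x]| <= p.[T]].
Proof.
move=> c0 gr ev; pose M' := Num.max M 1.
have M1 : 1 <= M' by rewrite le_max lexx orbT.
have MM : M <= M' by rewrite le_max lexx.
have [B B0 hB] := lip_bounded (@lip_poly R (- M') M' id p (lip_id _ _)).
(* From a value no less than $-B$ at $M'$, growth at rate $c$ reaches $B+1$, above all values on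
   $[-M',M']$. *)
exists (M' + (2 * B + 1) / c) => T hT.
have q0 : 0 <= (2 * B + 1) / c by rewrite divr_ge0 ?ltW //; lra.
have MT : M' <= T by lra.
have hpM : `|p.[M']| <= B by apply: hB; apply/andP; split; lra.
have pT : B + 1 <= p.[T].
  have h := gr M' T MM MT.
  have : 2 * B + 1 <= c * (T - M').
    by rewrite -ler_pdivrMl // mulrC; lra.
  by move: hpM; rewrite ler_norml => /andP[? ?]; lra.
split; [exact: le_trans MM MT|lra|].
have pos x : 0 <= x -> x <= T -> `|p.[x]| <= p.[T].
  move=> x0 xT; have [xM|/ltW Mx] := leP x M'.
    by apply: le_trans (hB x _) _; [apply/andP; split; lra|lra].
  have h1 := gr M' x MM Mx; have h2 := gr x T (le_trans MM Mx) xT.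
  have k1 : 0 <= c * (x - M') by rewrite mulr_ge0 ?subr_ge0 // ltW.
  have k2 : 0 <= c * (T - x) by rewrite mulr_ge0 ?subr_ge0 // ltW.
  by move: hpM; rewrite !ler_norml => /andP[? ?]; apply/andP; split; lra.
move=> x; rewrite ler_norml => /andP[xT1 xT2].
have [x0|/ltW x0] := leP 0 x; first exact: pos.
by rewrite -ev; apply: pos; lra.
Qed.

(* Linear on [- M, M], equal to P beyond M, odd. *)
Definition odd_ext (P : R -> R) (M k x : R) : R :=
  k * Num.max (- M) (Num.min x M) + (P (Num.max x M) - P M) -
  (P (Num.max (- x) M) - P M).

Section odd_ext.
Variables (P : R -> R) (M k c : R).
Hypotheses (M0 : 0 < M) (k0 : 0 < k) (c0 : 0 < c) (cP : continuous P) (gP : grows P M c).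
Hypothesis PM : P M = k * M.

Lemma odd_ext_mid x : `|x| <= M -> odd_ext P M k x = k * x.
Proof.
rewrite ler_norml => /andP[x1 x2]; rewrite /odd_ext (min_idPl x2) !(max_idPr _) //; last by lra.
by rewrite subrr subr0 addr0.
Qed.

Lemma odd_ext_pos x : M <= x -> odd_ext P M k x = P x.
Proof.
move=> Mx; have ? := M0; rewrite /odd_ext (min_idPr Mx) (max_idPl Mx) !(max_idPr _); try lra.
by rewrite -PM; ring.
Qed.

Lemma odd_extN x : odd_ext P M k (- x) = - odd_ext P M k x.
Proof.
have ? := M0; rewrite /odd_ext opprK.
have -> : Num.max (- M) (Num.min (- x) M) = - Num.max (- M) (Num.min x M).
  by case: (leP x M); case: (leP (- x) M) => *; case: (leP (- M) x); case: (leP (- M) (- x));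
    case: (leP (- M) M) => *; lra.
ring.
Qed.

Lemma line_homeo_odd_ext : line_homeo (odd_ext P M k).
Proof.
have ? := M0.
have gr x y : M <= x -> x <= y -> c * (y - x) <= P y - P x := @gP x y.
have gr0 x y : M <= x -> x <= y -> P x <= P y.
  move=> Mx xy; have := gr x y Mx xy.
  have : 0 <= c * (y - x) by rewrite mulr_ge0 ?subr_ge0 // ltW.
  lra.
have cid : continuous (fun x : R => x) by move=> x; exact: cvg_id.
split.
- apply: contB; [apply: contD|].
  + apply: contM; first exact: cont_cst.
    by apply: cont_max; [exact: cont_cst|apply: cont_min; [exact: cid|exact: cont_cst]].
  + apply: contB; last exact: cont_cst.
    by apply: comp_continuous cP; apply: cont_max; [exact: cid|exact: cont_cst].
  + apply: contB; last exact: cont_cst.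
    apply: comp_continuous cP; apply: cont_max; last exact: cont_cst.
    by apply: contN; exact: cid.
- have pos x y : M <= x -> x < y -> odd_ext P M k x < odd_ext P M k y.
    move=> Mx xy; rewrite !odd_ext_pos //; last by rewrite (le_trans Mx) // ltW.
    have := gr x y Mx (ltW xy); have : 0 < c * (y - x) by rewrite mulr_gt0 ?subr_gt0.
    lra.
  move=> x y xy; have [Mx|xM] := leP M x; first exact: pos.
  have [yM|My] := leP y (- M).
    by rewrite -ltrN2 -!odd_extN; apply: pos; lra.
  rewrite /odd_ext.
  have h1 : P (Num.max x M) <= P (Num.max y M).
    apply: gr0; first by rewrite le_max lexx orbT.
    by rewrite ge_max !le_max lexx orbT andbT (ltW xy).
  have h2 : P (Num.max (- y) M) <= P (Num.max (- x) M).
    apply: gr0; first by rewrite le_max lexx orbT.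
    by rewrite ge_max !le_max lexx orbT andbT lerN2 (ltW xy).
  have h3 : Num.max (- M) (Num.min x M) < Num.max (- M) (Num.min y M).
    by case: (leP x M); case: (leP y M) => *; case: (leP (- M) x); case: (leP (- M) y);
      case: (leP (- M) M) => *; lra.
  have := k0; rewrite -(ltr_pM2l k0) in h3 => _; lra.
- move=> B; exists (M + `|B| / c).
  have Bc : 0 <= `|B| / c by rewrite divr_ge0 // ltW.
  have pos x b : `|b| <= `|B| -> M + `|B| / c < x -> b < odd_ext P M k x.
    move=> bB hx; have Mx : M <= x by lra.
    rewrite odd_ext_pos //; have := gr M x (lexx _) Mx.
    have : `|B| < c * (x - M) by rewrite -ltr_pdivrMl // mulrC; lra.
    have kM : 0 < k * M by rewrite mulr_gt0.
    by have := ler_norm b; rewrite PM; lra.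
  move=> x; split; first exact: pos.
  move=> hx; rewrite -[x]opprK odd_extN ltrN2; apply: pos => //; lra.
Qed.

End odd_ext.

Lemma line_homeo_scale (k : R) : 0 < k -> line_homeo (fun x => k * x).
Proof.
move=> k0; split.
- by apply: contM; [exact: cont_cst|move=> x; exact: cvg_id].
- by move=> x y xy; rewrite ltr_pM2l.
- move=> B; exists (B / k) => x; rewrite ltr_pdivrMr // mulrC; split => //.
  by rewrite ltrNr ltr_pdivrMr // => h; rewrite mulrC; lra.
Qed.

End growth.

(** * Closing the long knot inside bounded space *)

Section closing.
Variables (R : realType) (n : nat) (T ky kz : R).
Hypotheses (n1 : (1 <= n)%N) (T1 : 1 <= T) (ky0 : 0 < ky) (kz0 : 0 < kz).
Local Notation e := (eps n : R).
Local Notation TN := (chebyshevT R (dg n)).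
Local Notation C := (height R n).
Hypotheses (kyT : TN.[T] = ky * T) (kzT : C.[T] = e * (kz * T)).
Hypothesis TN_le : forall x, `|x| <= T -> `|TN.[x]| <= TN.[T].
Hypothesis C_le : forall x, `|x| <= T -> `|C.[x]| <= e * C.[T].
Variables (c1 c2 : R).
Hypotheses (c10 : 0 < c1) (gT : grows (horner TN) T c1).
Hypotheses (c20 : 0 < c2) (gC : grows (fun x => e * C.[x]) T c2).

Let T0 : 0 < T := lt_le_trans ltr01 T1.
Let ee : e * e = 1 := eps_sqr R n.
Let pi2 : 2 <= pi :> R := @pi_ge2 R.
Let L := 2 * T - 1.
Let b := pi / 4 : R.

Lemma chebyshevT4 (x : R) : (chebyshevT R 4).[x] = 8 * x ^+ 4 - 8 * x ^+ 2 + 1.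
Proof.
have -> : chebyshevT R 4 = 2 *: 'X * (2 *: 'X * (2 *: 'X * 'X - 1) - 'X) - (2 *: 'X * 'X - 1) by [].
by rewrite !hornerE /=; ring.
Qed.

Lemma T4_grows : grows (horner (chebyshevT R 4)) 1 8.
Proof.
move=> x y x1 xy; rewrite !chebyshevT4.
have -> : 8 * y ^+ 4 - 8 * y ^+ 2 + 1 - (8 * x ^+ 4 - 8 * x ^+ 2 + 1) =
  8 * (y - x) * ((y + x) * (y ^+ 2 + x ^+ 2 - 1)) by ring.
have d0 : 0 <= 8 * (y - x) by rewrite mulr_ge0 ?subr_ge0.
rewrite -[X in X <= _]mulr1 ler_wpM2l // !expr2; nra.
Qed.

(* The polynomial knot with its ends straightened to rays. *)
Definition ray_x (u : R) := if u <= 1 then (chebyshevT R 4).[u] else u.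
Definition ray_y (u : R) := if u <= T then TN.[u] / ky else u.
Definition ray_z (u : R) := if u <= T then C.[u] / kz else e * u.
Definition ray (v : bool * R) : 'rV[R]_3 :=
  vec3 (ray_x v.2) (sg v.1 * ray_y v.2) (sg v.1 * ray_z v.2).
Definition ray_knot : set (sphere3 R) :=
  [set None] `|` [set Some (ray v) | v in [set v | 0 <= v.2]].

(** Carries the knot with straight ends back to the polynomial one: it rescales the core, where the
    coordinates are bounded by their values at $T$, and bends the diagonal rays into polynomial
    ends. *)
Let ends : 'rV[R]_3 -> 'rV[R]_3 :=
  coord_map (odd_ext (horner (chebyshevT R 4)) 1 1) (odd_ext (horner TN) T ky)
    (odd_ext (fun x => e * C.[x]) T kz).

Lemma ray_y_norm (u : R) : 0 <= u <= T -> `|TN.[u] / ky| <= T.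
Proof.
move=> /andP[u0 uT]; rewrite normrM (gtr0_norm (_ : 0 < ky^-1)) ?invr_gt0 //.
by rewrite ler_pdivrMr // mulrC -kyT TN_le // ger0_norm.
Qed.

Lemma ray_z_norm (u : R) : 0 <= u <= T -> `|C.[u] / kz| <= T.
Proof.
move=> /andP[u0 uT]; rewrite normrM (gtr0_norm (_ : 0 < kz^-1)) ?invr_gt0 //.
rewrite ler_pdivrMr // mulrC; have := @C_le u; rewrite kzT mulrA ee mul1r.
by apply; rewrite ger0_norm.
Qed.

Lemma T4_norm (u : R) : 0 <= u <= 1 -> `|(chebyshevT R 4).[u]| <= 1.
Proof.
move=> /andP[u0 u1]; have h : -1 <= u <= 1 by rewrite u1 andbT; lra.
have -> : u = cos (acos u) by rewrite acosK // in_itv.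
by rewrite chebyshevT_cos ler_norml cos_geN1 cos_le1.
Qed.

Lemma sg_mul_odd_ext (P : R -> R) (M k x : R) (s : bool) : 0 < M ->
  odd_ext P M k (sg s * x) = sg s * odd_ext P M k x.
Proof.
by move=> M0; rewrite /sg; case: s; rewrite ?expr1 ?expr0 ?mulN1r ?mul1r // odd_extN.
Qed.

Lemma ends_ray (v : bool * R) : 0 <= v.2 ->
  ends (ray v) = poly_curve (chebyshevT R 4) TN C (sg v.1 * v.2).
Proof.
case: v => s u /= u0; rewrite /ends /coord_map /ray !c_vec3 /=.
rewrite !sg_mul_odd_ext // /poly_curve.
have -> : (chebyshevT R 4).[sg s * u] = (chebyshevT R 4).[u].
  by rewrite !chebyshevT4 /sg; case: s; rewrite ?expr1 ?expr0 ?mul1r // mulN1r; ring.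
have sgE (p : {poly R}) : (forall t, p.[- t] = - p.[t]) -> p.[sg s * u] = sg s * p.[u].
  by move=> po; rewrite /sg; case: s; rewrite ?expr1 ?expr0 ?mul1r // !mulN1r po.
have To (t : R) : TN.[- t] = - TN.[t].
  rewrite chebyshevT_parity (_ : (-1) ^+ dg n = -1) ?mulN1r //.
  by rewrite -signr_odd /dg addn1 /= mul2n odd_double.
rewrite (sgE TN To) (sgE C (fun t => height_odd n t)).
have uT_norm : u <= T -> `|u| <= T by rewrite ger0_norm.
congr vec3.
- rewrite /ray_x; case: (leP u 1) => u1.
    by rewrite odd_ext_mid ?mul1r // T4_norm // u0.
  by rewrite odd_ext_pos ?ltW // mul1r chebyshevT4; ring.
- congr (_ * _); rewrite /ray_y; case: (leP u T) => uT.
    by rewrite odd_ext_mid ?ray_y_norm ?u0 //; field; rewrite gt_eqF.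
  by rewrite odd_ext_pos // ltW.
- congr (_ * _); rewrite /ray_z; case: (leP u T) => uT.
    by rewrite odd_ext_mid ?ray_z_norm ?u0 //; field; rewrite gt_eqF.
  have E : e * u = sg (odd n) * u by rewrite /eps /sg signr_odd.
  rewrite E sg_mul_odd_ext // -/(sg _) odd_ext_pos ?ltW //; last by rewrite kzT mulrA ee mul1r.
  by rewrite mulrA /sg signr_odd -/(eps n) ee mul1r.
Qed.

Lemma iso_ray_knot :
  iso R (closed_long_knot (poly_curve (chebyshevT R 4) TN C)) ray_knot.
Proof.
have cont p : continuous (horner p : R -> R) by exact: continuous_horner.
have hx : line_homeo (odd_ext (horner (chebyshevT R 4)) 1 1).
  apply: (line_homeo_odd_ext _ _ _ _ T4_grows) => //; first by rewrite chebyshevT4; ring.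
have hy : line_homeo (odd_ext (horner TN) T ky).
  exact: (line_homeo_odd_ext T0 ky0 c10 (cont _) gT kyT).
have hz : line_homeo (odd_ext (fun x => e * C.[x]) T kz).
  apply: (line_homeo_odd_ext T0 kz0 c20 _ gC); last by rewrite kzT mulrA ee mul1r.
  by apply: contM; [exact: cont_cst|exact: cont].
apply: iso_sym; exists (omap ends : sphere3 R -> sphere3 R); first exact: ambient_coord_map.
apply/seteqP; split => [P [Q]|P].
  case=> [->|[v /= v0 <-]] <-; first by left.
  by right; exists (sg v.1 * v.2) => //=; rewrite ends_ray.
case=> [->|[t _ <-]]; first by exists None => //; left.
have [s ->] : exists s : bool, t = sg s * `|t|.
  case: (ger0P t) => _; [exists false|exists true].
    by rewrite /sg expr0 mul1r.
  by rewrite /sg expr1 mulN1r opprK.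
exists (Some (ray (s, `|t|))); first by right; exists (s, `|t|) => //=; exact: normr_ge0.
by congr Some; apply: (@ends_ray (s, `|t|)); exact: normr_ge0.
Qed.

Definition scale3 (k : R) : sphere3 R -> sphere3 R :=
  omap (coord_map (fun x => k * x) (fun x => k * x) (fun x => k * x)).
(** [close_up] at scale [T]: it fixes the ball of radius $T$, which contains the core, and sends
    infinity to $(2T,0,0)$. *)
Definition bend_ends (P : sphere3 R) : sphere3 R :=
  scale3 T (close_up (scale3 T^-1 P)).

Lemma scale3_vec3 k x y z : scale3 k (Some (vec3 x y z)) = Some (vec3 (k * x) (k * y) (k * z)).
Proof. by rewrite /scale3 /= /coord_map !c_vec3. Qed.

Lemma ambient_bend_ends : ambient R bend_ends.
Proof.
have h k : 0 < k -> ambient R (scale3 k).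
  by move=> k0; apply: ambient_coord_map; exact: line_homeo_scale.
have TV : 0 < T^-1 by rewrite invr_gt0.
exact: (ambient_comp (h T T0) (ambient_comp (ambient_close_up R) (h T^-1 TV))).
Qed.

Let vec3_big (u : R) s : T <= u -> bend_ends (Some (vec3 u (sg s * u) (sg s * (e * u)))) =
  let Y := 2 * u * T / (u + T) in
  Some (vec3 Y (sg s * (Y * (2 * T - Y) / T)) (sg s * (e * (Y * (2 * T - Y) / T)))).
Proof.
move=> Tu; rewrite /bend_ends scale3_vec3.
have ? := T0; have u0 : 0 < u by exact: lt_le_trans Tu.
have E1 : T^-1 * (sg s * u) = T^-1 * u * sg s by ring.
have E2 : T^-1 * (sg s * (e * u)) = T^-1 * u * (sg s * e) by ring.
have sn : `|sg s| <= 1 :> R by rewrite /sg normrX normrN1 expr1n.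
have en : `|e| = 1 by case: (eps_cases R n) => ->; rewrite ?normrN normr1.
rewrite E1 E2 close_up_ray //; last by rewrite normrM en mulr1.
  by rewrite scale3_vec3; congr (Some (vec3 _ _ _)); field; lra.
by rewrite mulrC ler_pdivlMr // mul1r.
Qed.

Lemma bend_ends_small p : `|p| <= T -> bend_ends (Some p) = Some p.
Proof.
move=> pT; rewrite -(vec3K p) /bend_ends scale3_vec3 close_up_small.
  by rewrite scale3_vec3; congr (Some (vec3 _ _ _)); field; rewrite gt_eqF.
have TV : 0 < T^-1 by rewrite invr_gt0.
have h c : `|c| <= `|p| -> `|T^-1 * c| <= 1.
  move=> cp; rewrite normrM gtr0_norm // mulrC ler_pdivrMr // mul1r.
  exact: le_trans pT.
by apply: norm_vec3_le; apply: h; [exact: le_norm_cx|exact: le_norm_cy|exact: le_norm_cz].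
Qed.

Lemma bend_ends_ray (v : bool * R) : 0 <= v.2 <= T -> bend_ends (Some (ray v)) = Some (ray v).
Proof.
case: v => s u /= uT; apply: bend_ends_small; have /andP[u0 u1] := uT.
have sn : `|sg s| = 1 :> R by rewrite /sg normrX normrN1 expr1n.
apply: norm_vec3_le; rewrite ?normrM ?sn ?mul1r /=.
- rewrite /ray_x; case: (leP u 1) => h; last by rewrite ger0_norm.
  by apply: le_trans T1; rewrite T4_norm // u0.
- by rewrite /ray_y u1 ray_y_norm.
- by rewrite /ray_z u1 ray_z_norm.
Qed.

Local Notation S := (strand (@xc R) (Yo0 n T ky) (Zo0 n T kz) (Yi0 n ky) (Zi0 n kz)).

Let strand_inner s t : 0 <= t <= b -> Some (S (s, true, t)) = bend_ends (Some (ray (s, sin t))).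
Proof.
move=> /andP[t0 tb].
have s0 : 0 <= sin t by apply: sin_ge0_pi; apply/andP; split; have := pi2; rewrite /b in tb; lra.
have s1 := sin_le1 t.
rewrite bend_ends_ray /= ?s0 ?(le_trans s1) // /strand /ray /= /ray_x s1 /ray_y /ray_z (le_trans s1) //.
rewrite /Yi0 /Zi0 /xc ext_0 // add0r tau_id // sin_as_cos !chebyshevT_cos.
congr (Some (vec3 _ _ _)).
by rewrite (_ : 4%:R * (pi / 2 - t) = - (4 * t) + pi *+ 2) ?cosD2pi ?cosN //; rewrite mulr2n; field.
Qed.

Let strand_outer s t : 0 <= t <= b -> Some (S (s, false, t)) = bend_ends (Some (ray (s, cos t))).
Proof.
move=> /andP[t0 tb].
have c0 : 0 <= cos t by apply: cos_ge0_pihalf; apply/andP; split; have := pi2; rewrite /b in tb; lra.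
have c1' := cos_le1 t.
rewrite bend_ends_ray /= ?c0 ?(le_trans c1') // /strand /ray /= /ray_x c1' /ray_y /ray_z (le_trans c1') //.
rewrite /Yo0 /Zo0 /xc tpar_cos // bend_0 //; last by have := T1; lra.
by rewrite ext_0 // add0r tau_id // !chebyshevT_cos mul0r mul0r mulr0 !subr0.
Qed.

Let strand_arm s u : 1 <= u <= T -> Some (S (s, false, 1 - u)) = bend_ends (Some (ray (s, u))).
Proof.
move=> /andP[u1 uT].
rewrite bend_ends_ray /= ?uT ?(le_trans ler01 u1) // /strand /ray /= /ray_y /ray_z uT.
have t0 : 1 - u <= 0 by lra.
rewrite /Yo0 /Zo0 /xc bend_0 //; last by lra.
rewrite /tpar ext_id // tau_0 // mulr0 cos0 opprB subrK (min_idPl _); last by lra.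
rewrite (_ : 1 + (u - 1) = u); last by ring.
rewrite mul0r mul0r mulr0 !subr0.
congr (Some (vec3 _ _ _)); rewrite /ray_x; case: (leP u 1) => // h.
have -> : u = 1 by apply/eqP; rewrite eq_le h u1.
by rewrite chebyshevT4; ring.
Qed.

Let strand_arc s Y : T <= Y <= 2 * T ->
  S (s, false, 1 - Y) = vec3 Y (sg s * (Y * (2 * T - Y) / T)) (sg s * (e * (Y * (2 * T - Y) / T))).
Proof.
move=> /andP[TY Y2]; have ? := T1; have t0 : 1 - Y <= 0 by lra.
rewrite /strand /= /Yo0 /Zo0 /xc /tpar /bend ext_id // tau_0 // mulr0 cos0 opprB subrK.
rewrite (min_idPr _); last by lra.
rewrite (max_idPl _); last by lra.
rewrite (_ : 1 + (T - 1) = T); last by ring.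
by rewrite kyT kzT; congr vec3; field; rewrite ?gt_eqF.
Qed.

Let strand_ray s u : T <= u ->
  Some (S (s, false, 1 - 2 * u * T / (u + T))) = bend_ends (Some (ray (s, u))).
Proof.
move=> Tu; have ? := T0; have uT : 0 < u + T by lra.
have h : T <= 2 * u * T / (u + T) <= 2 * T.
  rewrite ler_pdivlMr // ler_pdivrMr //; apply/andP; split; nra.
have -> : ray (s, u) = vec3 u (sg s * u) (sg s * (e * u)).
  rewrite /ray /= /ray_x /ray_y /ray_z; congr vec3.
  - case: (leP u 1) => // u1; have -> : u = 1 by apply/eqP; rewrite eq_le u1 (le_trans T1).
    by rewrite chebyshevT4; ring.
  - case: (leP u T) => // u1; have -> : u = T by apply/eqP; rewrite eq_le u1 Tu.
    by rewrite kyT mulrAC divff ?mul1r // gt_eqF.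
  - case: (leP u T) => // u1; have -> : u = T by apply/eqP; rewrite eq_le u1 Tu.
    by rewrite kzT; congr (_ * _); field; rewrite gt_eqF.
by rewrite strand_arc // vec3_big.
Qed.

Let strand_end s : Some (S (s, false, - L)) = bend_ends None.
Proof.
have -> : - L = 1 - 2 * T by rewrite /L; ring.
rewrite strand_arc; last by have := T0; rewrite lexx andbT; lra.
rewrite /bend_ends /scale3 /= close_up_None /= /coord_map !c_vec3 subrr !(mulr0, mul0r).
by rewrite mulrC.
Qed.

Lemma acos_quarter (u : R) : 0 <= u <= 1 ->
  (u <= cos b -> b <= acos u <= pi / 2) /\ (cos b <= u -> acos u <= b).
Proof.
move=> /andP[u0 u1]; have h : -1 <= u <= 1 by rewrite u1 andbT; lra.
have a0 := acos_ge0 h; have api := acos_lepi h.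
have ca : cos (acos u) = u by rewrite acosK // in_itv.
have lt_cos (x y : R) : 0 <= x -> x < y -> y <= pi -> cos y < cos x.
  move=> x0 xy ypi; have := cos_gap x0 (ltW xy) ypi.
  have : 0 < (y - x) ^+ 2 by rewrite exprn_gt0 // subr_gt0.
  lra.
have b0 : 0 <= b by have := pi2; rewrite /b; lra.
have bpi : b <= pi by have := pi2; rewrite /b; lra.
have p20 : 0 <= pi / 2 :> R by have := pi2; lra.
split => hu; last first.
  by rewrite leNgt; apply/negP => k; have := lt_cos b (acos u) b0 k api; rewrite ca ltNge hu.
apply/andP; split; rewrite leNgt; apply/negP => k.
  by have := lt_cos (acos u) b a0 k bpi; rewrite ca ltNge hu.
by have := lt_cos (pi / 2) (acos u) p20 k api; rewrite ca cos_pihalf ltNge u0.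
Qed.

(** The parameter $u\ge0$ of the knot is $\sin t$ on the inner strand, $\cos t$ on the outer one up
    to $u=1$, and $1-t$ up to $u=T$; beyond that, the bent ray has abscissa $1-t=2uT/(u+T)$. *)
Lemma bend_ends_ray_knot : bend_ends @` ray_knot =
  some3 (strands L b (@xc R) (Yo0 n T ky) (Zo0 n T kz) (Yi0 n ky) (Zi0 n kz)).
Proof.
have ? := pi2; have ? := T1; have b0 : 0 <= b by rewrite /b; lra.
apply/seteqP; split => [P [Q]|P [Q]].
  case=> [->|[[s u] /= u0 <-]] <-.
    by exists (S (false, false, - L)) => //; exists (false, false, - L) => //;
      rewrite /strand_dom /= lexx; rewrite /L; lra.
  have [uT|/ltW Tu] := leP u T; last first.
    exists (S (s, false, 1 - 2 * u * T / (u + T))); last exact: strand_ray.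
    exists (s, false, 1 - 2 * u * T / (u + T)) => //; rewrite /strand_dom /=.
    have uT : 0 < u + T by lra.
    have : T <= 2 * u * T / (u + T) <= 2 * T.
      by rewrite ler_pdivlMr // ler_pdivrMr //; apply/andP; split; nra.
    by move=> /andP[? ?]; apply/andP; split; rewrite /L; lra.
  have [u1|/ltW u1] := leP u 1; last first.
    exists (S (s, false, 1 - u)); last by apply: strand_arm; rewrite u1.
    by exists (s, false, 1 - u) => //; rewrite /strand_dom /= /L; apply/andP; split; lra.
  have h : -1 <= u <= 1 by rewrite u1 andbT; lra.
  have a0 := acos_ge0 h; have ca : cos (acos u) = u by rewrite acosK // in_itv.
  have [q1 q2] := @acos_quarter u ltac:(by rewrite u0 u1).
  have [uq|/ltW uq] := leP u (cos b).
    have /andP[k1 k2] := q1 uq.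
    have E : sin (pi / 2 - acos u) = u by rewrite -{2}ca sin_as_cos subKr.
    have dom : 0 <= pi / 2 - acos u <= b by rewrite /b in k1 *; apply/andP; split; lra.
    exists (S (s, true, pi / 2 - acos u)); first by exists (s, true, pi / 2 - acos u).
    by rewrite strand_inner // E.
  have dom : 0 <= acos u <= b by rewrite a0 q2.
  exists (S (s, false, acos u)); last by rewrite strand_outer // ca.
  exists (s, false, acos u) => //; rewrite /strand_dom /=; case/andP: dom => *.
  by apply/andP; split; rewrite /L; lra.
case=> -[[s i] t]; rewrite /strand_dom /= => dom <- <-.
case: i dom => /= dom.
  exists (Some (ray (s, sin t))); last by rewrite strand_inner.
  right; exists (s, sin t) => //=; apply: sin_ge0_pi; case/andP: dom => *.
  by have ? : b = pi / 4 by []; apply/andP; split; lra.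
have /andP[tL tb] := dom.
have [t0|/ltW t0] := leP 0 t.
  exists (Some (ray (s, cos t))); last by rewrite strand_outer // t0.
  right; exists (s, cos t) => //=; apply: cos_ge0_pihalf.
  by have ? : b = pi / 4 by []; apply/andP; split; lra.
have [tT|/ltW tT] := leP (1 - t) T.
  exists (Some (ray (s, 1 - t))); first by right; exists (s, 1 - t) => //=; lra.
  by rewrite -strand_arm ?subKr //; apply/andP; split; lra.
have [tE|tn] := eqVneq t (- L).
  by exists None; [left|rewrite tE strand_end].
have tL' : - L < t by rewrite lt_neqAle eq_sym tn.
have k0 : 0 < 2 * T - (1 - t) by rewrite /L in tL'; lra.
(* The solution of $2uT/(u+T)=1-t$; the end $t=-L$ corresponds to infinity and was treated
   before. *)
pose u := (1 - t) * T / (2 * T - (1 - t)).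
have Tu : T <= u by rewrite /u ler_pdivlMr //; nra.
exists (Some (ray (s, u))); first by right; exists (s, u) => //=; lra.
rewrite -strand_ray //; congr (Some (S (_, _, _))).
rewrite /u; field; rewrite gt_eqF //= gt_eqF //.
have -> : (1 - t) * T + T * (2 * T - (1 - t)) = 2 * (T * T) by ring.
by rewrite !mulr_gt0.
Qed.

Lemma iso_closed : iso R (closed_long_knot (poly_curve (chebyshevT R 4) TN C))
  (some3 (strands L b (@XX R) (Yo0 n T ky) (Zo0 n T kz) (Yi0 n ky) (Zi0 n kz))).
Proof.
apply: iso_trans iso_ray_knot _.
apply: (@iso_trans _ _ _ (bend_ends @` ray_knot)).
  by exists bend_ends => //; exact: ambient_bend_ends.
rewrite bend_ends_ray_knot -coord_strands.
apply: iso_some3; apply: ambient_coord_map; try exact: line_homeo_id.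
exact: line_homeo_unround.
Qed.

End closing.

(** * The polynomial curve is a smooth embedding *)

Section embedding.
Variable R : realType.

Lemma poly_curve_coord (p q r : {poly R}) (i : 'I_1) (j : 'I_3) :
  (fun t => poly_curve p q r t i j) = horner [:: p; q; r]`_j.
Proof.
apply/funext => t; rewrite /poly_curve /vec3 mxE.
by case: j => -[|[|[|]]].
Qed.

Lemma derivable_poly_curve (p q r : {poly R}) t : derivable (poly_curve p q r) t 1.
Proof.
by apply/derivable_mxP => i j; rewrite poly_curve_coord; exact: derivable_horner.
Qed.

Lemma derive1_poly_curve (p q r : {poly R}) :
  derive1 (poly_curve p q r) = poly_curve p^`() q^`() r^`().
Proof.
apply/funext => t; rewrite derive1E derive_mx; last exact: derivable_poly_curve.
apply/rowP => j; rewrite !mxE poly_curve_coord -derive1E -derivE.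
by case: j => -[|[|[|]]].
Qed.

Lemma poly_curve_smooth (p q r : {poly R}) k t :
  derivable (derive1n k (poly_curve p q r)) t 1.
Proof.
suff [p' [q' [r' ->]]] : exists p' q' r' : {poly R},
    derive1n k (poly_curve p q r) = poly_curve p' q' r' by exact: derivable_poly_curve.
elim: k => [|k [p' [q' [r' IH]]]]; first by exists p, q, r.
by exists p'^`(), q'^`(), r'^`(); rewrite /derive1n iterS -/(derive1n k _) IH derive1_poly_curve.
Qed.

Lemma poly_curve_continuous (p q r : {poly R}) : continuous (poly_curve p q r).
Proof. by apply: vec3_continuous; exact: continuous_horner. Qed.

(** A proper continuous map is closed, so the complement of the image of the complement of $U$ is
    open; by injectivity its preimage is $U$. *)
Lemma proper_embedding (f : R -> 'rV[R]_3) : injective f -> continuous f ->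
  (forall B, exists K, forall t, `|f t| <= B -> `|t| <= K) ->
  forall U : set R, open U -> exists2 V : set 'rV[R]_3, open V & U = f @^-1` V.
Proof.
move=> fi cf prop U oU; exists (~` (f @` (~` U))); last first.
  apply/seteqP; split => t /=; first by move=> Ut [u nUu /fi ut]; apply: nUu; rewrite ut.
  by move=> h; apply: contrapT => nUt; apply: h; exists t.
apply: closed_openC => p clp.
have [K hK] := prop (`|p| + 1).
pose B := [set` `[(- K), K]] `&` ~` U.
have cB : compact (f @` B).
  apply: continuous_compact; first exact: continuous_subspaceT.
  apply: compact_closedI; [exact: segment_compact|exact: open_closedC].
have clB : closed (f @` B).
  by apply: compact_closed cB; exact: norm_hausdorff.
suff : (f @` B) p by move=> [t [_ nUt] <-]; exists t.
apply: clB => A nA.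
have nb : nbhs p (A `&` ball p 1).
  by apply: filterI => //; exact: nbhsx_ballx.
have [_ [[t nUt <-] [Aft]]] := clp _ nb.
rewrite -ball_normE /= => pf; exists (f t); split => //; exists t => //; split => //.
rewrite /= in_itv /= -ler_norml; apply: hK.
rewrite -[f t](subrK p) (le_trans (ler_normD _ _)) // addrC lerD2l distrC.
exact: ltW.
Qed.

Lemma poly_curve_proper (q r : {poly R}) B :
  exists K, forall t, `|poly_curve (chebyshevT R 4) q r t| <= B -> `|t| <= K.
Proof.
exists (1 + `|B|) => t ht; have B0 := normr_ge0 B; have B1 := ler_norm B.
have [t1|/ltW t1] := leP `|t| 1; first lra.
have := T4_grows (lexx 1) t1; rewrite [(chebyshevT R 4).[1]]chebyshevT4.
have -> : (chebyshevT R 4).[`|t|] = (chebyshevT R 4).[t].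
  by case: (ger0P t) => // _; rewrite !chebyshevT4; ring.
have := le_norm_cx (poly_curve (chebyshevT R 4) q r t).
rewrite /poly_curve c_vec3 => h; have := le_trans h ht.
have := ler_norm (chebyshevT R 4).[t].
rewrite !expr1n; lra.
Qed.

End embedding.

Section height_embedding.
Variables (R : realType) (n : nat).
Hypothesis n1 : (1 <= n)%N.
Local Notation N := ((dg n)%:R : R).
Local Notation m := (mu R n).
Local Notation e := (eps n : R).
Local Notation TN := (chebyshevT R (dg n)).
Local Notation C := (height R n).
Local Notation T4 := (chebyshevT R 4).
Let pi2 : 2 <= pi :> R := @pi_ge2 R.
Let ee : e * e = 1 := eps_sqr R n.

Let TN_odd (t : R) : TN.[- t] = - TN.[t].
Proof.
rewrite chebyshevT_parity (_ : (-1) ^+ dg n = -1) ?mulN1r //.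
by rewrite -signr_odd /dg addn1 /= mul2n odd_double.
Qed.

Lemma deriv_chebyshevT_cos (x : R) : TN^`().[cos x] * sin x = N * sin (N * x).
Proof.
have h1 : is_derive x (1 : R) (fun y => TN.[cos y]) (TN^`().[cos x] * - sin x).
  have hc : is_derive x (1 : R) (cos : R -> R) (- sin x) by exact: is_derive_cos.
  have hT : is_derive (cos x) (1 : R) (horner TN) TN^`().[cos x] by exact: is_derive_poly.
  exact: is_derive1_comp.
have h2 : is_derive x (1 : R) (fun y : R => cos (N * y)) (- sin (N * x) * N).
  have hl : is_derive x (1 : R) (fun y : R => N * y) N.
    have h := is_deriveZ N (is_derive_id x (1 : R)).
    by apply: is_derive_eq h _; rewrite /GRing.scale /= mulr1.
  have hc : is_derive (N * x) (1 : R) (cos : R -> R) (- sin (N * x)) by exact: is_derive_cos.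
  exact: (is_derive1_comp hc hl).
have E : (fun y => TN.[cos y]) = (fun y : R => cos (N * y)).
  by apply/funext => y; rewrite chebyshevT_cos.
rewrite E in h1; have := derive_val (is_derive := h1); rewrite (derive_val (is_derive := h2)).
lra.
Qed.

Lemma quarter_neq0 : cos (N * (pi / 4)) != 0 /\ sin (N * (pi / 4)) != 0.
Proof.
have h : cos (N * (pi / 4)) = e * sin (N * (pi / 4)) := quarter_eq R n.
have s0 : sin (N * (pi / 4)) != 0.
  apply/eqP => s0; apply: (@cN_sN_neq0 R n (pi / 4)); rewrite /= h s0 mulr0 //.
split=> //; rewrite h mulf_neq0 //; apply/eqP => e0.
by move: ee; rewrite e0 mul0r => /eqP; rewrite eq_sym oner_eq0.
Qed.

Lemma acos_interior (t : R) : t ^+ 2 < 1 -> cos (acos t) = t /\ 0 < sin (acos t).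
Proof.
move=> t2; have : `|t| < 1 by rewrite -(ltr_pXn2r (isT : (0 < 2)%N)) ?nnegrE // expr1n real_normK ?num_real.
rewrite ltr_norml => /andP[t1 t1']; split.
  by rewrite acosK // in_itv /= !ltW.
by apply: sin_gt0_pi; rewrite acos_gt0 ?acos_ltpi // ?t1 ?t1' ?(ltW t1) ?(ltW t1').
Qed.

Lemma deriv_chebyshevT_U (t : R) : t ^+ 2 < 1 ->
  TN^`().[t] = N * (chebyshevU R (dg n)).[t].
Proof.
move=> /acos_interior[ca sa]; apply: (mulIf (lt0r_neq0 sa)).
by have := deriv_chebyshevT_cos (acos t); rewrite -chebyshevU_cos ca mulrA.
Qed.

(** These are the critical points of $T_4$: $\cos(\pi/2)$ and $\pm\cos(\pi/4)$, where $\sin N\tau$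
    is nonzero as $N$ is odd. There $T_N'=NU_{N-1}$, so $T_N'$ does not vanish. *)
Lemma chebyshevU_neq0 (t : R) : t = 0 \/ 2 * (t * t) = 1 -> (chebyshevU R (dg n)).[t] != 0.
Proof.
case=> [->|t2].
  apply/eqP => u0; have := chebyshevU_cos (dg n) (pi / 2 : R).
  rewrite cos_pihalf u0 mul0r -[pi / 2]subr0 sin_compl mulr0 cos0 mulr1 => e0.
  by have := ee; rewrite -e0 mul0r => /eqP; rewrite eq_sym oner_eq0.
have [_ s0] := quarter_neq0; have qU : (chebyshevU R (dg n)).[cos (pi / 4)] != 0.
  by apply/eqP => u0; have := chebyshevU_cos (dg n) (pi / 4 : R); rewrite u0 mul0r => /esym/eqP; apply/negP.
have : (t - cos (pi / 4)) * (t + cos (pi / 4)) = 0 by have := cos_pi4_sqr R; lra.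
move/eqP; rewrite mulf_eq0 subr_eq0 addr_eq0 => /orP[/eqP ->|/eqP ->] //.
rewrite chebyshevU_parity mulf_neq0 // -signr_odd /dg addn1 /= mul2n odd_double /= expr0.
exact: oner_neq0.
Qed.

Lemma deriv_chebyshevT4 (t : R) : T4^`().[t] = 32 * t ^+ 3 - 16 * t.
Proof.
have -> : T4 = 2 *: 'X * (2 *: 'X * (2 *: 'X * 'X - 1) - 'X) - (2 *: 'X * 'X - 1) by [].
by rewrite !poly.derivE !hornerE /=; ring.
Qed.

Lemma poly_curve_immersion (t : R) : derive1 (poly_curve T4 TN C) t != 0.
Proof.
rewrite derive1_poly_curve; apply/eqP => h.
have hN : TN^`().[t] = 0.
  by have := congr1 (@cy R) h; rewrite /poly_curve c_vec3 /cy !mxE.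
have : T4^`().[t] = 0.
  by have := congr1 (@cx R) h; rewrite /poly_curve c_vec3 /cx !mxE.
rewrite deriv_chebyshevT4 => h4.
have : t * (2 * (t * t) - 1) = 0 by have := h4; rewrite !exprS expr0; lra.
move/eqP; rewrite mulf_eq0 subr_eq0 => hor.
have t01 : t = 0 \/ 2 * (t * t) = 1 by case/orP: hor => /eqP; [left|right].
have t2 : t ^+ 2 < 1 by rewrite expr2; case: t01 => [->|]; rewrite ?mul0r ?ltr01 //; lra.
have := chebyshevU_neq0 t01; have := deriv_chebyshevT_U t2; rewrite hN => /esym/eqP.
rewrite mulf_eq0 => /orP[/eqP N0|/eqP ->]; last by rewrite eqxx.
by have := dg_ge1 R n; rewrite N0; lra.
Qed.

(** Equal values of $T_4$ leave $u=\pm t$ or $t^2+u^2=1$. For $u=-t\ne0$ both odd coordinates would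
    vanish: as $T_N$ and $U_{N-1}$ have no common zero in $(-1,1)$, this forces $2t^2=1$, where
    $T_N\ne0$. On the circle the points lie on an outer and an inner strand over one abscissa. *)
Lemma poly_curve_injective : injective (poly_curve T4 TN C).
Proof.
move=> t u h.
have h4 : T4.[t] = T4.[u] by have := congr1 (@cx R) h; rewrite /poly_curve !c_vec3.
have hN : TN.[t] = TN.[u] by have := congr1 (@cy R) h; rewrite /poly_curve !c_vec3.
have hC : C.[t] = C.[u] by have := congr1 (@cz R) h; rewrite /poly_curve !c_vec3.
have Copp (x : R) : C.[- x] = - C.[x] := height_odd n x.
(* t and - t: both odd coordinates would vanish *)
have opp (x : R) : TN.[x] = TN.[- x] -> C.[x] = C.[- x] -> x = 0.
  rewrite TN_odd Copp => hT hH.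
  have T0 : TN.[x] = 0 by lra. have H0 : C.[x] = 0 by lra.
  have x2 : x ^+ 2 < 1.
    rewrite ltNge; apply/negP => x1.
    have nx : 1 <= `|x| by rewrite -(ler_pXn2r (isT : (0 < 2)%N)) ?nnegrE // expr1n real_normK ?num_real.
    have /andP[T1 _] := chebyshevT_ge1 (dg n) nx.
    by move: T1; case: (ger0P x) => _; rewrite ?TN_odd T0; lra.
  have [cx sx] := acos_interior x2.
  move: H0; rewrite horner_height T0 mulr0 add0r => /eqP.
  have U0 : (chebyshevU R (dg n)).[x] != 0.
    apply/eqP => U0; apply: (@cN_sN_neq0 R n (acos x)); split.
      by rewrite /= -chebyshevT_cos cx.
    by rewrite /= -chebyshevU_cos cx U0 mul0r.
  rewrite !mulf_eq0 (negPf U0) (gt_eqF (mu_gt0 R n)) /= orbF subr_eq0 => /orP[/eqP k|/eqP //].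
  have [q0 _] := quarter_neq0.
  have : (x - cos (pi / 4)) * (x + cos (pi / 4)) = 0.
    by have := cos_pi4_sqr R; rewrite expr2 in k; lra.
  have Tq : TN.[cos (pi / 4)] != 0 by rewrite chebyshevT_cos.
  move/eqP; rewrite mulf_eq0 subr_eq0 addr_eq0 => /orP[/eqP xE|/eqP xE]; exfalso.
    by move/eqP: Tq; apply; rewrite -xE.
  by move/eqP: Tq; apply; apply/eqP; rewrite -oppr_eq0 -TN_odd -xE T0.
(* points of equal x-coordinate with |t| = cos a, |u| = sin a *)
have side (x y : R) : x * x + y * y = 1 -> `|y| <= `|x| ->
    TN.[x] = TN.[y] -> C.[x] = C.[y] -> x = y \/ x = - y.
  move=> xy le_yx hT hH.
  pose a := acos `|x|.
  have nx2 : `|x| * `|x| + `|y| * `|y| = 1 by rewrite -!expr2 !real_normK ?num_real // !expr2.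
  have x0 := normr_ge0 x; have y0 := normr_ge0 y.
  have x1 : `|x| <= 1 by nra.
  have xi : -1 <= `|x| <= 1 by rewrite x1 andbT; lra.
  have ca : cos a = `|x| by rewrite acosK // in_itv.
  have [_ /(_ _) aq] := @acos_quarter R `|x| ltac:(by rewrite x0 x1).
  have a4 : a <= pi / 4.
    by apply: aq; have := cos_pi4_sqr R; have := cos_pi4_gt0 R; nra.
  have a0 : 0 <= a := acos_ge0 xi.
  have sa0 : 0 <= sin a by apply: sin_ge0_pi; apply/andP; split; have := pi2; lra.
  have sa : sin a = `|y|.
    have := cos2Dsin2 a; rewrite ca !expr2 => k; nra.
  have [aE|an] := eqVneq a (pi / 4).
    have : sin a = cos a by rewrite aE sin_pi4.
    rewrite sa ca => /eqP; rewrite eqr_norm2 => /orP[/eqP ->|/eqP ->]; first by left.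
    by right; rewrite opprK.
  have a4' : a < pi / 4 by rewrite lt_neqAle an.
  have Yo t' : 0 <= t' -> Yo0 n 1 1 t' = TN.[cos t'].
    by move=> t0; rewrite Yo0E // invr1 mul1r chebyshevT_cos.
  have Zo t' : 0 <= t' -> Zo0 n 1 1 t' = C.[cos t'].
    by move=> t0; rewrite Zo0E // height_cos divr1.
  have Yi : Yi0 n 1 a = TN.[`|y|] by rewrite /Yi0 sa divr1.
  have Zi : Zi0 n 1 a = C.[`|y|] by rewrite /Zi0 sa divr1.
  have w01 : 0 <= (0 : R) <= 1 by rewrite lexx ler01.
  have seg0 (v w : R) : seg 0 v w = v by rewrite /seg subr0 mul1r mul0r addr0.
  (* At time 0 and with all scales equal to 1, the homotopy starts from the curve itself, so sum and
     difference of the two strands are nonzero. *)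
  have F := @F_neq0 R n 1 1 1 (lexx 1) ltr01 ltr01 a 0 ltac:(by rewrite a0 a4') w01.
  have E := @E_neq0 R n 1 1 1 n1 (lexx 1) ltr01 ltr01 a 0 ltac:(by rewrite a0 a4) w01.
  rewrite !seg0 Yo // Zo // Yi Zi ca in F.
  rewrite !seg0 Yo // Zo // Yi Zi ca in E.
  exfalso; move: hT hH F E; case: (ger0P x) => _; case: (ger0P y) => _;
    do ?rewrite TN_odd; do ?rewrite Copp; move=> -> -> F E; solve [apply: F; split; ring | apply: E; split; ring].
have : (t - u) * (t + u) * (t * t + u * u - 1) = 0.
  by move: h4; rewrite !chebyshevT4 !exprS !expr0; lra.
move/eqP; rewrite !mulf_eq0 -orbA.
have oppE : t = - u -> t = u.
  move=> tu; have := opp u; rewrite -tu -hN -hC => /(_ erefl erefl) u0.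
  by rewrite tu u0 oppr0.
case/or3P => /eqP k; [lra|apply: oppE; lra|have tu : t * t + u * u = 1 by lra].
have [ut|/ltW tu'] := leP `|u| `|t|.
  by have [//|/oppE] := side t u tu ut hN hC.
have [->//|k1] := side u t ltac:(by rewrite addrC) tu' (esym hN) (esym hC).
by apply: oppE; rewrite k1 opprK.
Qed.

Lemma poly_curve_embedding : smooth_embedding (poly_curve T4 TN C).
Proof.
split.
- exact: poly_curve_smooth.
- exact: poly_curve_immersion.
- exact: poly_curve_injective.
- exact: poly_curve_continuous.
- apply: proper_embedding; [exact: poly_curve_injective|exact: poly_curve_continuous|].
  exact: poly_curve_proper.
Qed.

End height_embedding.

(** * Choice of the scales and assembly of the isotopy *)

Lemma closed_knot_iso (R : realType) (n : nat) : (1 <= n)%N ->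
  iso R (closed_long_knot (poly_curve (chebyshevT R 4) (chebyshevT R (dg n)) (height R n)))
    (torus_knot 2 (dg n)).
Proof.
move=> n1; pose TN := chebyshevT R (dg n); pose C := height R n.
have ee := eps_sqr R n.
have [sT lT] := size_chebyshevT R (2 * n); have dgS : (2 * n).+1 = dg n by rewrite /dg addn1.
rewrite dgS in sT lT.
have en0 : eps n != 0 :> R by apply/eqP => e0; move: ee; rewrite e0 mul0r => /eqP; rewrite eq_sym oner_eq0.
have [sC lC] := size_height R n.
have [M1 [c1 [c10 g1]]] : exists M c, 0 < c /\ grows (horner TN) M c.
  by apply: poly_grows; rewrite /TN ?sT ?lT ?exprn_gt0 // ltnS /dg addn1.
(* The leading coefficient of [C] has the sign [eps n], so it is [eps n *: C] that grows. *)
have [M2 [c2 [c20 g2]]] : exists M c, 0 < c /\ grows (horner (eps n *: C)) M c.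
  apply: poly_grows; first by rewrite size_scale // /C sC ltnS addn_gt0 orbT.
  rewrite lead_coefZ /C lC mulrCA mulr_gt0 ?exprn_gt0 // mulrDr ee.
  have m0 := mu_gt0 R n; have m1 := mu_lt1 R n.
  by case: (eps_cases R n) => ->; lra.
have To (t : R) : `|TN.[- t]| = `|TN.[t]|.
  by rewrite /TN chebyshevT_parity normrM normrX normrN1 expr1n mul1r.
have Co (t : R) : `|(eps n *: C).[- t]| = `|(eps n *: C).[t]|.
  by rewrite !hornerZ /C height_odd mulrN normrN.
have [A1 hA1] := poly_dominates c10 g1 To.
have [A2 hA2] := poly_dominates c20 g2 Co.
pose T := Num.max 1 (Num.max A1 A2).
have T1 : 1 <= T by rewrite le_max lexx.
have T0 : 0 < T := lt_le_trans ltr01 T1.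
have [MT1 TNT TN_le] := hA1 T ltac:(by rewrite !le_max lexx /= orbT).
have [MT2 CT C_le] := hA2 T ltac:(by rewrite !le_max lexx !orbT).
rewrite hornerZ in CT.
(* The scales $k_y=T_N(T)/T$ and $k_z=\varepsilon C(T)/T$ put the point of parameter $T$ on the
   diagonal ray of direction $(1,1,\varepsilon)$. *)
have kyT : TN.[T] = TN.[T] / T * T by rewrite divfK // gt_eqF.
have kzT : C.[T] = eps n * (eps n * C.[T] / T * T) by rewrite divfK ?gt_eqF // mulrA ee mul1r.
have ky0 : 0 < TN.[T] / T by rewrite divr_gt0.
have kz0 : 0 < eps n * C.[T] / T by rewrite divr_gt0.
have en : `|eps n| = 1 :> R by case: (eps_cases R n) => ->; rewrite ?normrN normr1.
have C_le' (x : R) : `|x| <= T -> `|C.[x]| <= eps n * C.[T].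
  by move=> /C_le; rewrite !hornerZ normrM en mul1r.
have gT : grows (horner TN) T c1 by move=> x y Tx; apply: g1; exact: le_trans Tx.
have gC : grows (fun x => eps n * C.[x]) T c2.
  by move=> x y Tx xy; rewrite -!hornerZ; apply: g2 => //; exact: le_trans Tx.
apply: iso_trans (iso_closed T1 ky0 kz0 kyT kzT TN_le C_le' c10 gT c20 gC) _.
apply: iso_trans (iso_untwisted n1 T1 ky0 kz0 kyT kzT) _.
apply: iso_trans (iso_sym (iso_rotated n T1)) _.
exact: iso_torus.
Qed.

Theorem mainTheorem13 (R : realType) (n N : nat) (hn : (1 <= n)%N)
    (hN : N = (2 * n + 1)%N) :
  exists C : {poly R},
    [/\ forall t : R, C.[- t] = - C.[t],
        size C = (N + 2).+1,
        smooth_embedding (poly_curve (chebyshevT R 4) (chebyshevT R N) C)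
      & isotopic R
          (closed_long_knot (poly_curve (chebyshevT R 4) (chebyshevT R N) C))
          (torus_knot 2 N)].
Proof.
rewrite hN -/(dg n); exists (height R n); split.
- exact: height_odd.
- by have [] := size_height R n.
- exact: poly_curve_embedding.
- exact/iso_isotopic/closed_knot_iso.
Qed.
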